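(* Let $n\ge 2$ be a fixed natural number. For each $\mathbf{d}=(d_1,\dots,d_n)\in\mathbb{N}^n$ let $p=p(\mathbf{d})\in\mathbb{N}$, and let $W=W_{d_1\cdots d_n,p}$ be the multipartite Wishart matrix with its $2^n$ partial transposes $W^\sigma$, $\sigma\in\{0,1\}^n$. Consider the limit in which $d_j\to\infty$ for all $j\in\{1,\dots,n\}$, and suppose that in this limit $\lim \frac{p}{d_1\cdots d_n}=c$ for some $c\in(0,\infty)$. Then the family $\{W^\sigma\}_{\sigma\in\{0,1\}^n}$ of all partial transposes is almost surely asymptotically free.
   Context: Wishart matrices and partial transposes: $G=G_{d_1\cdots d_n,p}$ is a $d_1\cdots d_n\times p$ random matrix whose entries are independent standard complex Gaussian random variables (mean $0$, variance $1$, i.e. $\mathbb{E}(g)=0$, $\mathbb{E}(g^2)=0$, $\mathbb{E}(|g|^2)=1$). The Wishart matrix is $W=W_{d_1\cdots d_n,p}=\frac{1}{d_1\cdots d_n}GG^*\in M_{d_1\cdots d_n}(\mathbb{C})\cong M_{d_1}(\mathbb{C})\otimes\cdots\otimes M_{d_n}(\mathbb{C})$. For $\sigma=(\sigma_1,\dots,\sigma_n)\in\{0,1\}^n$ the partial transpose is $W^\sigma=(T_1^{\sigma_1}\otimes\cdots\otimes T_n^{\sigma_n})(W)$, where $T_j$ is the transpose map on $M_{d_j}(\mathbb{C})$, $T_j^1=T_j$ and $T_j^0=\mathrm{id}$. All the random matrices (for the different $\mathbf{d}$) are defined on a common probability space; no assumption is made on their joint distribution for different $\mathbf{d}$. $\mathrm{tr}=\frac1d\mathrm{Tr}$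 is the normalized trace on $M_d(\mathbb{C})$. The limit is the limit along $\mathbf{d}\in\mathbb{N}^n$ as $\min_j d_j\to\infty$. Almost sure asymptotic freeness: there is a non-commutative probability space $(\mathcal{A},\varphi)$ and a family $(w_\sigma)_{\sigma\in\{0,1\}^n}$ in $\mathcal{A}$ which is freely independent with respect to $\varphi$, such that with probability one, for every $m\in\mathbb{N}$ and all $\epsilon_1,\dots,\epsilon_m\in\{0,1\}^n$, $\lim \mathrm{tr}(W^{\epsilon_1}W^{\epsilon_2}\cdots W^{\epsilon_m})=\varphi(w_{\epsilon_1}w_{\epsilon_2}\cdots w_{\epsilon_m})$. *)

(* Defs.v *)
From HB Require Import structures.
From mathcomp Require Import all_boot all_order all_algebra.
From mathcomp Require Import complex.
From mathcomp Require Import all_classical all_reals all_analysis.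

Set Implicit Arguments.
Unset Strict Implicit.
Unset Printing Implicit Defensive.

Import Order.TTheory GRing.Theory Num.Theory.
Import numFieldNormedType.Exports.

Local Open Scope classical_set_scope.
Local Open Scope ring_scope.
Local Open Scope complex_scope.

Definition all_infty (n : nat) : set_system ('I_n -> nat) :=
  filter_from [set: nat] (fun N => [set d | forall j, (N <= d j)%N]).

Global Instance all_infty_filter (n : nat) : ProperFilter (@all_infty n).
Proof.
apply: filter_from_proper => [|N _]; last by exists (fun=> N) => j /=.
apply: filter_from_filter => [|M N _ _]; first by exists 0%N.
exists (maxn M N) => // d dMN; split=> j; apply: leq_trans (dMN j).
  exact: leq_maxl.
exact: leq_maxr.
Qed.

(** Tensor products: the standard basis of C^{d_0} (x) ... (x) C^{d_{n-1}} is
    indexed by the multi-indices below, and M_{d_0}(C) (x) ... (x)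
    M_{d_{n-1}}(C) is identified with the matrices whose rows and columns are
    the enumerated multi-indices. *)
Definition midx (n : nat) (d : 'I_n -> nat) : finType :=
  {dffun forall j : 'I_n, 'I_(d j)}.

Lemma card_midx (n : nat) (d : 'I_n -> nat) : #|midx d| = (\prod_j d j)%N.
Proof.
by rewrite card_dep_ffun foldrE big_map big_enum; apply: eq_bigr => j _;
  rewrite card_ord.
Qed.

Definition tensmx (C : comPzRingType) (n : nat) (d : 'I_n -> nat)
    (A : forall j, 'M[C]_(d j)) : 'M[C]_(#|midx d|) :=
  \matrix_(x, y)
    \prod_j A j ((enum_val x : midx d) j) ((enum_val y : midx d) j).

(** (L_0 (x) ... (x) L_{n-1})(W), for linear maps L_j on M_{d_j}(C), obtained by
    expanding W in the basis of tensor products of matrix units. *)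
Definition tensmap (C : comPzRingType) (n : nat) (d : 'I_n -> nat)
    (L : forall j, 'M[C]_(d j) -> 'M[C]_(d j)) (W : 'M[C]_(#|midx d|)) :
    'M[C]_(#|midx d|) :=
  \sum_x \sum_y W x y *:
    tensmx (fun j => L j (delta_mx ((enum_val x : midx d) j)
                                   ((enum_val y : midx d) j))).

Definition ptranspose (C : comPzRingType) (n : nat) (d : 'I_n -> nat)
    (s : {ffun 'I_n -> bool}) : 'M[C]_(#|midx d|) -> 'M[C]_(#|midx d|) :=
  tensmap (fun j A => if s j then A^T else A).

Definition wishart (R : realType) (n : nat) (d : 'I_n -> nat) (p : nat)
    (G : 'M[R[i]]_(#|midx d|, p)) : 'M[R[i]]_(#|midx d|) :=
  ((\prod_j d j)%N%:R)^-1 *: (G *m map_mx Num.conj G^T).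

Definition ntr (C : unitRingType) (N : nat) (A : 'M[C]_N) : C :=
  \tr A / N%:R.

Definition plane (R : realType) (z : R[i]) :
    measurableTypeR R * measurableTypeR R :=
  (complex.Re z, complex.Im z).

Definition complex_rv (R : realType) (disp : measure_display)
    (T : measurableType disp) (g : T -> R[i]) : Prop :=
  measurable_fun [set: T] (fun t => plane (g t)).

(** Real and imaginary parts independent N(0, 1/2): [normal_prob] takes the
    mean and the standard deviation. *)
Definition std_complex_gaussian (R : realType) (disp : measure_display)
    (T : measurableType disp) (P : probability T R) (g : T -> R[i]) : Prop :=
  let N := normal_prob 0 (Num.sqrt (2^-1 : R)) in
  complex_rv g /\
  forall B : set (measurableTypeR R * measurableTypeR R), measurable B ->
    P [set t | B (plane (g t))] = (N \x N)%E B.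

Definition independent_complex_rvs (R : realType) (disp : measure_display)
    (T : measurableType disp) (P : probability T R) (I : finType)
    (g : I -> T -> R[i]) : Prop :=
  forall (J : {set I}) (B : I -> set (measurableTypeR R * measurableTypeR R)),
    (forall k, measurable (B k)) ->
    P [set t | forall k, k \in J -> B k (plane (g k t))] =
    (\prod_(k in J) P [set t | B k (plane (g k t))])%E.

Definition std_gaussian_matrix (R : realType) (disp : measure_display)
    (T : measurableType disp) (P : probability T R) (m p : nat)
    (G : T -> 'M[R[i]]_(m, p)) : Prop :=
  (forall i j, std_complex_gaussian P (fun t => G t i j)) /\
  independent_complex_rvs P (fun (k : 'I_m * 'I_p) t => G t k.1 k.2).

Definition gen_subalg (C : nzRingType) (A : algType C) (a : A) : set A :=
  smallest (fun S : set A => GRing.subalg_closed [in S]) [set a].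

Definition free_family (C : nzRingType) (A : algType C) (phi : A -> C)
    (I : eqType) (w : I -> A) : Prop :=
  forall (m : nat) (i : nat -> I) (a : nat -> A),
    (0 < m)%N ->
    (forall k, (k.+1 < m)%N -> i k != i k.+1) ->
    (forall k, (k < m)%N -> gen_subalg (w (i k)) (a k) /\ phi (a k) = 0) ->
    phi (\prod_(0 <= k < m) a k) = 0.

(** The limit is taken in [R[i]^o] because [R[i]] itself carries no topology. *)
Definition as_asymptotically_free (R : realType) (disp : measure_display)
    (T : measurableType disp) (P : probability T R) (D : Type)
    (F : set_system D) (N : D -> nat) (I : eqType)
    (X : forall d : D, I -> T -> 'M[R[i]]_(N d)) : Prop :=
  exists (A : algType R[i]) (phi : {scalar A}) (w : I -> A),
    [/\ phi 1 = 1,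
        free_family phi w &
        {ae P, forall t, forall e : seq I,
          ntr (\prod_(s <- e) X d s t) @[d --> F] -->
            (phi (\prod_(s <- e) w s) : R[i]^o)}].

(* Main.v *)
(** Gaussian integration by parts gives Schwinger-Dyson equations for the
    moments E tr(W^{e_1} ... W^{e_m}): removing the first letter e produces
    (p/N) times the shorter moment plus one term for each later letter t.  If
    t <> e, the two transpositions disagree on some leg j and the term is
    O(1/d_j).  If t = e, it factorizes, up to O(1/min d_j), into a product of
    two moments, because covariances of traces are bounded.  All these
    estimates come from one counting principle: expanding a moment into
    entries of W gives a sum over a finite abelian group, integration by parts
    keeps it of that shape, and the sum is at most a constant times the number
    of points of the group at which every factor is diagonal.

    The limiting recursion couples only equal letters, and this forces the
    alternating products of centred polynomials to have expectation zero.  The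
    limit functional on the free algebra is therefore free.  Finally the
    variance of tr(W^{e_1} ... W^{e_m}) is O(1/N^2) with N = prod_j d_j, and
    sum_d prod_j d_j^-2 is finite, so that almost surely the moments differ
    from their expectations by o(1) along the whole multi-indexed family. *)

Require Import Defs.
From HB Require Import structures.
From mathcomp Require Import all_boot all_order all_algebra.
From mathcomp Require Import complex ring lra zify.
From mathcomp Require finmap monalg bigenough ssrcomplements mpoly.

Set Implicit Arguments.
Unset Strict Implicit.
Unset Printing Implicit Defensive.

Import Order.TTheory GRing.Theory Num.Theory.

Local Open Scope ring_scope.

(** * Moments of Wishart matrices by integration by parts *)

(** Moments are never expanded over permutations or pairings. All that is used of the Gaussian law
    is a derivation with Stein's identity, whose coefficients are nonnegative. Hence every
    expectation of a product of entries is nonnegative, nothing cancels, and sums of expectations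
    can be bounded term by term. Each contraction costs a factor [N^-1], and the counting closes
    because exchanging two right indices multiplies the number of diagonal points by at most [N].
    For this the index set is made an abelian group. The group law has no meaning for the matrices;
    it turns the fibres of a difference of index maps into translates of one another. The delicate
    case is that of two equal letters with some, but not all, legs transposed. If no leg or every
    leg is transposed, a contraction splits exactly into two traces. In the mixed case it identifies
    only half of the index data, and a second integration by parts is needed; its remainder is small
    because the letter has both a transposed and an untransposed leg. *)

Definition zadd (U V : zmodType) (f : U -> V) := forall x y, f (x - y) = f x - f y.

Definition zsub (U : finZmodType) (A : {set U}) :=
  forall x y, x \in A -> y \in A -> x - y \in A.

HB.instance Definition _ (U V : finZmodType) := GRing.Zmodule.on (U * V)%type.

(* The difference [a - b] maps the left-hand set to [M], and any two points of
   a fibre differ by a point of the right-hand set. *)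
Lemma card_swap (U M : finZmodType) (A : {set U}) (a b a' b' : U -> M) :
  zsub A -> zadd a -> zadd b -> zadd a' -> zadd b' ->
  (#|[set x in A | (a x == b' x) && (a' x == b x)]| <=
   #|M| * #|[set x in A | (a x == b x) && (a' x == b' x)]|)%N.
Proof.
move=> As aB bB a'B b'B; set S := [set x in A | _].
rewrite -sum1_card (partition_big (fun x => a x - b x) predT) //=.
rewrite -sum_nat_const; apply: leq_sum => m _; rewrite sum1_card.
have [[x0 /andP[x0S /eqP x0m]]|none] :=
  altP (@existsP _ (fun x0 => (x0 \in S) && (a x0 - b x0 == m))); last first.
  rewrite eq_card0 // => x; apply/negbTE/negP => xS.
  by case/existsP: none; exists x.
rewrite -(card_imset _ (@addIr _ (- x0))); apply: subset_leq_card.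
apply/subsetP => _ /imsetP[x /andP[xS /eqP xm] ->].
move: xS x0S; rewrite !inE => /and3P[xA /eqP x1 /eqP x2] /and3P[x0A /eqP y1 /eqP y2].
have E : a x - a x0 = b x - b x0.
  have /eqP : a x - b x = a x0 - b x0 by rewrite xm.
  by rewrite subr_eq => /eqP ->; rewrite addrC !addrA addNr add0r addrC.
by rewrite As // aB bB a'B b'B x2 y2 -x1 -y1 E !eqxx.
Qed.

Lemma deriv_prod (R : nzRingType) (D : R -> R) (T : Type) (F : T -> R)
    (s : seq T) (x0 : T) :
  (forall f g, D (f * g) = D f * g + f * D g) ->
  D (\prod_(i <- s) F i) = \sum_(k < size s)
    (\prod_(i <- take k s) F i) * D (F (nth x0 s k)) *
    (\prod_(i <- drop k.+1 s) F i).
Proof.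
move=> DM; have D1 : D 1 = 0.
  by apply: (addrI (D 1)); rewrite addr0 -{3}(mulr1 1) DM mulr1 mul1r.
elim: s => [|t s IH]; first by rewrite big_nil big_ord0 D1.
rewrite big_cons DM IH big_ord_recl /= ?take0 ?drop0 big_nil mul1r; congr (_ + _).
by rewrite mulr_sumr; apply: eq_bigr => k _; rewrite big_cons !mulrA.
Qed.

Section Wishart.
Variables (C : numFieldType) (E : Type) (M : finZmodType).
Variables (mix : E -> M -> M -> M).
Variables (Pr : comNzRingType) (EE : {additive Pr -> C}).
Variables (X : M -> M -> Pr) (D : M -> M -> Pr -> Pr) (kap kap0 : C).

Local Notation N := #|M|.

(* [X a b] plays the entry N^-1 sum_r G_ar conj(G_br) of the Wishart matrix, [EE]
   the Gaussian expectation and [D a b] the derivation sum_r conj(G_br) d/dconj(G_ar);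
   [wc_ibp] is Stein's identity.  The partial transpose of type [e] has the entries
   [X (mix e x y) (mix e y x)].  The exact value of [kap] is p / N. *)
Record wishart_calculus : Prop := WishartCalculus {
  wc_kap : 0 <= kap <= kap0;
  wc_E1 : EE 1 = 1;
  wc_DD : forall a b f g, D a b (f + g) = D a b f + D a b g;
  wc_DM : forall a b f g, D a b (f * g) = D a b f * g + f * D a b g;
  wc_DX : forall a b a' b', D a b (X a' b') = (a == b')%:R * X a' b;
  wc_ibp : forall a b F, EE (X a b * F) =
     kap * (a == b)%:R * EE F + N%:R^-1 * EE (D a b F);
  wc_mixB : forall e x y x' y', mix e (x - x') (y - y') = mix e x y - mix e x' y';
  wc_mixxx : forall e x, mix e x x = x;
  wc_mixI : forall e x y, (mix e x y == mix e y x) = (x == y) }.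

Hypothesis wc : wishart_calculus.

Let kapge0 : 0 <= kap. Proof. by have /andP[] := wc_kap wc. Qed.
Let kapkap0 : kap <= kap0. Proof. by have /andP[] := wc_kap wc. Qed.
Let kap0ge0 : 0 <= kap0. Proof. exact: le_trans kapkap0. Qed.
Let Ngt0 : 0 < N%:R :> C.
Proof. by rewrite ltr0n; apply/card_gt0P; exists 0. Qed.
Let Nneq0 : N%:R != 0 :> C. Proof. by rewrite gt_eqF. Qed.

Lemma EE_mulb (b : bool) F : EE (b%:R * F) = b%:R * EE F.
Proof. by case: b; rewrite ?mul1r // !mul0r raddf0. Qed.

(* A factor [X (a u) (b u)] whose indices are additive functions of the
   summation variable [u]; the class of products of such factors is stable
   under integration by parts, which swaps right indices. *)
Record box (U : zmodType) := Box
  { bl : U -> M; br : U -> M; bl_add : zadd bl; br_add : zadd br }.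
Definition boxes (U : zmodType) (s : seq (box U)) (x : U) : Pr :=
  \prod_(b <- s) X (bl b x) (br b x).
Definition balanced (U : zmodType) (x : U) (b : box U) := bl b x == br b x.
Definition sat (U : finZmodType) (A : {set U}) (s : seq (box U)) : {set U} :=
  [set x in A | all (balanced x) s].
Definition bswap (U : zmodType) (b b' : box U) := Box (bl_add b') (br_add b).
Definition splice (U : zmodType) (b : box U) (s : seq (box U)) k :=
  take k s ++ bswap b (nth b s k) :: drop k.+1 s.

Lemma size_splice (U : zmodType) (b : box U) (s : seq (box U)) (k : 'I_(size s)) :
  size (splice b s k) = size s.
Proof.
by rewrite size_cat /= size_drop size_takel ?[(k <= _)%N]ltnW // addnS -addSn subnKC.
Qed.

(** The spectator [F] lets one expansion serve twice: with [F = 1] for bounds on expectations, and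
    with [F] the trace of another word for covariances, where only the last term is new. *)
Lemma boxes_ibp (U : zmodType) (b : box U) (s : seq (box U)) (x : U) (F : Pr) :
  EE (boxes (b :: s) x * F) = kap * (bl b x == br b x)%:R * EE (boxes s x * F) +
  N%:R^-1 * \sum_(k < size s) (bl b x == br (nth b s k) x)%:R *
     EE (boxes (splice b s k) x * F)
  + N%:R^-1 * EE (boxes s x * D (bl b x) (br b x) F).
Proof.
rewrite [boxes _ _]big_cons -mulrA (wc_ibp wc) -!addrA; congr (_ + _).
rewrite (wc_DM wc) raddfD mulrDr; congr (_ * _ + _).
rewrite {1}/boxes (@deriv_prod _ _ _ _ _ b); last exact: (wc_DM wc).
rewrite mulr_suml raddf_sum; apply: eq_bigr => k _.
rewrite (wc_DX wc) -EE_mulb; congr (EE _).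
rewrite /boxes big_cat big_cons /=; ring.
Qed.

Lemma wc_D0 a b : D a b 0 = 0.
Proof. by have /eqP := wc_DD wc a b 0 0; rewrite addr0 -subr_eq subrr => /eqP <-. Qed.

Lemma wc_D1 a b : D a b 1 = 0.
Proof.
have /eqP := wc_DM wc a b 1 1.
by rewrite !mulr1 mul1r -subr_eq subrr => /eqP <-.
Qed.

Lemma wc_Dsum (I : Type) (r : seq I) (P : pred I) (F : I -> Pr) a b :
  D a b (\sum_(i <- r | P i) F i) = \sum_(i <- r | P i) D a b (F i).
Proof. exact: (big_morph (D a b) (wc_DD wc a b) (wc_D0 a b)). Qed.

Lemma boxes_ibp1 (U : zmodType) (b : box U) (s : seq (box U)) (x : U) :
  EE (boxes (b :: s) x) = kap * ((bl b x == br b x)%:R * EE (boxes s x)) +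
  N%:R^-1 * \sum_(k < size s) (bl b x == br (nth b s k) x)%:R *
     EE (boxes (splice b s k) x).
Proof.
rewrite -[boxes _ _]mulr1 boxes_ibp wc_D1 mulr0 raddf0 mulr0 addr0 mulr1 mulrA.
by under eq_bigr do rewrite mulr1.
Qed.

(** Every coefficient of the integration by parts is nonnegative, and each step leaves one factor
    fewer. This positivity is what allows [kap] to be replaced by [kap0] in upper bounds. *)
Lemma EE_boxes_ge0 (U : zmodType) (s : seq (box U)) (x : U) : 0 <= EE (boxes s x).
Proof.
have [m] := ubnP (size s); elim: m s => // m IH [|b s] sm.
  by rewrite /boxes big_nil (wc_E1 wc).
have H t : (size t <= size s)%N -> 0 <= EE (boxes t x).
  by move=> ts; apply: IH; apply: leq_ltn_trans ts sm.
rewrite boxes_ibp1 addr_ge0 //.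
  by rewrite !mulr_ge0 ?H ?ler0n.
rewrite mulr_ge0 ?invr_ge0 ?ler0n // sumr_ge0 // => k _.
by rewrite mulr_ge0 ?ler0n // H // size_splice.
Qed.

(** The rising factorial [kap0 (kap0 + 1) ... (kap0 + m - 1)]: removing one of [m'.+1] factors gives
    one diagonal term of weight at most [kap0] and [m'] exchanges. *)
Fixpoint Kb (m : nat) : C := if m is m'.+1 then (kap0 + m'%:R) * Kb m' else 1.

Lemma Kb_ge0 m : 0 <= Kb m.
Proof. by elim: m => //= m IH; rewrite mulr_ge0 ?addr_ge0 ?ler0n. Qed.

Lemma sat_cons (U : finZmodType) (A : {set U}) b s :
  sat A (b :: s) = sat [set x in A | bl b x == br b x] s.
Proof. by apply/setP => x; rewrite !inE /= andbA. Qed.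

Lemma zsub_eq (U : finZmodType) (A : {set U}) (f g : U -> M) :
  zsub A -> zadd f -> zadd g -> zsub [set x in A | f x == g x].
Proof.
move=> As fB gB x y; rewrite !inE => /andP[xA /eqP xE] /andP[yA /eqP yE].
by rewrite As // fB gB xE yE eqxx.
Qed.

Lemma zsub_sat (U : finZmodType) (A : {set U}) s : zsub A -> zsub (sat A s).
Proof.
move=> As; elim: s A As => [|b s IH] A As; last first.
  by rewrite sat_cons; apply/IH/zsub_eq => //; [exact: bl_add | exact: br_add].
by move=> x y; rewrite !inE !andbT; apply: As.
Qed.

(** The contraction condition together with the balance of the exchanged factor is the left-hand set
    of [card_swap], and the balance of the two original factors is its right-hand set. The factor
    [N] lost here is cancelled by the [N^-1] of the integration by parts. *)
Lemma sat_swap (U : finZmodType) (A : {set U}) (b : box U) (s : seq (box U))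
    (k : 'I_(size s)) : zsub A ->
  (#|sat [set x in A | bl b x == br (nth b s k) x] (splice b s k)| <=
  N * #|sat A (b :: s)|)%N.
Proof.
move=> As; set b' := nth b s k.
have As' : zsub (sat A (take k s ++ drop k.+1 s)) by exact: zsub_sat.
have := card_swap As' (@bl_add _ b) (@br_add _ b) (@bl_add _ b') (@br_add _ b').
set n1 := #|_|; set n2 := (X in (_ <= N * X)%N) => n12.
have -> : #|sat A (b :: s)| = n2.
  rewrite -[in LHS](cat_take_drop k s) (drop_nth b (ltn_ord k)).
  apply: eq_card => x; rewrite !inE /= !all_cat /= /balanced.
  by case: (x \in A); case: (bl b x == _); case: all; case: all; case: (bl b' x == _).
apply: leq_trans n12; rewrite eq_leq //.
apply: eq_card => x; rewrite !inE /= !all_cat /= /balanced /=.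
by case: (x \in A); case: (bl b x == _); case: all; case: all; case: (bl b' x == _).
Qed.

Lemma sum_setb (U : finType) (A : {set U}) (P : pred U) (F : U -> C) :
  \sum_(x in A) (P x)%:R * F x = \sum_(x in [set x in A | P x]) F x.
Proof.
rewrite big_mkcond [RHS]big_mkcond; apply: eq_bigr => x _.
by rewrite inE; case: (x \in A); case: (P x); rewrite /= ?mul1r ?mul0r.
Qed.

Lemma boxes_bound (U : finZmodType) (A : {set U}) (s : seq (box U)) :
  zsub A ->
  \sum_(x in A) EE (boxes s x) <= Kb (size s) * #|sat A s|%:R.
Proof.
have [m] := ubnP (size s); elim: m A s => // m IH A [|b s] sm As.
  rewrite /= mul1r -sum1_card natr_sum big_mkcond [leRHS]big_mkcond /=.
  apply: ler_sum => x _; rewrite inE /= andbT.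
  by case: (x \in A); rewrite // /boxes big_nil (wc_E1 wc).
have H (t : seq (box U)) (A' : {set U}) : (size t <= size s)%N -> zsub A' ->
    \sum_(x in A') EE (boxes t x) <= Kb (size t) * #|sat A' t|%:R.
  by move=> ts; apply: IH; apply: leq_ltn_trans ts sm.
under eq_bigr do rewrite boxes_ibp1.
rewrite big_split /= !mulrDl -!mulr_sumr sum_setb.
apply: lerD.
  rewrite -mulrA; apply: ler_pM => //.
    by apply: sumr_ge0 => x _; exact: EE_boxes_ge0.
  by rewrite sat_cons; apply: H => //; apply: zsub_eq => //; [exact: bl_add | exact: br_add].
rewrite exchange_big /= mulr_sumr -mulrA mulr_natl.
have -> (c : C) : c *+ size s = \sum_(k < size s) c by rewrite sumr_const card_ord.
apply: ler_sum => k _; rewrite ler_pdivrMl // sum_setb mulrCA.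
apply: le_trans (H _ _ _ _) _; rewrite ?size_splice //.
  by apply: zsub_eq => //; [exact: bl_add | exact: br_add].
by rewrite ler_wpM2l ?Kb_ge0 // -natrM ler_nat sat_swap.
Qed.


(** * Words in the partial transposes and covariances of their traces *)

Fixpoint wd (w : seq E) (x y : M) : Pr :=
  if w is e :: w' then \sum_z X (mix e x z) (mix e z x) * wd w' z y
  else (x == y)%:R.

Record wbox (U : zmodType) := WBox { wletter : box U; wword : seq E }.
Definition wboxes (U : zmodType) (s : seq (wbox U)) (x : U) : Pr :=
  \prod_(b <- s) wd (wword b) (bl (wletter b) x) (br (wletter b) x).
Definition wsize (U : zmodType) (s : seq (wbox U)) :=
  (\sum_(b <- s) size (wword b))%N.

Definition bfst (U V : zmodType) (b : box U) : box (U * V)%type.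
Proof.
exists (fun x => bl b x.1) (fun x => br b x.1) => x y;
  [exact: bl_add | exact: br_add].
Defined.
Definition bstep (U : zmodType) (e : E) (b : box U) : box (U * M)%type.
Proof.
exists (fun x => mix e (bl b x.1) x.2) (fun x => mix e x.2 (bl b x.1)) => x y;
by rewrite (bl_add b) (wc_mixB wc).
Defined.
Definition brest (U : zmodType) (b : box U) : box (U * M)%type.
Proof.
exists (fun x => x.2) (fun x => br b x.1) => x y //; exact: br_add.
Defined.
Definition wfst (U V : zmodType) (w : wbox U) : wbox (U * V)%type%type :=
  WBox (bfst V (wletter w)) (wword w).

Lemma sum_setXT (U V : finType) (A : {set U}) (F : U * V -> C) :
  \sum_(u in setX A setT) F u = \sum_(x in A) \sum_y F (x, y).
Proof.
by rewrite pair_big; apply: eq_big => [[x y]|[x y] _]; rewrite ?inE.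
Qed.

Lemma zsub_setXT (U V : finZmodType) (A : {set U}) :
  zsub A -> zsub (setX A [set: V]).
Proof. by move=> As [x y] [x' y']; rewrite !inE !andbT /=; apply: As. Qed.

(* The inner summation variables of the words are adjoined to the group. *)
Lemma wboxes_expand (U : finZmodType) (A : {set U}) (s : seq (box U))
    (t : seq (wbox U)) : zsub A ->
  exists (U' : finZmodType) (A' : {set U'}) (s' : seq (box U')),
    [/\ zsub A', size s' = (size s + wsize t)%N,
      forall F, \sum_(x in A) EE (boxes s x * wboxes t x * F) =
        \sum_(x in A') EE (boxes s' x * F) &
      (#|sat A' s'| <= #|sat A (s ++ map (@wletter U) t)|)%N].
Proof.
have [m] := ubnP (size t + wsize t); elim: m U A s t => // m IH U A s [|[b w] t] tm As.
  exists U, A, s; rewrite /wsize big_nil addn0 cats0; split => // F.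
  by apply: eq_bigr => x _; rewrite /wboxes big_nil mulr1.
case: w tm => [|e w] tm; rewrite /wsize big_cons /= -/(wsize t) in tm *.
  have A0s : zsub [set x in A | bl b x == br b x].
    by apply: zsub_eq => //; [exact: bl_add | exact: br_add].
  have [//|U' [A' [s' [As' ss' Fs' sat']]]] := IH U _ s t _ A0s.
  exists U', A', s'; split => // [F|].
    rewrite -Fs' -sum_setb; apply: eq_bigr => x _; rewrite -EE_mulb; congr (EE _).
    by rewrite /wboxes big_cons /=; ring.
  apply: (leq_trans sat'); rewrite eq_leq //; apply: eq_card => x.
  by rewrite !inE !all_cat /= /balanced; case: (x \in A); case: (bl b x == _); case: all.
pose s1 := bstep e b :: map (bfst M) s.
pose t1 := WBox (brest b) w :: map (wfst M) t.
have wt : wsize (map (wfst M) t) = wsize t by rewrite /wsize big_map.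
have [|U' [A' [s' [As' ss' Fs' sat']]]] := IH _ _ s1 t1 _ (@zsub_setXT _ M _ As).
  by rewrite /= /wsize big_cons /= size_map -/(wsize _) wt; move: tm; rewrite addnS ltnS.
exists U', A', s'; split => // [|F|].
- by rewrite ss' /= size_map /wsize big_cons /= -/(wsize _) wt !addSn addnS.
- rewrite -Fs' sum_setXT; apply: eq_bigr => x _; rewrite -raddf_sum; congr (EE _).
  rewrite /wboxes big_cons /= mulr_suml mulr_sumr mulr_suml; apply: eq_bigr => z _.
  by rewrite /boxes /s1 /t1 !big_cons !big_map /=; ring.
apply: (leq_trans sat').
(* At a diagonal point the balance of the new letter forces the new index to equal the left index of
   [b], so adjoining it creates no further diagonal points. *)
have inj : {in sat (setX A setT) (s1 ++ map (@wletter _) t1) &, injective fst}.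
  move=> [x y] [x' y']; rewrite !inE /= !all_cat /= /balanced /= => h1 h2 xx'.
  move: h1 h2; rewrite xx' => /and5P[_ h _ _ _] /and5P[_ h' _ _ _].
  by move: h h'; rewrite !(wc_mixI wc) => /eqP <- /eqP <-.
rewrite -(card_in_imset inj); apply: subset_leq_card; apply/subsetP => x.
move=> /imsetP[[x' y]]; rewrite !inE /= !all_cat /= /balanced /= => h ->.
move: h => /and5P[/andP[h1 _] h2 h3 h4 h5].
rewrite h1 /=; move: h3; rewrite all_map => ->.
move: h2 h4; rewrite (wc_mixI wc) => /eqP -> -> /=.
by move: h5; rewrite -map_comp !all_map.
Qed.

Lemma wboxes_bound (U : finZmodType) (A : {set U}) (s : seq (box U))
    (t : seq (wbox U)) : zsub A ->
  0 <= \sum_(x in A) EE (boxes s x * wboxes t x) <=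
    Kb (size s + wsize t) * #|sat A (s ++ map (@wletter U) t)|%:R.
Proof.
move=> As; have [U' [A' [s' [As' ss' Fs' sat']]]] := wboxes_expand s t As.
have -> : \sum_(x in A) EE (boxes s x * wboxes t x) = \sum_(x in A') EE (boxes s' x).
  by transitivity (\sum_(x in A) EE (boxes s x * wboxes t x * 1));
    [|rewrite Fs']; apply: eq_bigr => x _; rewrite mulr1.
rewrite sumr_ge0 => [|x _]; last exact: EE_boxes_ge0.
by rewrite (le_trans (boxes_bound _ As')) // ss' ler_wpM2l ?Kb_ge0 // ler_nat.
Qed.

(** This is [D a b] applied to the entry at [(z, z')] of the partial transpose of type [e]. *)
Definition wdX (e : E) a b (z z' : M) : Pr :=
  (a == mix e z' z)%:R * X (mix e z z') b.

Lemma wd_D e0 (v : seq E) a b x y : D a b (wd v x y) =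
  \sum_(k < size v) \sum_(p : M * M)
    wd (take k v) x p.1 * wdX (nth e0 v k) a b p.1 p.2 * wd (drop k.+1 v) p.2 y.
Proof.
elim: v x => [|e v IH] x /=.
  by rewrite big_ord0; case: (x == y); rewrite ?wc_D1 ?wc_D0.
rewrite wc_Dsum big_ord_recl /= ?take0 ?drop0.
under eq_bigr do rewrite (wc_DM wc) (wc_DX wc) IH.
rewrite big_split /=; congr (_ + _).
  rewrite -(pair_bigA _ (fun z z' => (x == z)%:R * wdX e a b z z' * wd v z' y)) /=.
  rewrite [RHS](bigD1 x) //= [X in _ = _ + X]big1 ?addr0 => [|z /negbTE zx].
    by apply: eq_bigr => z' _; rewrite eqxx mul1r.
  by apply: big1 => z' _; rewrite eq_sym zx !mul0r.
under eq_bigr do rewrite mulr_sumr.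
rewrite exchange_big /=; apply: eq_bigr => k _.
under eq_bigr do rewrite mulr_sumr.
rewrite exchange_big /=; apply: eq_bigr => p _.
by rewrite !mulr_suml; apply: eq_bigr => z _; rewrite !mulrA.
Qed.

Definition wtr (w : seq E) : Pr := \sum_x wd w x x.

(** The recursion of [Kb] with a source term: the derivative may also fall on one of the [l] letters
    of the other trace, and [crossing_bound] estimates each such term by [Kb (m' + l)]. *)
Fixpoint Kc (l m : nat) : C :=
  if m is m'.+1 then (kap0 + m'%:R) * Kc l m' + l%:R * Kb (m' + l) else 0.

Section Crossing.
Variable U : finZmodType.
Local Notation V := (U * (M * (M * M)))%type.
Definition bcross (e : E) (b : box U) : box V.
Proof.
exists (fun u => mix e u.2.2.1 u.2.2.2) (fun u => br b u.1) => x y.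
  by rewrite -(wc_mixB wc).
exact: br_add.
Defined.
Definition wleft (w : seq E) : wbox V.
Proof. by apply: (WBox (@Box _ (fun u => u.2.1) (fun u => u.2.2.1) _ _) w). Defined.
Definition wright (w : seq E) : wbox V.
Proof. by apply: (WBox (@Box _ (fun u => u.2.2.2) (fun u => u.2.1) _ _) w). Defined.

(** Differentiating the trace of [v] cuts it open at a letter and adjoins three indices. At a
    diagonal point the two remaining pieces of [v] make these indices equal, and the cut letter then
    identifies them with both indices of [b]. So the diagonal points are still counted by those of
    [b :: s]: unlike an exchange inside [s], a crossing gains no factor [N]. *)
Lemma crossing_bound (v : seq E) (A : {set U}) b (s : seq (box U)) : zsub A ->
  0 <= \sum_(x in A) EE (boxes s x * D (bl b x) (br b x) (wtr v)) <=
   (size v)%:R * Kb (size s + size v) * #|sat A (b :: s)|%:R.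
Proof.
move=> As; case: v => [|e0 v'].
  rewrite /= !mul0r big1 ?lexx // => x _; rewrite /wtr wc_Dsum big1 ?mulr0 ?raddf0 //.
  by move=> y _; rewrite /= eqxx wc_D1.
set v := e0 :: v'.
pose A' k := [set u : V in setX A setT | bl b u.1 == mix (nth e0 v k) u.2.2.2 u.2.2.1].
have A's k : zsub (A' k).
  apply: zsub_eq; first exact: zsub_setXT.
    by move=> x y; rewrite (bl_add b).
  by move=> x y; rewrite -(wc_mixB wc).
pose s' k := bcross (nth e0 v k) b :: map (bfst (M * (M * M))%type) s.
pose t' k := [:: wleft (take k v); wright (drop k.+1 v)].
have -> : \sum_(x in A) EE (boxes s x * D (bl b x) (br b x) (wtr v)) =
    \sum_(k < size v) \sum_(u in A' k) EE (boxes (s' k) u * wboxes (t' k) u).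
  under [RHS]eq_bigr => k _ do rewrite -sum_setb sum_setXT.
  rewrite exchange_big; apply: eq_bigr => x _ /=.
  rewrite /wtr wc_Dsum mulr_sumr raddf_sum.
  transitivity (\sum_y \sum_(k < size v) \sum_(p : M * M) EE (boxes s x *
    (wd (take k v) y p.1 * wdX (nth e0 v k) (bl b x) (br b x) p.1 p.2 *
     wd (drop k.+1 v) p.2 y))).
    apply: eq_bigr => y _; rewrite (wd_D e0) mulr_sumr raddf_sum.
    by apply: eq_bigr => k _; rewrite mulr_sumr raddf_sum.
  rewrite exchange_big; apply: eq_bigr => k _.
  rewrite pair_bigA /=; apply: eq_bigr => [[y [z z']]] _ /=.
  rewrite -EE_mulb; congr (EE _).
  by rewrite /boxes /wboxes /s' /t' !big_cons big_nil !big_map /wdX /=; ring.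
have B k := wboxes_bound (s' k) (t' k) (A's k).
rewrite sumr_ge0 => [|k _]; last by have /andP[] := B k.
rewrite -mulrA mulr_natl.
have -> (c : C) : c *+ size v = \sum_(k < size v) c by rewrite sumr_const card_ord.
apply: ler_sum => k _; have /andP[_] := B k; move/le_trans; apply.
have -> : (size (s' k) + wsize (t' k) = size s + size v)%N.
  rewrite /= size_map /wsize !big_cons big_nil /= addn0 addSn -addnS; congr (_ + _)%N.
  by rewrite size_drop size_takel ?[(k <= _)%N]ltnW // -addnS -[X in _ = X](subnKC (ltn_ord k)) addSn addnS.
rewrite ler_wpM2l ?Kb_ge0 // ler_nat.
have inj : {in sat (A' k) (s' k ++ map (@wletter _) (t' k)) &, injective fst}.
  move=> [x [y [z z']]] [x1 [y1 [z1 z'1]]]; rewrite !inE /= !all_cat /= /balanced /=.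
  move=> h1 h2 xx'; move: h1 h2; rewrite {}xx'.
  move=> /and5P[/andP[_ h2] h3 _ /eqP h4 /andP[/eqP h5 _]].
  move=> /and5P[/andP[_ h2'] h3' _ /eqP h4' /andP[/eqP h5' _]].
  move: h2 h3 h2' h3'; rewrite h5 h4 h5' h4' !(wc_mixxx wc).
  by move=> /eqP <- _ /eqP <- _.
rewrite -(card_in_imset inj); apply: subset_leq_card; apply/subsetP => x.
move=> /imsetP[[x' [y [z z']]]]; rewrite !inE /= !all_cat /= /balanced /= => h ->.
move: h => /and5P[/andP[/andP[-> _] h2] h3 h6 /eqP h4 /andP[/eqP h5 _]].
move: h2 h3; rewrite h5 h4 !(wc_mixxx wc) => /eqP -> -> /=.
by move: h6; rewrite all_map.
Qed.
End Crossing.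

Lemma Kc_ge0 l m : 0 <= Kc l m.
Proof.
by elim: m => //= m IH; rewrite addr_ge0 ?mulr_ge0 ?addr_ge0 ?ler0n ?Kb_ge0.
Qed.

(** The induction of [boxes_bound], run on the difference of two expansions. Diagonal and exchange
    terms reproduce covariances of shorter products; the crossing terms keep their prefactor [N^-1],
    which is the gain over [boxes_bound]. *)
Lemma cov_boxes (U : finZmodType) (v : seq E) (A : {set U}) (s : seq (box U)) :
  zsub A ->
  0 <= \sum_(x in A) (EE (boxes s x * wtr v) - EE (boxes s x) * EE (wtr v)) <=
    Kc (size v) (size s) * (N%:R^-1 * #|sat A s|%:R).
Proof.
have [m] := ubnP (size s); elim: m A s => // m IH A [|b s] sm As.
  rewrite /= mul0r big1 ?lexx // => x _.
  by rewrite /boxes big_nil mul1r (wc_E1 wc) mul1r subrr.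
have H (t : seq (box U)) (A' : {set U}) : (size t <= size s)%N -> zsub A' ->
    0 <= \sum_(x in A') (EE (boxes t x * wtr v) - EE (boxes t x) * EE (wtr v)) <=
    Kc (size v) (size t) * (N%:R^-1 * #|sat A' t|%:R).
  by move=> ts; apply: IH; apply: leq_ltn_trans ts sm.
pose c (t : seq (box U)) x := EE (boxes t x * wtr v) - EE (boxes t x) * EE (wtr v).
have -> : \sum_(x in A) c (b :: s) x =
    kap * \sum_(x in [set x in A | bl b x == br b x]) c s x
    + N%:R^-1 * \sum_(k < size s) \sum_(x in [set x in A | bl b x == br (nth b s k) x])
        c (splice b s k) x
    + N%:R^-1 * \sum_(x in A) EE (boxes s x * D (bl b x) (br b x) (wtr v)).
  under [X in _ = _ + _ * X + _]eq_bigr => k _ do rewrite -sum_setb.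
  rewrite exchange_big -sum_setb !mulr_sumr -!big_split /=; apply: eq_bigr => x _.
  rewrite /c boxes_ibp boxes_ibp1.
  have -> : \sum_(k < size s) (bl b x == br (nth b s k) x)%:R *
      (EE (boxes (splice b s k) x * wtr v) - EE (boxes (splice b s k) x) * EE (wtr v)) =
      \sum_(k < size s) (bl b x == br (nth b s k) x)%:R *
      EE (boxes (splice b s k) x * wtr v) - (\sum_(k < size s)
      (bl b x == br (nth b s k) x)%:R * EE (boxes (splice b s k) x)) * EE (wtr v).
    by rewrite mulr_suml -sumrB; apply: eq_bigr => k _; rewrite mulrBr mulrA.
  by ring.
have Ab : zsub [set x in A | bl b x == br b x].
  by apply: zsub_eq => //; [exact: bl_add | exact: br_add].
have Ak k : zsub [set x in A | bl b x == br (nth b s k) x].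
  by apply: zsub_eq => //; [exact: bl_add | exact: br_add].
have /andP[X1 X2] := crossing_bound v b s As.
have /andP[S1 S2] := H s _ (leqnn _) Ab.
have T (k : 'I_(size s)) := H (splice b s k) _ (eq_leq (size_splice b k)) (Ak k).
have N0 : 0 <= N%:R^-1 :> C by rewrite invr_ge0 ltW.
apply/andP; split.
  rewrite !addr_ge0 ?mulr_ge0 // sumr_ge0 // => k _.
  by have /andP[] := T k.
rewrite /= !mulrDl; apply: lerD; last by rewrite [leRHS]mulrCA ler_wpM2l.
apply: lerD.
  by rewrite -mulrA; apply: ler_pM => //; rewrite sat_cons.
rewrite -mulrA mulr_natl mulr_sumr.
have -> (e : C) : e *+ size s = \sum_(k < size s) e by rewrite sumr_const card_ord.
apply: ler_sum => k _.
have /andP[_ Tk] := T k; rewrite ler_pdivrMl // (le_trans Tk) // size_splice.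
rewrite [leRHS]mulrCA ler_wpM2l ?Kc_ge0 // mulVKf // ler_pdivrMl //.
by rewrite -natrM ler_nat sat_swap.
Qed.

(** A trace has one free index, hence at most [N] diagonal points after expansion, and these cancel
    the [N^-1] of [cov_boxes]. The bound is therefore independent of the dimension. *)
Lemma cov_Tr (u v : seq E) :
  0 <= EE (wtr u * wtr v) - EE (wtr u) * EE (wtr v) <= Kc (size v) (size u).
Proof.
have As : zsub [set: M] by move=> x y; rewrite !inE.
pose b0 : box M := @Box _ id id (fun _ _ => erefl) (fun _ _ => erefl).
have [U' [A' [s' [As' ss' Fs' sat']]]] := wboxes_expand [::] [:: WBox b0 u] As.
have HF F : EE (wtr u * F) = \sum_(x in A') EE (boxes s' x * F).
  rewrite -Fs' mulr_suml raddf_sum; apply: eq_big => [x|x _]; first by rewrite inE.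
  by rewrite /boxes /wboxes big_cons !big_nil mul1r mulr1.
have /andP[C1 C2] := cov_boxes v s' As'.
have <- : \sum_(x in A') (EE (boxes s' x * wtr v) - EE (boxes s' x) * EE (wtr v)) =
    EE (wtr u * wtr v) - EE (wtr u) * EE (wtr v).
  have H1 : EE (wtr u) = \sum_(x in A') EE (boxes s' x).
    by rewrite -[wtr u]mulr1 HF; apply: eq_bigr => x _; rewrite mulr1.
  by rewrite sumrB -HF -mulr_suml -H1.
rewrite C1 (le_trans C2) // ss' /wsize big_cons big_nil addn0 add0n /=.
rewrite ler_piMr ?Kc_ge0 // ler_pdivrMl // mulr1 ler_nat (leq_trans sat') //.
exact: max_card.
Qed.

End Wishart.

(** * Schwinger-Dyson equations with explicit error terms *)

Section SchwingerDyson.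
Variables (C : numFieldType) (J : finType) (M : finZmodType).
Notation E := {ffun J -> bool}.
Variables (mix : E -> M -> M -> M).
Variables (Pr : comNzRingType) (EE : {additive Pr -> C}).
Variables (X : M -> M -> Pr) (D : M -> M -> Pr -> Pr) (kap kap0 : C).
Hypothesis wc : wishart_calculus mix EE X D kap kap0.
(** [L j] reads the component of an index on leg [j], and [dd j] stands for the dimension of that
    leg: two indices agree on leg [j] in at most a fraction [1 / dd j] of all pairs. The single
    quantity [delta] dominates all error terms. *)
Variables (T : eqType) (L : J -> M -> T) (dd : J -> nat) (delta : C).

Local Notation N := #|M|.
Hypothesis mixL : forall j e x y, L j (mix e x y) = if e j then L j y else L j x.
Hypothesis L_inj : forall x y, (forall j, L j x = L j y) -> x = y.
Hypothesis dd_gt0 : forall j, (0 < dd j)%N.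
Hypothesis dd_card : forall j,
  (#|[set p : M * M | L j p.1 == L j p.2]| * dd j <= N ^ 2)%N.
Hypothesis dd_delta : forall j, (dd j)%:R^-1 <= delta.
Hypothesis N_delta : N%:R^-1 <= delta.

Local Notation wd := (wd mix X).
Local Notation Tr := (wtr mix X).
Local Notation dX := (wdX mix X).
Local Notation Kb := (Kb kap0).
Local Notation Kc := (Kc kap0).

Let Ngt0 : 0 < N%:R :> C.
Proof. by rewrite ltr0n; apply/card_gt0P; exists 0. Qed.
Let Nneq0 : N%:R != 0 :> C. Proof. by rewrite gt_eqF. Qed.
Let kapge0 : 0 <= kap. Proof. by have /andP[] := wc_kap wc. Qed.

Lemma wd_cat u v x y : wd (u ++ v) x y = \sum_z wd u x z * wd v z y.
Proof.
elim: u x => [|e u IH] x /=.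
  rewrite (bigD1 x) //= eqxx mul1r big1 ?addr0 // => z /negbTE zx.
  by rewrite eq_sym zx mul0r.
under eq_bigr do rewrite IH mulr_sumr.
rewrite exchange_big; apply: eq_bigr => z _; rewrite mulr_suml.
by apply: eq_bigr => z' _; rewrite mulrA.
Qed.

Lemma wd1 e x y : wd [:: e] x y = X (mix e x y) (mix e y x).
Proof.
rewrite /= (bigD1 y) //= eqxx mulr1 big1 ?addr0 // => z /negbTE zy.
by rewrite zy mulr0.
Qed.

Definition moment w : C := N%:R^-1 * EE (Tr w).

Lemma moment_nil : moment [::] = 1.
Proof.
rewrite /moment /Tr /=; under eq_bigr do rewrite eqxx.
rewrite sumr_const raddfMn (wc_E1 wc); apply: mulVf.
exact: Nneq0.
Qed.

(* The term of the integration by parts in which the first letter [e] of a word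
   is contracted with a later letter [t]; [u1] and [u2] are the words between
   and after them. *)
Definition pairing e t u1 u2 : C := \sum_(y : M * M) \sum_(z : M * M)
  EE (wd u1 y.2 z.1 * dX t (mix e y.1 y.2) (mix e y.2 y.1) z.1 z.2 *
      wd u2 z.2 y.1).

Lemma moment_cons e u : moment (e :: u) = kap * moment u +
  N%:R^-1 ^+ 2 * \sum_(k < size u) pairing e (nth e u k) (take k u) (drop k.+1 u).
Proof.
rewrite /moment; have -> : EE (Tr (e :: u)) = \sum_(y : M * M)
    EE (X (mix e y.1 y.2) (mix e y.2 y.1) * wd u y.2 y.1).
  rewrite /wtr /= raddf_sum -(pair_bigA _ (fun y0 y1 =>
    EE (X (mix e y0 y1) (mix e y1 y0) * wd u y1 y0))) /=.
  by apply: eq_bigr => y _; rewrite raddf_sum.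
have -> : \sum_(k < size u) pairing e (nth e u k) (take k u) (drop k.+1 u) =
    \sum_(y : M * M) EE (D (mix e y.1 y.2) (mix e y.2 y.1) (wd u y.2 y.1)).
  rewrite exchange_big; apply: eq_bigr => y _.
  rewrite (wd_D wc e) raddf_sum; apply: eq_bigr => k _.
  by rewrite raddf_sum.
have -> : EE (Tr u) = \sum_(y : M * M) (y.1 == y.2)%:R * EE (wd u y.2 y.1).
  rewrite -(pair_bigA _ (fun y y' => (y == y')%:R * EE (wd u y' y))) /=.
  rewrite raddf_sum; apply: eq_bigr => y _; rewrite (bigD1 y) //= eqxx mul1r.
  by rewrite big1 ?addr0 // => z /negbTE zy; rewrite eq_sym zy mul0r.
rewrite !mulr_sumr -big_split; apply: eq_bigr => y _ /=.
rewrite (wc_ibp wc) (wc_mixI wc); ring.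
Qed.

Lemma cardL_le j : #|[set p : M * M | L j p.1 == L j p.2]|%:R <= N%:R ^+ 2 * delta.
Proof.
have dj := dd_gt0 j; rewrite -[leRHS]mulr1.
apply: (@le_trans _ _ (N%:R ^+ 2 * (dd j)%:R^-1)); last by rewrite mulr1 ler_wpM2l ?exprn_ge0.
by rewrite ler_pdivlMr ?ltr0n // -natrX -natrM ler_nat.
Qed.

Local Notation V4 := ((M * M) * (M * M))%type.
(** At a diagonal point the words [u1] and [u2] force [z = (y.2, y.1)], and the contraction becomes
    [mix e y.1 y.2 = mix t y.1 y.2]. On a leg where [e] and [t] disagree this says that [y.1] and
    [y.2] agree there, which leaves at most [N ^ 2 * delta] pairs. *)
Lemma pairing_cross (e t : E) (u1 u2 : seq E) j : e j != t j ->
  0 <= N%:R^-1 ^+ 2 * pairing e t u1 u2 <= Kb (size u1 + size u2).+1 * delta.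
Proof.
move=> etj.
pose A : {set V4} := [set u in setT | mix e u.1.1 u.1.2 == mix t u.2.2 u.2.1].
have As : zsub A.
  by apply: zsub_eq => // [x y|x y|x y]; rewrite ?inE //= (wc_mixB wc).
have bl_add : zadd (fun u : V4 => mix t u.2.1 u.2.2) by move=> x y; rewrite -(wc_mixB wc).
have br_add : zadd (fun u : V4 => mix e u.1.2 u.1.1) by move=> x y; rewrite -(wc_mixB wc).
pose b : box M V4 := Box bl_add br_add.
pose w1 : wbox E M V4 := WBox (@Box _ _ (fun u : V4 => u.1.2) (fun u => u.2.1)
  (fun _ _ => erefl) (fun _ _ => erefl)) u1.
pose w2 : wbox E M V4 := WBox (@Box _ _ (fun u : V4 => u.2.2) (fun u => u.1.1)
  (fun _ _ => erefl) (fun _ _ => erefl)) u2.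
have QE : pairing e t u1 u2 =
    \sum_(u in A) EE (boxes X [:: b] u * wboxes mix X [:: w1; w2] u).
  rewrite -sum_setb big_mkcond /= /pairing pair_bigA; apply: eq_bigr => [[[y0 y1] [z z']]] _ /=.
  rewrite inE -EE_mulb; congr (EE _).
  by rewrite /boxes /wboxes !big_cons !big_nil /wdX /=; ring.
have /andP[Q0 Q1] := wboxes_bound wc [:: b] [:: w1; w2] As.
rewrite QE mulr_ge0 ?exprn_ge0 ?invr_ge0 ?ler0n //=.
rewrite exprVn ler_pdivrMl ?exprn_gt0 // (le_trans Q1) //.
have -> : (size [:: b] + wsize [:: w1; w2] = (size u1 + size u2).+1)%N.
  by rewrite /wsize !big_cons big_nil addn0.
rewrite mulrCA; apply: ler_wpM2l; first exact: (Kb_ge0 wc).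
apply: le_trans (cardL_le j); rewrite ler_nat.
have inj : {in sat A ([:: b] ++ map (@wletter _ _ _) [:: w1; w2]) &, injective fst}.
  move=> [[y0 y1] [z z']] [[y0' y1'] [x x']]; rewrite !inE /= /balanced /=.
  move=> /and5P[_ _ /eqP h1 /eqP h2 _] /and5P[_ _ /eqP h3 /eqP h4 _].
  by rewrite -h1 -h3 h2 h4 => -[-> ->].
rewrite -(card_in_imset inj); apply: subset_leq_card; apply/subsetP => x.
move=> /imsetP[[[y0 y1] [z z']]]; rewrite !inE /= /balanced /= => h ->.
move: h => /and5P[/eqP h _ /eqP h1 /eqP h2 _] /=; move: h; rewrite -h1 h2.
move/(congr1 (L j)); rewrite !mixL; move: etj.
by case: (e j); case: (t j) => // _ ->.
Qed.

Lemma mix_false (e : E) x y : (forall j, ~~ e j) -> mix e x y = x.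
Proof. by move=> e0; apply: L_inj => j; rewrite mixL (negbTE (e0 j)). Qed.

Lemma mix_true (e : E) x y : (forall j, e j) -> mix e x y = y.
Proof. by move=> e1; apply: L_inj => j; rewrite mixL e1. Qed.

(** Here [mix e x y = x], so the contraction identifies [y.1] with [z.2] and closes [u2] into a
    loop, while the surviving letter closes [u1]. When every leg is transposed, the two words
    exchange roles. *)
Lemma pairing_false (e : E) u1 u2 : (forall j, ~~ e j) ->
  pairing e e u1 u2 = EE (Tr (rcons u1 e) * Tr u2).
Proof.
move=> e0; rewrite /wtr mulr_suml raddf_sum /pairing.
rewrite -(pair_bigA _ (fun y y' => \sum_z EE (wd u1 y' z.1 *
  dX e (mix e y y') (mix e y' y) z.1 z.2 * wd u2 z.2 y))) /= exchange_big.
apply: eq_bigr => y1 _; rewrite -cats1 wd_cat.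
rewrite mulr_sumr raddf_sum; apply: eq_bigr => y0 _.
rewrite -(pair_bigA _ (fun z z' => EE (wd u1 y1 z *
  dX e (mix e y0 y1) (mix e y1 y0) z z' * wd u2 z' y0))) /=.
rewrite mulr_suml raddf_sum; apply: eq_bigr => z _; have /= -> := wd1 e z y1.
rewrite (bigD1 y0) //= big1 ?addr0 => [|z' /negbTE zy].
  by rewrite /wdX !mix_false // eqxx mul1r.
rewrite /wdX !mix_false // eq_sym zy mul0r mulr0 mul0r raddf0 //.
Qed.

Lemma pairing_true (e : E) u1 u2 : (forall j, e j) ->
  pairing e e u1 u2 = EE (Tr u1 * Tr (e :: u2)).
Proof.
move=> e0; rewrite /wtr mulr_suml raddf_sum /pairing.
rewrite -(pair_bigA _ (fun y y' => \sum_z EE (wd u1 y' z.1 *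
  dX e (mix e y y') (mix e y' y) z.1 z.2 * wd u2 z.2 y))) /= exchange_big.
apply: eq_bigr => y1 _.
rewrite mulr_sumr raddf_sum; apply: eq_bigr => y0 _.
rewrite -(pair_bigA _ (fun z z' => EE (wd u1 y1 z *
  dX e (mix e y0 y1) (mix e y1 y0) z z' * wd u2 z' y0))) /= exchange_big.
rewrite mulr_sumr raddf_sum; apply: eq_bigr => z' _.
rewrite (bigD1 y1) //= big1 ?addr0 => [|z /negbTE zy].
  by rewrite /wdX !mix_true // eqxx mul1r mulrA.
by rewrite /wdX !mix_true // eq_sym zy mul0r mulr0 mul0r raddf0.
Qed.

Lemma wboxes_bound_card (U : finZmodType) (V : finType) (A : {set U}) (f : U -> V)
    (S : {set V}) (s : seq (box M U)) (t : seq (wbox E M U)) :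
  zsub A -> {in sat A (s ++ map (@wletter _ _ _) t) &, injective f} ->
  (forall u, u \in sat A (s ++ map (@wletter _ _ _) t) -> f u \in S) ->
  0 <= \sum_(u in A) EE (boxes X s u * wboxes mix X t u) <=
    Kb (size s + wsize t) * #|S|%:R.
Proof.
move=> As finj fS; have /andP[-> h] /= := wboxes_bound wc s t As.
apply: le_trans h _; apply: ler_wpM2l; first exact: (Kb_ge0 wc).
rewrite ler_nat -(card_in_imset finj); apply: subset_leq_card.
by apply/subsetP => _ /imsetP[u us ->]; apply: fS.
Qed.

Local Notation V6 := ((M * M) * (M * M) * (M * M))%type.

Lemma zadd_mix (U : zmodType) (e : E) (f g : U -> M) :
  zadd f -> zadd g -> zadd (fun u => mix e (f u) (g u)).
Proof. by move=> fB gB x y; rewrite fB gB (wc_mixB wc). Qed.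

Lemma cardL3_le j : #|[set p : M * M * M | L j p.1.1 == L j p.1.2]|%:R <= N%:R ^+ 3 * delta.
Proof.
have -> : [set p : M * M * M | L j p.1.1 == L j p.1.2] =
    setX [set p : M * M | L j p.1 == L j p.2] setT.
  by apply/setP => [[p q]]; rewrite !inE andbT.
rewrite cardsX cardsT natrM exprS mulrC -mulrA ler_wpM2l ?ler0n //.
exact: cardL_le.
Qed.

Definition remainder (e : E) u1 u2 : C := \sum_(y : M * M) \sum_(z : M * M)
  (mix e y.1 y.2 == mix e z.2 z.1)%:R *
  EE (D (mix e z.1 z.2) (mix e y.2 y.1) (wd u1 y.2 z.1 * wd u2 z.2 y.1)).

(** The contraction matches the untransposed legs of [y.1] with [z.2] and the transposed legs of
    [y.2] with [z.1]. A second integration by parts, on the surviving factor, matches the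
    complementary legs in its diagonal term; together they give [y = (z.2, z.1)], and both words
    become traces. *)
Lemma pairing_mixed (e : E) u1 u2 :
  pairing e e u1 u2 = kap * EE (Tr u1 * Tr u2) + N%:R^-1 * remainder e u1 u2.
Proof.
have -> : EE (Tr u1 * Tr u2) = \sum_(y : M * M) \sum_(z : M * M)
    (y == (z.2, z.1))%:R * EE (wd u1 y.2 z.1 * wd u2 z.2 y.1).
  rewrite /wtr mulr_suml raddf_sum exchange_big.
  rewrite -(pair_bigA _ (fun z z' => \sum_(y : M * M) (y == (z', z))%:R *
    EE (wd u1 y.2 z * wd u2 z' y.1))) /=.
  apply: eq_bigr => z _; rewrite mulr_sumr raddf_sum; apply: eq_bigr => z' _.
  rewrite (bigD1 (z', z)) //= eqxx mul1r big1 ?addr0 // => y /negbTE ->.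
  by rewrite mul0r.
rewrite /pairing /remainder !mulr_sumr -big_split; apply: eq_bigr => [[y0 y1]] _ /=.
rewrite !mulr_sumr -big_split; apply: eq_bigr => [[z z']] _ /=.
rewrite /wdX (_ : wd _ _ _ * _ * _ = (mix e y0 y1 == mix e z' z)%:R *
  (X (mix e z z') (mix e y1 y0) * (wd u1 y1 z * wd u2 z' y0))); last by ring.
rewrite EE_mulb (wc_ibp wc) xpair_eqE mulrDr; congr (_ + _); last by ring.
rewrite !mulrA [_ * kap]mulrC -!mulrA; congr (_ * _); rewrite mulrA -natrM mulnb.
congr (_%:R * _); congr (nat_of_bool _).
apply/andP/andP => [[/eqP h1 /eqP h2]|[/eqP -> /eqP ->] //].
suff h k : L k y0 = L k z' /\ L k y1 = L k z.
  by split; apply/eqP/L_inj => k; have [] := h k.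
move/(congr1 (L k)): h1; move/(congr1 (L k)): h2; rewrite !mixL.
by case: (e k) => ? ?; split.
Qed.

Section RemainderBound.
Variables (e t : E) (v1 v2 v3 : seq E).
Let ent (f g : V6 -> M) (fB : zadd f) (gB : zadd g) w : wbox E M V6 :=
  WBox (Box fB gB) w.
Let A : {set V6} := [set u in [set u in setT |
  mix e u.1.1.1 u.1.1.2 == mix e u.1.2.2 u.1.2.1] |
  mix e u.1.2.1 u.1.2.2 == mix t u.2.2 u.2.1].
Let As : zsub A.
Proof.
by do 2?[apply: zsub_eq; [|exact: zadd_mix|exact: zadd_mix]]; move=> x y; rewrite !inE.
Qed.
Let lB : zadd (fun u : V6 => mix t u.2.1 u.2.2). Proof. exact: zadd_mix. Qed.
Let rB : zadd (fun u : V6 => mix e u.1.1.2 u.1.1.1). Proof. exact: zadd_mix. Qed.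
Let b : box M V6 := Box lB rB.
Let y0 : V6 -> M := fun u => u.1.1.1.
Let y1 : V6 -> M := fun u => u.1.1.2.
Let z1 : V6 -> M := fun u => u.1.2.1.
Let z2 : V6 -> M := fun u => u.1.2.2.
Let s1 : V6 -> M := fun u => u.2.1.
Let s2 : V6 -> M := fun u => u.2.2.

(** The case where the second derivative falls on the left word. At a diagonal point three free
    indices [y0], [y1], [z1] remain. On a transposed leg the first contraction gives [y1 = z1], and
    the second equates [y0] with one of them, so [y0] and [y1] agree on that leg. When the
    derivative falls on the right word, the same argument needs an untransposed leg. *)
Lemma remainder_left j : e j -> 0 <= \sum_(u in A) EE (X (mix t u.2.1 u.2.2)
      (mix e u.1.1.2 u.1.1.1) * (wd v1 u.1.1.2 u.2.1 * wd v2 u.2.2 u.1.2.1 *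
      wd v3 u.1.2.2 u.1.1.1)) <=
  Kb (size v1 + size v2 + size v3).+1 * (N%:R ^+ 3 * delta).
Proof.
move=> ej; pose ws := [:: @ent y1 s1 (fun _ _ => erefl) (fun _ _ => erefl) v1;
  @ent s2 z1 (fun _ _ => erefl) (fun _ _ => erefl) v2;
  @ent z2 y0 (fun _ _ => erefl) (fun _ _ => erefl) v3].
have finj : {in sat A ([:: b] ++ map (@wletter _ _ _) ws) &,
    injective (fun u => (y0 u, y1 u, z1 u))}.
  move=> [[[a0 a1] [a2 a3]] [a4 a5]] [[[c0 c1] [c2 c3]] [c4 c5]].
  rewrite !inE /= /balanced /= => /and5P[_ _ /eqP h1 /eqP h2 /andP[/eqP h3 _]].
  move=> /and5P[_ _ /eqP g1 /eqP g2 /andP[/eqP g3 _]].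
  rewrite /y0 /y1 /s1 /s2 /z1 /z2 /= in h1 h2 h3 g1 g2 g3 *.
  by rewrite -h1 h2 h3 -g1 g2 g3 => -[-> -> ->].
have fS u : u \in sat A ([:: b] ++ map (@wletter _ _ _) ws) ->
    (y0 u, y1 u, z1 u) \in [set p : M * M * M | L j p.1.1 == L j p.1.2].
  move: u => [[[a0 a1] [a2 a3]] [a4 a5]].
  rewrite !inE /= /balanced /= => /and5P[/andP[/eqP k1 /eqP k2] _ /eqP h1 /eqP h2 /andP[/eqP h3 _]].
  rewrite /y0 /y1 /s1 /s2 /z1 /z2 /= in h1 h2 h3 *.
  move/(congr1 (L j)): k1; move/(congr1 (L j)): k2; rewrite !mixL ej -h1 h2 h3.
  by case: (t j) => -> // ->.
have /andP[B0 B1] := wboxes_bound_card As finj fS.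
have E1 : \sum_(u in A) EE (boxes X [:: b] u * wboxes mix X ws u) =
  \sum_(u in A) EE (X (mix t u.2.1 u.2.2)
      (mix e u.1.1.2 u.1.1.1) * (wd v1 u.1.1.2 u.2.1 * wd v2 u.2.2 u.1.2.1 *
      wd v3 u.1.2.2 u.1.1.1)).
  apply: eq_bigr => u _; congr (EE _).
  by rewrite /boxes /wboxes /ws !big_cons !big_nil /= !mulr1 !mulrA.
rewrite -E1 B0 (le_trans B1) //.
have -> : (size [:: b] + wsize ws = (size v1 + size v2 + size v3).+1)%N.
  by rewrite /wsize !big_cons big_nil addn0 /= add1n !addnA.
by apply: ler_wpM2l; [exact: (Kb_ge0 wc)|exact: cardL3_le].
Qed.

Lemma remainder_right j : ~~ e j -> 0 <= \sum_(u in A) EE (X (mix t u.2.1 u.2.2)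
      (mix e u.1.1.2 u.1.1.1) * (wd v1 u.1.1.2 u.1.2.1 * wd v2 u.1.2.2 u.2.1 *
      wd v3 u.2.2 u.1.1.1)) <=
  Kb (size v1 + size v2 + size v3).+1 * (N%:R ^+ 3 * delta).
Proof.
move=> /negbTE ej; pose ws := [:: @ent y1 z1 (fun _ _ => erefl) (fun _ _ => erefl) v1;
  @ent z2 s1 (fun _ _ => erefl) (fun _ _ => erefl) v2;
  @ent s2 y0 (fun _ _ => erefl) (fun _ _ => erefl) v3].
have finj : {in sat A ([:: b] ++ map (@wletter _ _ _) ws) &,
    injective (fun u => (y0 u, y1 u, z2 u))}.
  move=> [[[a0 a1] [a2 a3]] [a4 a5]] [[[c0 c1] [c2 c3]] [c4 c5]].
  rewrite !inE /= /balanced /= => /and5P[_ _ /eqP h1 /eqP h2 /andP[/eqP h3 _]].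
  move=> /and5P[_ _ /eqP g1 /eqP g2 /andP[/eqP g3 _]].
  rewrite /y0 /y1 /s1 /s2 /z1 /z2 /= in h1 h2 h3 g1 g2 g3 *.
  by rewrite -h1 -h2 h3 -g1 -g2 g3 => -[-> -> ->].
have fS u : u \in sat A ([:: b] ++ map (@wletter _ _ _) ws) ->
    (y0 u, y1 u, z2 u) \in [set p : M * M * M | L j p.1.1 == L j p.1.2].
  move: u => [[[a0 a1] [a2 a3]] [a4 a5]].
  rewrite !inE /= /balanced /= => /and5P[/andP[/eqP k1 /eqP k2] _ /eqP h1 /eqP h2 /andP[/eqP h3 _]].
  rewrite /y0 /y1 /s1 /s2 /z1 /z2 /= in h1 h2 h3 *.
  move/(congr1 (L j)): k1; move/(congr1 (L j)): k2; rewrite !mixL ej -h1 -h2 h3.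
  by case: (t j) => -> // ->.
have /andP[B0 B1] := wboxes_bound_card As finj fS.
have E1 : \sum_(u in A) EE (boxes X [:: b] u * wboxes mix X ws u) =
  \sum_(u in A) EE (X (mix t u.2.1 u.2.2)
      (mix e u.1.1.2 u.1.1.1) * (wd v1 u.1.1.2 u.1.2.1 * wd v2 u.1.2.2 u.2.1 *
      wd v3 u.2.2 u.1.1.1)).
  apply: eq_bigr => u _; congr (EE _).
  by rewrite /boxes /wboxes /ws !big_cons !big_nil /= !mulr1 !mulrA.
rewrite -E1 B0 (le_trans B1) //.
have -> : (size [:: b] + wsize ws = (size v1 + size v2 + size v3).+1)%N.
  by rewrite /wsize !big_cons big_nil addn0 /= add1n !addnA.
by apply: ler_wpM2l; [exact: (Kb_ge0 wc)|exact: cardL3_le].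
Qed.

Lemma remainder_sum (F : V6 -> Pr) :
  \sum_(u in A) EE (F u) = \sum_(y : M * M) \sum_(z : M * M)
    (mix e y.1 y.2 == mix e z.2 z.1)%:R * \sum_(s : M * M)
    EE ((mix e z.1 z.2 == mix t s.2 s.1)%:R * F (y, z, s)).
Proof.
rewrite /A -!sum_setb big_mkcond /= pair_bigA /=.
under [RHS]eq_bigr do rewrite mulr_sumr.
rewrite pair_bigA; apply: eq_bigr => [[[y z] s]] _.
by rewrite inE /= EE_mulb.
Qed.
End RemainderBound.

Lemma remainder_bound (e : E) u1 u2 j1 j0 : e j1 -> ~~ e j0 ->
  0 <= remainder e u1 u2 <=
   (size u1 + size u2)%:R * Kb (size u1 + size u2) * (N%:R ^+ 3 * delta).
Proof.
move=> ej1 ej0.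
have RE : remainder e u1 u2 =
  \sum_(k < size u1) \sum_(y : M * M) \sum_(z : M * M)
    (mix e y.1 y.2 == mix e z.2 z.1)%:R * \sum_(s : M * M)
    EE ((mix e z.1 z.2 == mix (nth e u1 k) s.2 s.1)%:R *
     (X (mix (nth e u1 k) s.1 s.2) (mix e y.2 y.1) * (wd (take k u1) y.2 s.1 *
      wd (drop k.+1 u1) s.2 z.1 * wd u2 z.2 y.1)))
  + \sum_(k < size u2) \sum_(y : M * M) \sum_(z : M * M)
    (mix e y.1 y.2 == mix e z.2 z.1)%:R * \sum_(s : M * M)
    EE ((mix e z.1 z.2 == mix (nth e u2 k) s.2 s.1)%:R *
     (X (mix (nth e u2 k) s.1 s.2) (mix e y.2 y.1) * (wd u1 y.2 z.1 *
      wd (take k u2) z.2 s.1 * wd (drop k.+1 u2) s.2 y.1))).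
  rewrite [in RHS]exchange_big [X in _ = _ + X]exchange_big -big_split.
  apply: eq_bigr => y _ /=.
  rewrite [in RHS]exchange_big [X in _ = _ + X]exchange_big -big_split.
  apply: eq_bigr => z _ /=.
  rewrite -!mulr_sumr -mulrDr (wc_DM wc) raddfD; congr (_ * (_ + _)).
    rewrite (wd_D wc e) mulr_suml raddf_sum; apply: eq_bigr => k _.
    rewrite mulr_suml raddf_sum; apply: eq_bigr => s _; congr (EE _).
    by rewrite /wdX; ring.
  rewrite (wd_D wc e) mulr_sumr raddf_sum; apply: eq_bigr => k _.
  rewrite mulr_sumr raddf_sum; apply: eq_bigr => s _; congr (EE _).
  by rewrite /wdX; ring.
have c1 (k : 'I_(size u1)) : (size (take k u1) + size (drop k.+1 u1) + size u2).+1
    = (size u1 + size u2)%N.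
  rewrite size_drop size_takel ?[(k <= _)%N]ltnW // -!addSn.
  by rewrite subnKC.
have c2 (k : 'I_(size u2)) : (size u1 + size (take k u2) + size (drop k.+1 u2)).+1
    = (size u1 + size u2)%N.
  rewrite size_drop size_takel ?[(k <= _)%N]ltnW // -addnA -addnS -addSn.
  by rewrite subnKC.
have B1 (k : 'I_(size u1)) := @remainder_left e (nth e u1 k) (take k u1) (drop k.+1 u1) u2 j1 ej1.
have B2 (k : 'I_(size u2)) := @remainder_right e (nth e u2 k) u1 (take k u2) (drop k.+1 u2) j0 ej0.
rewrite RE; under eq_bigr => k _ do rewrite -(remainder_sum e
  (nth e u1 k) (fun u => X (mix (nth e u1 k) u.2.1 u.2.2) (mix e u.1.1.2 u.1.1.1) *
  (wd (take k u1) u.1.1.2 u.2.1 *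
      wd (drop k.+1 u1) u.2.2 u.1.2.1 * wd u2 u.1.2.2 u.1.1.1))).
under [X in _ + X]eq_bigr => k _ do rewrite -(remainder_sum e
  (nth e u2 k) (fun u => X (mix (nth e u2 k) u.2.1 u.2.2) (mix e u.1.1.2 u.1.1.1) *
  (wd u1 u.1.1.2 u.1.2.1 *
      wd (take k u2) u.1.2.2 u.2.1 * wd (drop k.+1 u2) u.2.2 u.1.1.1))).
rewrite addr_ge0; last 2 first.
- by apply: sumr_ge0 => k _; have /andP[] := B1 k.
- by apply: sumr_ge0 => k _; have /andP[] := B2 k.
have nsum l (c : C) : l%:R * c = \sum_(k < l) c.
  by rewrite sumr_const card_ord mulr_natl.
rewrite natrD !mulrDl; apply: lerD; rewrite -mulrA nsum; apply: ler_sum => k _.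
  by have /andP[_] := B1 k; rewrite c1.
by have /andP[_] := B2 k; rewrite c2.
Qed.

(** For powers of a single letter, the first two shapes together with the term [c * m u] give the
    Marchenko-Pastur (free Poisson) recursion of rate [c]. The third gives the recursion of a
    semicircular variable of mean [c] and variance [c]. *)
Definition sdterm (c : C) (m : seq E -> C) (e : E) (u1 u2 : seq E) : C :=
  if [forall j, ~~ e j] then m (rcons u1 e) * m u2
  else if [forall j, e j] then m u1 * m (e :: u2)
  else c * (m u1 * m u2).

(** The sum of the constants of all cases: different letters, no leg transposed, every leg
    transposed, and the two errors of the mixed case. *)
Definition Ksd (l1 l2 : nat) : C :=
  Kb (l1 + l2).+1 + Kc l2 l1.+1 + Kc l2.+1 l1 + kap0 * Kc l2 l1 +
  (l1 + l2)%:R * Kb (l1 + l2).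

Let Vge0 : 0 <= N%:R^-1 :> C. Proof. by rewrite invr_ge0 ltW. Qed.
Let delta_ge0 : 0 <= delta. Proof. exact: le_trans N_delta. Qed.

Lemma moment_cov u v :
  `|N%:R^-1 ^+ 2 * EE (Tr u * Tr v) - moment u * moment v| <=
  Kc (size v) (size u) * delta.
Proof.
have /andP[c0 c1] := cov_Tr wc u v.
have -> : N%:R^-1 ^+ 2 * EE (Tr u * Tr v) - moment u * moment v =
   N%:R^-1 ^+ 2 * (EE (Tr u * Tr v) - EE (Tr u) * EE (Tr v)).
  by rewrite /moment; ring.
rewrite ger0_norm ?mulr_ge0 ?exprn_ge0 // mulrC.
apply: ler_pM => //; first by rewrite exprn_ge0.
rewrite (le_trans _ N_delta) // expr2 ler_piMr // invf_le1 // ler1n.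
by rewrite -(ltr0n C).
Qed.

Let sum5_ge (a b c d e : C) : 0 <= a -> 0 <= b -> 0 <= c -> 0 <= d -> 0 <= e ->
  [/\ a <= a + b + c + d + e, b <= a + b + c + d + e,
      c <= a + b + c + d + e & d + e <= a + b + c + d + e].
Proof.
move=> a0 b0 c0 d0 e0; split.
- by rewrite -!addrA lerDl !addr_ge0.
- by rewrite [a + b]addrC -!addrA lerDl !addr_ge0.
- by rewrite [a + b + c]addrC -!addrA lerDl !addr_ge0.
- by rewrite -addrA lerDr !addr_ge0.
Qed.

Lemma pairing_sdterm (e t : E) u1 u2 :
  `|N%:R^-1 ^+ 2 * pairing e t u1 u2 - (e == t)%:R * sdterm kap moment e u1 u2| <=
  Ksd (size u1) (size u2) * delta.
Proof.
have k0 : 0 <= kap0 by have /andP[h] := wc_kap wc; apply: le_trans.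
set l1 := size u1; set l2 := size u2.
have T1 : 0 <= Kb (l1 + l2).+1 by exact: (Kb_ge0 wc).
have T2 : 0 <= Kc l2 l1.+1 by exact: (Kc_ge0 wc).
have T3 : 0 <= Kc l2.+1 l1 by exact: (Kc_ge0 wc).
have T4 : 0 <= kap0 * Kc l2 l1 by rewrite mulr_ge0 // (Kc_ge0 wc).
have T5 : 0 <= (l1 + l2)%:R * Kb (l1 + l2) by rewrite mulr_ge0 // (Kb_ge0 wc).
have [S1 S2 S3 S4] := sum5_ge T1 T2 T3 T4 T5; rewrite -/(Ksd l1 l2) in S1 S2 S3 S4.
have [<-{t}|et] := eqVneq e t; last first.
  have [j ej] : exists j, e j != t j.
    apply/existsP; apply: contraNT et => /existsPn et.
    by apply/eqP/ffunP => j; apply/eqP; have := et j; rewrite negbK.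
  have /andP[q0 q1] := pairing_cross u1 u2 ej.
  by rewrite mul0r subr0 ger0_norm // (le_trans q1) // ler_wpM2r.
rewrite mul1r /sdterm; case: (boolP [forall j, ~~ e j]) => [/forallP e0|en0].
  by rewrite pairing_false // (le_trans (moment_cov _ _)) // size_rcons ler_wpM2r.
case: (boolP [forall j, e j]) => [/forallP e1|en1].
  by rewrite pairing_true // (le_trans (moment_cov _ _)) // ler_wpM2r.
have [j0 ej0] := forallPn en1; have [j1] := forallPn en0; rewrite negbK => ej1.
have /andP[R0 R1] := remainder_bound u1 u2 ej1 ej0.
rewrite pairing_mixed mulrDr mulrCA addrAC -mulrBr (le_trans (ler_normD _ _)) //.
have c1 := moment_cov u1 u2.
have /andP[kap_ge0 kap_le] := wc_kap wc.
have h1 : `|kap * (N%:R^-1 ^+ 2 * EE (Tr u1 * Tr u2) - moment u1 * moment u2)| <=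
    kap0 * Kc l2 l1 * delta.
  by rewrite normrM (ger0_norm kap_ge0) -mulrA ler_pM.
have h2 : `|N%:R^-1 ^+ 2 * (N%:R^-1 * remainder e u1 u2)| <=
    (l1 + l2)%:R * Kb (l1 + l2) * delta.
  rewrite ger0_norm ?mulr_ge0 ?exprn_ge0 // mulrA -exprSr exprVn ler_pdivrMl ?exprn_gt0 //.
  by rewrite mulrCA.
by rewrite (le_trans (lerD h1 h2)) // -mulrDl ler_wpM2r.
Qed.

Definition Kmom (n : nat) : C := \sum_(k < n) Ksd k (n - k.+1).

Lemma moment_sd e u :
  `|moment (e :: u) - (kap * moment u + \sum_(k < size u)
     (e == nth e u k)%:R * sdterm kap moment e (take k u) (drop k.+1 u))| <=
  Kmom (size u) * delta.
Proof.
rewrite moment_cons addrAC opprD addrA subrr add0r addrC mulr_sumr -sumrB.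
apply: le_trans (ler_norm_sum _ _ _) _; rewrite /Kmom mulr_suml.
apply: ler_sum => k _; apply: le_trans (pairing_sdterm _ _ _ _) _.
by rewrite size_drop size_takel // ltnW.
Qed.

Lemma moment_var u v :
  N%:R^-1 ^+ 2 * EE (Tr u * Tr v) - moment u * moment v <=
  Kc (size v) (size u) * N%:R^-1 ^+ 2.
Proof.
have /andP[c0 c1] := cov_Tr wc u v.
have -> : N%:R^-1 ^+ 2 * EE (Tr u * Tr v) - moment u * moment v =
   N%:R^-1 ^+ 2 * (EE (Tr u * Tr v) - EE (Tr u) * EE (Tr v)).
  by rewrite /moment; ring.
by rewrite mulrC ler_wpM2r ?exprn_ge0.
Qed.
End SchwingerDyson.

(** * Freeness from the limiting recursion *)

Section FreeFunctional.
Variables (C : fieldType) (I : eqType) (phi0 : seq I -> C) (c : C).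
Variables (kappa : I -> C) (nl nr : I -> nat).

Hypothesis phi0_nil : phi0 [::] = 1.
Hypothesis phi0_sd : forall e u, phi0 (e :: u) = c * phi0 u +
  \sum_(k < size u) (e == nth e u k)%:R * (kappa e *
    (phi0 (take k u ++ nseq (nl e) e) * phi0 (nseq (nr e) e ++ drop k.+1 u))).
Hypothesis nr_le1 : forall e, (nr e <= 1)%N.

Local Notation block := (I * {poly C})%type.

(* The value of [phi0] on the word [w] followed by the polynomials [p] in the
   letters [i], for [(i, p)] in [bs]. *)
Fixpoint blk (w : seq I) (bs : seq block) : C :=
  if bs is (i, p) :: bs' then \sum_(r < size p) p`_r * blk (w ++ nseq r i) bs'
  else phi0 w.

Lemma sum_coef_widen (p : {poly C}) n (f : nat -> C) : (size p <= n)%N ->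
  \sum_(r < size p) p`_r * f r = \sum_(r < n) p`_r * f r.
Proof.
move=> pn; rewrite (big_ord_widen_cond n xpredT (fun r => p`_r * f r) pn).
rewrite [LHS]big_mkcond; apply: eq_bigr => r _ /=; case: ltnP => // h.
by rewrite nth_default ?mul0r.
Qed.

Lemma blk_rconsD w bs i p q :
  blk w (rcons bs (i, p + q)) = blk w (rcons bs (i, p)) + blk w (rcons bs (i, q)).
Proof.
elim: bs w => [|[j p'] bs IH] w /=; last first.
  by rewrite -big_split; apply: eq_bigr => r _; rewrite IH mulrDr.
pose n := maxn (size (p + q)) (maxn (size p) (size q)).
rewrite !(@sum_coef_widen _ n (fun r => phi0 (w ++ nseq r i))) ?leq_max ?leqnn ?orbT //.
by rewrite -big_split; apply: eq_bigr => r _; rewrite coefD mulrDl.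
Qed.

Lemma blk_rconsC w bs i a : blk w (rcons bs (i, a%:P)) = a * blk w bs.
Proof.
elim: bs w => [|[j p'] bs IH] w /=; last first.
  by rewrite mulr_sumr; apply: eq_bigr => r _; rewrite IH mulrCA.
rewrite (@sum_coef_widen _ 1 (fun r => phi0 (w ++ nseq r i))) ?size_polyC_leq1 //.
by rewrite big_ord1 coefC cats0.
Qed.

Lemma blk_Xn w i q : blk w [:: (i, 'X^q)] = phi0 (w ++ nseq q i).
Proof.
rewrite /= size_polyXn big_ord_recr /= coefXn eqxx mul1r big1 ?add0r // => r _.
by rewrite coefXn ltn_eqF ?mul0r.
Qed.

(** The contractions of a first letter [e] are sorted by its partner: a letter of [u] for [inner], a
    letter inside a block for [outer]. A partner inside a power cuts that power; [split_power]
    records the two pieces, the left one staying a block and the right one becoming a leading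
    power. *)
Definition inner (e : I) (u : seq I) (bs : seq block) :=
  \sum_(k < size u) (e == nth e u k)%:R * (kappa e *
    (phi0 (take k u ++ nseq (nl e) e) * blk (nseq (nr e) e ++ drop k.+1 u) bs)).

Definition split_power (e : I) (u : seq I) (bs bs' : seq block) (r : nat) :=
  \sum_(l < r) kappa e * (blk u (rcons bs (e, 'X^(l + nl e))) *
    blk (nseq (nr e + (r - l.+1)) e) bs').

Definition outer (e : I) (u : seq I) (bs : seq block) :=
  \sum_(b < size bs) (e == (nth (e, 0) bs b).1)%:R *
  \sum_(r < size (nth (e, 0) bs b).2) (nth (e, 0) bs b).2`_r *
   split_power e u (take b bs) (drop b.+1 bs) r.

Lemma dropl_cat (T : Type) n (s t : seq T) : (n <= size s)%N ->
  drop n (s ++ t) = drop n s ++ t.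
Proof.
rewrite leq_eqVlt drop_cat => /orP[/eqP ->|->] //.
by rewrite ltnn subnn drop0 drop_size.
Qed.

Lemma inner_nseq e u r i bs : inner e (u ++ nseq r i) bs =
  \sum_(k < size u) (e == nth e u k)%:R * (kappa e *
    (phi0 (take k u ++ nseq (nl e) e) *
     blk ((nseq (nr e) e ++ drop k.+1 u) ++ nseq r i) bs)) +
  (e == i)%:R * split_power e u [::] bs r.
Proof.
rewrite /inner size_cat size_nseq big_split_ord /=; congr (_ + _).
  apply: eq_bigr => k _; rewrite nth_cat ltn_ord takel_cat 1?ltnW //.
  by rewrite dropl_cat // catA.
rewrite mulr_sumr; apply: eq_bigr => l _.
rewrite nth_cat ltnNge leq_addr /= addKn nth_nseq ltn_ord.
case: eqVneq => [<-|]; last by rewrite !mul0r.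
rewrite !mul1r; have /= -> := blk_Xn u e (l + nl e); rewrite take_cat ltnNge leq_addr /= addKn.
rewrite drop_cat ltnNge -addnS leq_addr /= addKn.
have -> : take l (nseq r e) = nseq l e by rewrite take_nseq // ltnW.
by rewrite drop_nseq -catA -!nseqD.
Qed.

Lemma blk_sd e u bs :
  blk (e :: u) bs = c * blk u bs + inner e u bs + outer e u bs.
Proof.
elim: bs u => [|[i p] bs IH] u.
  by rewrite /outer big_ord0 addr0 /= phi0_sd.
rewrite [LHS]/=; under eq_bigr do rewrite IH inner_nseq.
rewrite /outer big_ord_recl /= ?take0 ?drop0 addrA.
under eq_bigr do rewrite !mulrDr.
rewrite !big_split /= !addrA; congr (_ + _ + _ + _).
- by rewrite mulr_sumr; apply: eq_bigr => r _; rewrite mulrCA.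
- rewrite /inner; under eq_bigr do rewrite mulr_sumr.
  rewrite exchange_big; apply: eq_bigr => k _ /=.
  rewrite !mulr_sumr; apply: eq_bigr => r _; ring.
- by rewrite mulr_sumr; apply: eq_bigr => r _; rewrite mulrCA.
under eq_bigr do rewrite /outer mulr_sumr.
rewrite exchange_big; apply: eq_bigr => b _ /=.
under [LHS]eq_bigr do rewrite mulrCA.
rewrite -mulr_sumr; congr (_ * _).
under [LHS]eq_bigr do rewrite mulr_sumr.
rewrite exchange_big; apply: eq_bigr => r _ /=.
rewrite /split_power; under [LHS]eq_bigr do rewrite mulrCA.
rewrite -mulr_sumr; congr (_ * _).
under [LHS]eq_bigr do rewrite mulr_sumr.
rewrite exchange_big; apply: eq_bigr => l _ /=.
by rewrite mulr_suml mulr_sumr; apply: eq_bigr => r' _; ring.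
Qed.

Definition centered_block (b : block) := blk [::] [:: b] = 0.
Definition alternating_blocks (i : I) (bs : seq block) :=
  path (fun i j => i != j) i (map fst bs).

(* In [blk_sd] for the letter [i], a block equal to [i] is cut in two, and the
   remaining centred blocks on its right form a shorter alternating product. *)
Lemma blk_centered i r bs : bs != [::] -> alternating_blocks i bs ->
  (forall b, b \in bs -> centered_block b) -> blk (nseq r i) bs = 0.
Proof.
have [m] := ubnP (size bs); elim: m i r bs => // m IHm i r bs.
have [k] := ubnP r; elim: k i r bs => // k IHk i [|r] bs.
  move=> _; case: bs => [|[i1 p] bs] // sm _ /= /andP[_ alt] cen.
  case: bs => [|b bs] in sm alt cen *; first exact: (cen (i1, p) (mem_head _ _)).
  (* With no leading power, the first block is expanded into leading powers of its own letter, in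
     front of a shorter alternating product. *)
  rewrite big1 // => r _; rewrite IHm ?mulr0 // => b' hb'.
  by apply: cen; rewrite in_cons hb' orbT.
rewrite ltnS => rk sm bs0 alt cen.
rewrite (_ : nseq r.+1 i = i :: nseq r i) // blk_sd (IHk i r bs) // mulr0 add0r.
(* By [nr_le1], the power left in front of the blocks is at most [r], so the induction on the power
   applies. *)
rewrite [inner _ _ _]big1 ?add0r; last first.
  move=> l _; rewrite drop_nseq -nseqD (IHk i _ bs) ?mulr0 //.
  have : (l < r)%N by rewrite -[X in (_ < X)%N](size_nseq r i) ltn_ord.
  move: rk (nr_le1 i); clear; lia.
apply: big1 => b _; case: eqVneq => [ib|]; last by rewrite mul0r.
rewrite mul1r big1 // => q _; rewrite [split_power _ _ _ _ _]big1 ?mulr0 // => l _.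
have sb := ltn_ord b; set b0 := nth _ _ _ in ib *.
have bsE : bs = rcons (take b bs) b0 ++ drop b.+1 bs.
  by rewrite cat_rcons -drop_nth // cat_take_drop.
(* If blocks remain to the right of the cut one, the right factor vanishes by induction on the
   number of blocks. Otherwise the left factor has to vanish. *)
have [lastb|notlast] := eqVneq (drop b.+1 bs) [::]; last first.
  rewrite [X in _ * (_ * X)]IHm ?mulr0 //.
  - by rewrite size_drop -ltnS; apply: leq_trans sm; rewrite ltnS ltn_subrL (leq_ltn_trans _ sb).
  - move: alt; rewrite {1}bsE /alternating_blocks map_cat cat_path map_rcons last_rcons.
    by rewrite -ib => /andP[].
  - by move=> b' /mem_drop; exact: cen.
have bE : bs = rcons (take b bs) b0 by rewrite {1}bsE lastb cats0.
(* Alternation starts from [i], so a block in the letter [i] is never the first one. *)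
have tb0 : take b bs != [::].
  apply/eqP => t0; move: alt; rewrite bE t0 /alternating_blocks /= -ib eqxx //.
have altb : alternating_blocks i (take b bs).
  by move: alt; rewrite {1}bE /alternating_blocks map_rcons rcons_path => /andP[].
have lastE : last i (map fst (take b bs)) != i.
  by move: alt; rewrite {1}bE /alternating_blocks map_rcons rcons_path -ib => /andP[].
have cenb b' : b' \in take b bs -> centered_block b' by move=> /mem_take; exact: cen.
(* The truncated power is recentred. Its mean multiplies the product without the last block, which
   vanishes by induction on the blocks; the centred part has a smaller leading power. *)
set Q := 'X^_; rewrite -[Q](subrK (blk [::] [:: (i, Q)])%:P) blk_rconsD blk_rconsC.
have sbs : size (take b bs) = b by rewrite size_takel // ltnW.
rewrite [X in _ + _ * X]IHm // ?sbs ?(leq_trans sb) //.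
rewrite mulr0 addr0 IHk ?mul0r ?mulr0 //.
- by rewrite size_rcons sbs; exact: leq_ltn_trans sb sm.
- by case: (take b bs).
- by rewrite /alternating_blocks map_rcons rcons_path lastE andbT; exact: altb.
move=> b'; rewrite mem_rcons in_cons => /orP[/eqP ->|]; last exact: cenb.
rewrite /centered_block -[[:: _]]/(rcons [::] _) blk_rconsD -polyCN blk_rconsC.
by rewrite /= phi0_nil mulr1 subrr.
Qed.

End FreeFunctional.

(** * The free algebra, with linear functionals prescribed on words *)

Module FreeAlgebra.
Import finmap monalg.

Section FreeAlgebra.
Variables (C : comNzRingType) (I : choiceType).

Lemma malg_scalerAr (a : C) (x y : {malg C[{fmonom I}]}) :
  a *: (x * y) = x * (a *: y).
Proof.
have ax (g : {malg C[{fmonom I}]}) : a *: g = a%:MP * g by rewrite mul_malgC.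
have xa : x * a%:MP = a%:MP * x.
  rewrite [LHS]fgmulgU [RHS]fgmulUg; apply: eq_bigr => k _.
  by rewrite mulrC mul1m mulm1.
by rewrite (ax (x * y)) (ax y) !mulrA xa.
Qed.

Definition free_alg := {malg C[{fmonom I}]}.
HB.instance Definition _ := GRing.Lalgebra.on free_alg.
HB.instance Definition _ :=
  GRing.Lalgebra_isAlgebra.Build C free_alg malg_scalerAr.

Definition word_form (f : seq I -> C) (x : free_alg) : C :=
  mmap idfun (fun m : {fmonom I} => f m) x.

Lemma word_form_additive f : additive (word_form f).
Proof. exact: mmap_is_additive. Qed.

Lemma word_form_scalable f : scalable_for *%R (word_form f).
Proof.
move=> a g; rewrite /word_form (mmapEw (msuppZ_le _ _)) mmapE mulr_sumr.
by apply: eq_bigr => k _; rewrite mcoeffZ mulrA.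
Qed.

HB.instance Definition _ f := GRing.isAdditive.Build
  free_alg C (word_form f) (word_form_additive f).
HB.instance Definition _ f := GRing.isScalable.Build C
  free_alg C *%R (word_form f) (word_form_scalable f).

Lemma free_algebra : exists (A : algType C) (w : I -> A),
  forall f : seq I -> C, exists phi : {scalar A},
  forall s : seq I, phi (\prod_(i <- s) w i) = f s.
Proof.
exists (free_alg : algType C), (fun i => << fmu i >>) => f.
exists (word_form f) => s.
have -> : \prod_(i <- s) (<< fmu i >> : free_alg) = << FMonom s >>.
  elim: s => [|i s IH]; first by rewrite big_nil; congr << _ >>; apply/val_inj; rewrite /= fm1.
  rewrite big_cons IH [LHS]fgmulUU mulr1; congr << _ >>; apply/val_inj.
  by rewrite /= [LHS]fmM fmU.
by rewrite /= /word_form mmapU mul1r.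
Qed.
End FreeAlgebra.
End FreeAlgebra.

(* Polynomials in independent variables that all have the moments [gam]. *)
Record moment_algebra (C : fieldType) (V : finType) (gam : nat -> C) := MomentAlgebra {
  ma_ring : comAlgType C;
  ma_var : V -> ma_ring;
  ma_form : {scalar ma_ring};
  ma_deriv : V -> ma_ring -> ma_ring;
  ma_eval : (V -> C) -> {rmorphism ma_ring -> C};
  ma_formX : forall m : V -> nat,
    ma_form (\prod_x ma_var x ^+ m x) = \prod_x gam (m x);
  ma_derivD : forall x p q, ma_deriv x (p + q) = ma_deriv x p + ma_deriv x q;
  ma_derivM : forall x p q, ma_deriv x (p * q) = ma_deriv x p * q + p * ma_deriv x q;
  ma_derivZ : forall x a p, ma_deriv x (a *: p) = a *: ma_deriv x p;
  ma_derivX : forall x y, ma_deriv x (ma_var y) = (x == y)%:R;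
  ma_evalZ : forall e a p, ma_eval e (a *: p) = a * ma_eval e p;
  ma_evalX : forall e x, ma_eval e (ma_var x) = e x;
  ma_ind : forall Q : ma_ring -> Prop,
    (forall m : V -> nat, Q (\prod_x ma_var x ^+ m x)) ->
    (forall p q, Q p -> Q q -> Q (p + q)) ->
    (forall a p, Q p -> Q (a *: p)) -> forall p, Q p }.

Arguments ma_deriv {C V gam} m0 x p.

(** * Multivariate polynomials with a product moment functional *)

Module MomentPolynomials.
Import bigenough.BigEnough ssrcomplements mpoly.

Section MomentPolynomials.
Variables (C : fieldType) (V : finType) (gam : nat -> C).
Local Notation A := {mpoly C[#|V|]}.

Definition form (p : A) : C := \sum_(m <- msupp p) p@_m * \prod_i gam (m i).

(** A summation range that does not depend on the support of [p] is what makes linearity of [form]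
    provable termwise. *)
Lemma formwE (p : A) k : (msize p <= k)%N ->
  form p = \sum_(m : 'X_{1..#|V| < k}) p@_m * \prod_i gam (m i).
Proof.
pose I : subFinType _ := 'X_{1..#|V| < k}.
move=> le_pk; rewrite /form (big_mksub I) /=; first last.
- by move=> m /msize_mdeg_lt /leq_trans; apply.
- by rewrite msupp_uniq.
by rewrite big_rmcond //= => m /memN_msupp_eq0 ->; rewrite mul0r.
Qed.

Lemma form_linear : scalar form.
Proof.
move=> a p q; pose_big_enough k.
  rewrite !(@formwE _ k) // mulr_sumr -big_split.
  by apply: eq_bigr => m _; rewrite /= mcoeffD mcoeffZ mulrDl mulrA.
by close.
Qed.
HB.instance Definition _ := GRing.isLinear.Build C A C *%R form form_linear.

Lemma formX m : form 'X_[m] = \prod_i gam (m i).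
Proof. by rewrite /form msuppX big_seq1 mcoeffX eqxx mul1r. Qed.

Definition mnm_of (m : V -> nat) : 'X_{1..#|V|} := [multinom m (enum_val i) | i < #|V|].

Lemma prod_var (T : comNzRingType) (F : V -> T) (m : V -> nat) :
  \prod_x F x ^+ m x = \prod_(i < #|V|) F (enum_val i) ^+ m (enum_val i).
Proof. by rewrite (reindex (@enum_val V V)) //; apply: onW_bij; exact: enum_val_bij. Qed.

Lemma mnm_ofE m : \prod_x ('X_(enum_rank x) : A) ^+ m x = 'X_[mnm_of m].
Proof.
rewrite prod_var mpolyXE_id; apply: eq_bigr => i _.
by rewrite enum_valK mnmE.
Qed.

Lemma moment_polynomials : moment_algebra V gam.
Proof.
exists (A : comAlgType C) (fun x => 'X_(enum_rank x)) (form : {scalar A}) (fun x => mderiv (enum_rank x))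
  (fun e => meval (fun i : 'I_#|V| => e (enum_val i)) : {rmorphism A -> C}).
- move=> m; rewrite mnm_ofE [LHS]formX (reindex enum_rank) /=.
    by apply: eq_bigr => x _; rewrite mnmE enum_rankK.
  by apply: onW_bij; exact: enum_rank_bij.
- by move=> x p q; rewrite mderivD.
- by move=> x p q; rewrite mderivM.
- by move=> x a p; rewrite mderivZ.
- move=> x y; rewrite mderivX mnm1E eq_sym (inj_eq enum_rank_inj).
  case: eqVneq => [->|_]; last by rewrite scale0r.
  rewrite scale1r (_ : (_ - _)%MM = 0%MM) ?mpolyX0 //.
  by apply/mnmP => i; rewrite mnmBE subnn mnm0E.
- by move=> e a p; exact: mevalZ.
- by move=> e x; apply: etrans (mevalXU _ _) _; rewrite enum_rankK.
move=> Q QX QD QZ p; rewrite [p]mpolyE.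
have Q0 : Q 0 by rewrite -(scale0r (\prod_x ('X_(enum_rank x) : A) ^+ 0)); apply/QZ/(QX (fun=> 0%N)).
elim/big_ind: _ => // m _; apply: QZ.
have -> : 'X_[m] = \prod_x ('X_(enum_rank x) : A) ^+ m (enum_rank x).
  rewrite (mnm_ofE (fun x => m (enum_rank x))); congr 'X_[_].
  by apply/mnmP => i; rewrite mnmE enum_valK.
exact: QX.
Qed.

End MomentPolynomials.
End MomentPolynomials.

From mathcomp Require Import all_classical all_reals all_analysis.
From mathcomp Require Import measurable_realfun.

Import numFieldNormedType.Exports.

Local Open Scope classical_set_scope.
Local Open Scope ring_scope.

Section FreeFamily.
Variables (C : fieldType) (I : choiceType) (phi0 : seq I -> C) (c : C).
Variables (kappa : I -> C) (nl nr : I -> nat).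
Hypothesis phi0_nil : phi0 [::] = 1.
Hypothesis phi0_sd : forall e u, phi0 (e :: u) = c * phi0 u +
  \sum_(k < size u) (e == nth e u k)%:R * (kappa e *
    (phi0 (take k u ++ nseq (nl e) e) * phi0 (nseq (nr e) e ++ drop k.+1 u))).
Hypothesis nr_le1 : forall e, (nr e <= 1)%N.

Lemma gen_subalg_poly (A : algType C) (w a : A) :
  gen_subalg w a -> exists p : {poly C}, a = horner_alg w p.
Proof.
pose S : set A := [set x | exists p : {poly C}, x = horner_alg w p].
have mS x : (x \in [in S]) <-> S x by split=> [/set_mem|/mem_set].
apply: (smallest_sub (X := S)).
  split.
  - by apply: (mS _).2; exists 1; rewrite rmorph1.
  - move=> b u v /mS[p ->] /mS[q ->]; apply: (mS _).2.
    by exists (b *: p + q); rewrite rmorphD -mul_polyC rmorphM /= horner_algC mulr_algl.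
  - move=> u v /mS[p ->] /mS[q ->]; apply: (mS _).2.
    by exists (p * q); rewrite rmorphM.
by move=> _ ->; exists 'X; rewrite horner_algX.
Qed.

Lemma horner_algE (A : algType C) (w : A) (p : {poly C}) :
  horner_alg w p = \sum_(r < size p) p`_r *: w ^+ r.
Proof.
rewrite -[p in LHS]coefK poly_def rmorph_sum; apply: eq_bigr => r _.
by rewrite -mul_polyC rmorphM /= horner_algC mulr_algl rmorphXn /= horner_algX.
Qed.

Lemma free_realization : exists (A : algType C) (phi : {scalar A}) (w : I -> A),
  [/\ phi 1 = 1, free_family phi w &
      forall s : seq I, phi (\prod_(i <- s) w i) = phi0 s].
Proof.
have [A [w fw]] := FreeAlgebra.free_algebra C I.
have [phi phiE] := fw phi0; exists A, phi, w.
have phi1 : phi 1 = 1 by have := phiE [::]; rewrite big_nil phi0_nil.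
split => // m i a m0 alt cen.
have phiZ (b : C) x : phi (b *: x) = b * phi x by exact: linearZ.
have phi_blk u bs : phi ((\prod_(j <- u) w j) *
    \prod_(b <- bs) horner_alg (w b.1) b.2) = blk phi0 u bs.
  elim: bs u => [|[j p] bs IH] u; first by rewrite big_nil mulr1 phiE.
  rewrite big_cons /= horner_algE mulr_suml mulr_sumr raddf_sum.
  apply: eq_bigr => r _; rewrite -scalerAl -scalerAr; apply: etrans (phiZ _ _) _.
  rewrite -IH; congr (_ * phi _).
  rewrite big_cat mulrA; congr (_ * _ * _).
  by elim: (nat_of_ord r) => [|k IHk]; rewrite ?big_nil ?expr0 // exprS big_cons IHk.
(* Choice asks for a polynomial at every index; beyond [m] the value [0] is a dummy. *)
have ex k : exists q : {poly C}, (k < m)%N -> a k = horner_alg (w (i k)) q.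
  case: (ltnP k m) => [km|_]; last by exists 0.
  by have [/gen_subalg_poly[q ->] _] := cen k km; exists q.
have [p pE] := boolp.choice ex.
pose f k := (i k, p k).
have prodE n : (n <= m)%N -> \prod_(0 <= k < n) a k =
    \prod_(b <- map f (iota 0 n)) horner_alg (w b.1) b.2.
  move=> nm; rewrite big_map /index_iota subn0 big_seq [RHS]big_seq.
  by apply: eq_bigr => k; rewrite mem_iota add0n => /andP[_ kn]; rewrite pE // (leq_trans kn).
have cenf k : (k < m)%N -> blk phi0 [::] [:: f k] = 0.
  move=> km; rewrite -phi_blk big_nil mul1r big_cons big_nil mulr1 /= -pE //.
  by have [] := cen k km.
rewrite prodE //; have := phi_blk [::] (map f (iota 0 m)); rewrite big_nil mul1r => ->.
case: m m0 alt {cen ex pE prodE} cenf => // m _ alt cenf.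
case: m => [|m] in alt cenf *; first exact: (cenf 0%N isT).
(* Expanding the first factor provides the leading power from which [blk_centered] starts. *)
rewrite [LHS](_ : _ = \sum_(r < size (p 0%N)) (p 0%N)`_r *
  blk phi0 (nseq r (i 0%N)) (map f (iota 1 m.+1))) //.
rewrite big1 // => r _.
rewrite (@blk_centered _ _ phi0 c kappa nl nr phi0_nil phi0_sd nr_le1) ?mulr0 //.
  rewrite /alternating_blocks -map_comp.
  apply/(pathP (i 0%N)) => k; rewrite size_map size_iota => km.
  rewrite (nth_map 0%N) ?size_iota // nth_iota // add1n.
  case: k km => [|k] km; first exact: alt.
  have E : nth (i 0%N) (i 0%N :: map (fst \o f) (iota 1 m.+1)) k.+1 = i k.+1.
    rewrite -[LHS]/(nth (i 0%N) (map (fst \o f) (iota 1 m.+1)) k).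
    by rewrite (nth_map 0%N) ?size_iota ?nth_iota ?(ltnW km).
  by rewrite E alt.
move=> b /mapP[k]; rewrite mem_iota => /andP[_ km] ->; exact: cenf.
Qed.
End FreeFamily.

(** * The limiting moments and convergence to them *)

Section LimitMoments.
Variables (C : numFieldType) (J : finType) (c : C).
Local Notation E := {ffun J -> bool}.

(* The recursion is on the length of the word, which bounds the fuel [n]. *)
Fixpoint phi_fuel (n : nat) (w : seq E) : C :=
  match n, w with
  | n'.+1, e :: u => c * phi_fuel n' u + \sum_(k < size u)
      (e == nth e u k)%:R * sdterm c (phi_fuel n') e (take k u) (drop k.+1 u)
  | _, _ => 1
  end.

Definition limit_moment w := phi_fuel (size w) w.

(* The three shapes of [sdterm] (no leg, all legs, or only some legs transposed)
   written uniformly with a coefficient and repetitions of the letter. *)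
Definition weight (e : E) : C :=
  if [forall j, ~~ e j] || [forall j, e j] then 1 else c.
Definition left_pad (e : E) : nat := [forall j, ~~ e j].
Definition right_pad (e : E) : nat := ~~ [forall j, ~~ e j] && [forall j, e j].

Lemma sdtermE (m : seq E -> C) e u1 u2 : sdterm c m e u1 u2 =
  weight e * (m (u1 ++ nseq (left_pad e) e) * m (nseq (right_pad e) e ++ u2)).
Proof.
rewrite /sdterm /weight /left_pad /right_pad.
case: [forall j, ~~ e j] => /=; first by rewrite mul1r cats1.
by case: [forall j, e j] => /=; rewrite cats0 ?mul1r.
Qed.

Lemma eq_sdterm (m m' : seq E -> C) e u1 u2 n :
  (forall w, (size w <= n)%N -> m w = m' w) ->
  (size u1 < n)%N -> (size u2 < n)%N ->
  sdterm c m e u1 u2 = sdterm c m' e u1 u2.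
Proof.
move=> mm' s1 s2; rewrite /sdterm !mm' ?size_rcons //; exact: ltnW.
Qed.

Lemma phi_fuel_enough n w : (size w <= n)%N -> phi_fuel n w = limit_moment w.
Proof.
have [N] := ubnP n; elim: N n w => // N IH [|n] [|e u] nN //= un.
rewrite ltnS in un nN *; rewrite /limit_moment /= IH //; congr (_ + _).
apply: eq_bigr => k _; congr (_ * _).
have ku := ltn_ord k.
apply: (@eq_sdterm _ _ _ _ _ (size u)) => [w wu||].
- by rewrite !IH // ?(leq_trans wu) // (leq_ltn_trans un).
- by rewrite size_takel // ltnW.
- by rewrite size_drop ltn_subrL /= (leq_ltn_trans _ ku).
Qed.

Lemma limit_moment_sd e u : limit_moment (e :: u) = c * limit_moment u +
  \sum_(k < size u) (e == nth e u k)%:R *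
    sdterm c limit_moment e (take k u) (drop k.+1 u).
Proof.
rewrite {1}/limit_moment /=; congr (_ + _); apply: eq_bigr => k _; congr (_ * _).
have ku := ltn_ord k.
apply: (@eq_sdterm _ _ _ _ _ (size u)) => [w wu||].
- exact: phi_fuel_enough.
- by rewrite size_takel // ltnW.
- by rewrite size_drop ltn_subrL /= (leq_ltn_trans _ ku).
Qed.

Lemma moment_cvg (Dt : Type) (F : set_system Dt) (FF : ProperFilter F)
    (m : Dt -> seq E -> C) (kap delta : Dt -> C) (K : nat -> C) :
  kap @ F --> c -> delta @ F --> 0 ->
  (\forall d \near F, m d [::] = 1) ->
  (\forall d \near F, forall e u, `|m d (e :: u) - (kap d * m d u +
      \sum_(k < size u) (e == nth e u k)%:R *
        sdterm (kap d) (m d) e (take k u) (drop k.+1 u))| <= K (size u) * delta d) ->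
  forall w, m d w @[d --> F] --> limit_moment w.
Proof.
move=> kapc delta0 m1 msd w.
have [n] := ubnP (size w); elim: n w => // n IH [|e u] wn.
  by apply: cvg_near_cst; near=> d; rewrite (near m1 d).
rewrite limit_moment_sd.
pose main d := kap d * m d u + \sum_(k < size u) (e == nth e u k)%:R *
        sdterm (kap d) (m d) e (take k u) (drop k.+1 u).
have main_cvg : main d @[d --> F] --> c * limit_moment u +
  \sum_(k < size u) (e == nth e u k)%:R *
    sdterm c limit_moment e (take k u) (drop k.+1 u).
  apply: cvgD; first by apply: cvgM => //; exact: IH.
  apply: cvg_big => [|k _]; first exact: add_continuous.
  apply: cvgM; first exact: cvg_cst.
  have ku := ltn_ord k.
  have st : (size (take k u) < size u)%N by rewrite size_takel // ltnW.
  have sd : (size (drop k.+1 u) < size u)%N.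
    by rewrite size_drop ltn_subrL /= (leq_ltn_trans _ ku).
  have un : (size u < n)%N by [].
  rewrite /sdterm; case: ifP => _.
    by apply: cvgM; apply: IH; rewrite ?size_rcons; [apply: leq_ltn_trans st un|apply: ltn_trans sd un].
  case: ifP => _.
    by apply: cvgM; apply: IH; [apply: ltn_trans st un|apply: leq_ltn_trans sd un].
  by apply: cvgM => //; apply: cvgM; apply: IH; [apply: ltn_trans st un|apply: ltn_trans sd un].
have err : m d (e :: u) - main d @[d --> F] --> (0 : C).
  have Kd : K (size u) * delta d @[d --> F] --> (0 : C).
    by rewrite -[X in _ --> X](mulr0 (K (size u))); apply: cvgM => //; exact: cvg_cst.
  apply/cvgr0Pnorm_lt => eps eps0; have /cvgr0Pnorm_lt/(_ _ eps0) Ke := Kd.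
  near=> d; have xK : `|m d (e :: u) - main d| <= K (size u) * delta d.
    exact: (near msd d).
  (* No sign is assumed for [K] or [delta]: their product is nonnegative because it bounds a
     norm. *)
  apply: le_lt_trans xK _; rewrite -[ltLHS]ger0_norm; first exact: (near Ke d).
  exact: le_trans (near msd d _ e u).
rewrite (_ : m ^~ (e :: u) = fun d => (m d (e :: u) - main d) + main d).
  by rewrite -[X in _ --> X]add0r; exact: cvgD.
by apply/funext => d; rewrite subrK.
Unshelve. all: by end_near.
Qed.
End LimitMoments.

(** * Gaussian expectations of polynomials *)

Section Density.
Context d1 d2 (X : measurableType d1) (Y : measurableType d2) (R : realType).
Variables (P : {measure set X -> \bar R}) (nu : {measure set Y -> \bar R}).
Variables (phi : X -> Y) (w : X -> R).
Hypothesis mphi : measurable_fun [set: X] phi.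
Hypothesis mw : measurable_fun [set: X] w.
Hypothesis w0 : forall x, 0 <= w x.
Hypothesis nuE : forall B, measurable B ->
  nu B = (\int[P]_(x in phi @^-1` B) (w x)%:E)%E.
Local Open Scope ereal_scope.
Import HBNNSimple.

(** This form has three uses: a density on the line ([phi] the identity), the law of a random
    variable ([w = 1]), and independence, where [w] is the product of the other factors. *)
Lemma ge0_integral_density (f : Y -> \bar R) :
  measurable_fun [set: Y] f -> (forall y, 0 <= f y) ->
  \int[nu]_y f y = \int[P]_x (f (phi x) * (w x)%:E).
Proof.
move=> mf f0; pose h := nnsfun_approx measurableT mf.
have -> : \int[nu]_y f y = lim (\int[nu]_y (EFin \o h n) y @[n --> \oo]).
  have fE y : f y = lim ((EFin \o h n) y @[n --> \oo]).
    by apply/esym/cvg_lim => //; exact: cvg_nnsfun_approx.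
  under eq_integral do rewrite fE.
  apply: monotone_convergence => //.
  - by move=> n; apply/measurable_EFinP; exact/measurable_funP.
  - by move=> n y _ //=; rewrite lee_fin.
  - by move=> y _ a b ab; rewrite lee_fin; exact/lefP/nd_nnsfun_approx.
have -> : \int[P]_x (f (phi x) * (w x)%:E) =
    lim (\int[P]_x ((EFin \o h n) (phi x) * (w x)%:E) @[n --> \oo]).
  have fg x : f (phi x) * (w x)%:E = lim ((EFin \o h n) (phi x) * (w x)%:E @[n --> \oo]).
    by apply/esym/cvg_lim => //; apply: cvgeZr => //; exact: cvg_nnsfun_approx.
  under eq_integral do rewrite fg.
  apply: monotone_convergence => //.
  - move=> n; apply/emeasurable_funM; apply/measurable_EFinP => //.
    exact: measurableT_comp.
  - by move=> n x _ /=; rewrite mule_ge0 ?lee_fin.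
  - move=> x _ a b ab /=; rewrite lee_wpmul2r ?lee_fin //.
    exact/lefP/nd_nnsfun_approx.
suff suf n : \int[P]_x ((EFin \o h n) (phi x) * (w x)%:E) =
    \int[nu]_y (EFin \o h n) y.
  by congr (lim (_ @ \oo)); apply/funext => n; rewrite -suf.
transitivity (\int[nu]_y
   (\sum_(r \in range (h n)) (r * \1_(h n @^-1` [set r]) y)%:E)); last first.
  by apply: eq_integral => t tE; rewrite /= fimfunE -fsumEFin.
have indich r : measurable_fun setT (fun y => (r * \1_(h n @^-1` [set r]) y)%:E).
  by apply/measurable_EFinP; exact: measurable_funM.
rewrite ge0_integral_fsum //; last by move=> m y Ey; exact: nnfun_muleindic_ge0.
transitivity (\int[P]_x (\sum_(r \in range (h n))
    (r * \1_(h n @^-1` [set r]) (phi x))%:E * (w x)%:E)).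
  apply: eq_integral => x _.
  rewrite -ge0_mule_fsuml => [|r]; last exact: nnfun_muleindic_ge0.
  by rewrite fsumEFin // -(fimfunE _ (phi x)).
rewrite ge0_integral_fsum //; last 2 first.
  - move=> r; apply: emeasurable_funM; last exact/measurable_EFinP.
    exact: (measurableT_comp (indich r)).
  - by move=> m y Ey; rewrite mule_ge0 ?lee_fin // -lee_fin; exact: nnfun_muleindic_ge0.
apply: eq_fsbigr => r rhn.
have mr : measurable (h n @^-1` [set r]) by exact: measurable_sfunP.
have [->|r0] := eqVneq r 0%R.
  rewrite !integral0_eq // => x _; first by rewrite mul0r.
  by rewrite mul0r mul0e.
have {}r0 : (0 <= r)%R.
  by move: rhn; rewrite inE /= => -[y _ <-].
under [RHS]eq_integral do rewrite EFinM.
rewrite ge0_integralZl //; last exact/measurable_EFinP.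
rewrite integral_indic // setIT nuE //.
under eq_integral do rewrite EFinM -muleA.
rewrite ge0_integralZl //; [|apply: emeasurable_funM; apply/measurable_EFinP => //|
    by move=> x _; rewrite mule_ge0 ?lee_fin]; last exact: measurableT_comp.
congr (_ * _); rewrite [RHS]integral_mkcond; apply: eq_integral => x _.
rewrite patchE indicE /=; have [/[!inE] xh|/negP xh] := boolP (x \in phi @^-1` (h n @^-1` [set r])).
  by rewrite mem_set // mul1e.
by rewrite memNset ?mul0e // => hx; apply: xh; rewrite inE.
Qed.

Lemma integral_density (f : Y -> R) : measurable_fun [set: Y] f ->
  P.-integrable setT (fun x => (f (phi x) * w x)%:E) ->
  nu.-integrable setT (EFin \o f) /\
  \int[nu]_y (f y)%:E = \int[P]_x (f (phi x) * w x)%:E.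
Proof.
move=> mf fw; have mEf : measurable_fun setT (EFin \o f) by exact/measurable_EFinP.
split.
  apply/integrableP; split => //=.
  have /integrableP[_] := fw; apply: le_lt_trans.
  rewrite ge0_integral_density //; last by apply/measurable_EFinP; exact: measurableT_comp.
  rewrite le_eqVlt; apply/orP; left; apply/eqP; apply: eq_integral => x _ /=.
  by rewrite -EFinM normrM (ger0_norm (w0 x)).
rewrite integralE [RHS]integralE; congr (_ - _).
  rewrite ge0_integral_density //; last exact: measurable_funepos.
  apply: eq_integral => x _; rewrite !funeposE -!EFin_max -EFinM.
  by rewrite maxr_pMl // mul0r.
rewrite ge0_integral_density //; last exact: measurable_funeneg.
apply: eq_integral => x _; rewrite !funenegE -!EFinN -!EFin_max -EFinM.
by rewrite maxr_pMl // mul0r mulNr.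
Qed.

End Density.

(** * Moments of the centred normal law of variance 1/2 *)

Section GaussMoments.
Variable R : realType.
Notation mu := (@lebesgue_measure R).

(** For variance 1/2 the normal density is proportional to [expR (- x ^+ 2)]. *)
Definition gmono (k : nat) (x : R) : R := x ^+ k * expR (- x ^+ 2).

Lemma pow_expR (k : nat) : exists C : R,
  forall x : R, `|x| ^+ k <= C * expR (x ^+ 2 / 2).
Proof.
(* The choice of [m] makes [expR (x ^+ 2 / 2)] the power [k.+1] of [expR (x ^+ 2 / m)], and each
   such factor times [m] dominates both [1] and [|x|]. *)
pose m : R := k.+1%:R * 2.
have m0 : 0 < m by rewrite mulr_gt0 // ltr0n.
exists (m ^+ k.+1) => x.
have -> : expR (x ^+ 2 / 2) = expR (x ^+ 2 / m) ^+ k.+1.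
  rewrite -expRM_natl; congr expR; rewrite /m -mulr_natl; field.
  by rewrite -(natrD _ 1) pnatr_eq0.
have m1 : 1 <= m * expR (x ^+ 2 / m).
  apply: mulr_ege1.
    by rewrite /m -natrM ler1n muln_gt0.
  by rewrite -expR0 ler_expR divr_ge0 ?sqr_ge0 // ltW.
have h2 : `|x| <= m * expR (x ^+ 2 / m).
  have [x1|x1] := lerP `|x| 1; first exact: le_trans m1.
  have x2 : `|x| <= x ^+ 2.
    rewrite -(real_normK (num_real x)) expr2; apply: ler_peMr => //; exact: ltW.
  have := expR_ge1Dx (x ^+ 2 / m); rewrite -(ler_pM2l m0); apply: le_trans.
  rewrite mulrDr mulrCA divff ?gt_eqF // mulr1 mulr1 (le_trans x2) // lerDr.
  exact: ltW.
rewrite -exprMn (@le_trans _ _ ((m * expR (x ^+ 2 / m)) ^+ k)) //.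
  by rewrite lerXn2r ?nnegrE // (le_trans _ h2).
by rewrite [leRHS]exprS ler_peMl // exprn_ge0 // (le_trans _ h2).
Qed.

Lemma derive_gmono (k : nat) (x : R) :
  is_derive x 1 (gmono k) (k%:R * gmono k.-1 x - 2 * gmono k.+1 x).
Proof.
have d1 : is_derive x (1:R) (fun x : R => x ^+ k : R) (k%:R * x ^+ k.-1 : R).
  apply: DeriveDef; first exact: exprn_derivable.
  by rewrite exp_derive; apply: mulr1.
have d2 : is_derive x (1:R) (fun x : R => - x ^+ 2 : R) (- (2 * x) : R).
  apply: is_deriveN; apply: DeriveDef; first exact: exprn_derivable.
  by rewrite exp_derive /GRing.scale /= mulr1 expr1.
have d3 : is_derive x (1:R) (fun x : R => expR (- x ^+ 2)) (expR (- x ^+ 2) * - (2 * x)).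
  exact: (@is_derive1_comp _ expR (fun x : R => - x ^+ 2)).
have d4 := is_deriveM d1 d3.
apply: (is_derive_eq d4); rewrite /gmono /GRing.scale /= [x ^+ k.+1]exprS; ring.
Qed.

Lemma measurable_gmono k : measurable_fun [set: R] (gmono k).
Proof.
apply: measurable_funM; first exact: exprn_measurable.
apply: measurableT_comp => //; apply: measurableT_comp => //.
Qed.

Lemma integrable_gauss2 : mu.-integrable [set: R] (fun x => (expR (- (x ^+ 2 / 2)))%:E).
Proof.
have := integrableZl measurableT (normal_peak (1:R))^-1 (integrable_normal_pdf (0 : R) 1).
apply: eq_integrable => // x _ /=; rewrite -EFinM; congr EFin.
rewrite normal_pdfE ?oner_neq0 // /normal_fun subr0 expr1n mulrA mulVf ?mul1r ?mulNr //.
by rewrite gt_eqF // normal_peak_gt0 // oner_neq0.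
Qed.

Lemma gmono_bound k : exists C : R, forall x, `|gmono k x| <= C * expR (- (x ^+ 2 / 2)).
Proof.
have [C Ck] := pow_expR k; exists C => x.
rewrite /gmono normrM normrX (ger0_norm (expR_ge0 _)).
have -> : expR (- x ^+ 2) = expR (- (x ^+ 2 / 2)) * expR (- (x ^+ 2 / 2)).
  by rewrite -expRD; congr expR; lra.
rewrite mulrA ler_wpM2r ?expR_ge0 //.
by rewrite expRN ler_pdivrMr ?expR_gt0.
Qed.

Lemma integrable_gmono k : mu.-integrable [set: R] (fun x => (gmono k x)%:E).
Proof.
have [C Ck] := gmono_bound k.
apply: le_integrable (integrableZl measurableT C integrable_gauss2) => //.
  by apply/measurable_EFinP; exact: measurable_gmono.
move=> x _ /=; rewrite lee_fin (le_trans (Ck x)) //.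
exact: ler_norm.
Qed.

(** Prescribing only [|u n|] covers both endpoints of a growing symmetric interval. *)
Lemma gmono_cvg0 k (u : nat -> R) : (forall n, `|u n| = n%:R) ->
  gmono k (u n) @[n --> \oo] --> (0 : R).
Proof.
move=> un; have [C Ck] := gmono_bound k.+1.
have C0 : 0 <= C.
  by have := le_trans (normr_ge0 _) (Ck 0); rewrite pmulr_lge0 ?expR_gt0.
apply/cvgr0Pnorm_le => e e0; near=> n.
have n0 : 0 < n%:R :> R by near: n; exists 1%N => // n /= n1; rewrite ltr0n.
have -> : `|gmono k (u n)| = n%:R^-1 * `|gmono k.+1 (u n)|.
  by rewrite /gmono [_ ^+ k.+1]exprS -mulrA [in RHS]normrM un mulKf // gt_eqF.
rewrite ler_pdivrMl // (le_trans (Ck _)) //.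
rewrite (@le_trans _ _ C) //.
  rewrite ler_piMr // -expR0 ler_expR oppr_le0 divr_ge0 ?sqr_ge0 //.
rewrite -ler_pdivrMr //; near: n; exact: nbhs_infty_ger.
Unshelve. all: by end_near. Qed.

Lemma continuous_gmono k : continuous (gmono k).
Proof.
move=> x; apply: differentiable_continuous; apply/derivable1_diffP.
by have [] := derive_gmono k x.
Qed.

(** The integrand is the derivative of [gmono k]: the boundary terms on symmetric intervals vanish
    in the limit, and dominated convergence gives the integral over the line. For [k = 0] the
    coefficient kills the term in [k.-1]. *)
Lemma integral_gmono_derive k :
  (\int[mu]_x (k%:R * gmono k.-1 x - 2 * gmono k.+1 x)%:E = 0)%E.
Proof.
pose h x := k%:R * gmono k.-1 x - 2 * gmono k.+1 x.
have hi : mu.-integrable [set: R] (EFin \o h).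
  have := integrableB measurableT
    (integrableZl measurableT k%:R (integrable_gmono k.-1))
    (integrableZl measurableT 2 (integrable_gmono k.+1)).
  by apply: eq_integrable.
have mh : measurable_fun setT h.
  by apply/measurable_EFinP; have /integrableP[] := hi.
have ch : continuous h.
  move=> x; apply: cvgB; apply: cvgM; try exact: cvg_cst; exact: continuous_gmono.
pose I (n : nat) := `[- n.+1%:R, n.+1%:R]%classic : set R.
have FTC n : (\int[mu]_(x in I n) (h x)%:E = (gmono k n.+1%:R - gmono k (- n.+1%:R))%:E)%E.
  rewrite EFinB; apply: continuous_FTC2.
  - by rewrite gtrN ?ltr0n.
  - exact: continuous_subspaceT.
  - split; first by move=> x _; have [] := derive_gmono k x.
      by apply: cvg_at_right_filter; exact: continuous_gmono.
    by apply: cvg_at_left_filter; exact: continuous_gmono.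
  - by move=> x _; rewrite derive1E; have [_ ->] := derive_gmono k x.
have mI n : measurable (I n) by exact: measurable_itv.
pose hI n x := (h x * \1_(I n) x)%:E.
have mhI n : measurable_fun setT (hI n).
  by apply/measurable_EFinP; apply: measurable_funM.
have mhE : measurable_fun setT (EFin \o h) by apply/measurable_EFinP.
have hIh : {ae mu, forall x, setT x -> hI ^~ x @ \oo --> (EFin \o h) x}.
  apply: aeW => x _; apply: cvg_near_cst; near=> n.
  rewrite /hI indicE mem_set ?mulr1 // /I /= in_itv /= -ler_norml.
  rewrite (@le_trans _ _ n%:R) ?ler_nat //; near: n; exact: nbhs_infty_ger.
have hIg : {ae mu, forall x n, setT x -> (`|hI n x| <= (abse \o (EFin \o h)) x)%E}.
  apply: aeW => x n _; rewrite /hI /= lee_fin normrM ler_piMr //.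
  by rewrite indicE; case: (_ \in _); rewrite ?normr1 ?normr0.
have ih : mu.-integrable setT (abse \o (EFin \o h)) by apply: integrable_abse.
have [_ _] := @dominated_convergence _ _ _ mu _ measurableT _ _ _ mhI mhE hIh ih hIg.
have -> : [sequence (\int[mu]_(x in setT) hI n x)%E]_n =
    fun n => (gmono k n.+1%:R - gmono k (- n.+1%:R))%:E.
  apply/funext => n /=; rewrite -FTC [RHS]integral_mkcond.
  apply: eq_integral => x _; rewrite /hI patchE indicE.
  by case: (x \in I n); rewrite ?mulr1 ?mulr0.
move=> cvI; apply/esym; apply: cvg_unique cvI; first exact: ereal_hausdorff.
apply: cvg_EFin; first by apply: nearW.
rewrite -[X in _ --> X](subrr (0:R)).
apply: (@cvgB _ R^o).
  have := @gmono_cvg0 k (fun n => n%:R) (fun n => ger0_norm (ler0n _ _)).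
  by rewrite -(cvg_shiftS (fun n : nat => gmono k n%:R)).
have := @gmono_cvg0 k (fun n => - n%:R) (fun n => etrans (normrN _) (ger0_norm (ler0n _ _))).
by rewrite -(cvg_shiftS (fun n : nat => gmono k (- n%:R))).
Unshelve. all: by end_near. Qed.

Lemma integral_gmono_rec k : (2%:E * \int[mu]_x (gmono k.+1 x)%:E =
  k%:R%:E * \int[mu]_x (gmono k.-1 x)%:E)%E.
Proof.
have := integral_gmono_derive k.
under eq_integral do rewrite EFinB !EFinM.
rewrite integralB //; [|exact: (integrableZl measurableT _ (integrable_gmono _)) ..].
rewrite !integralZl //; try exact: integrable_gmono.
have f1 := integrable_fin_num measurableT (integrable_gmono k.-1).
have f2 := integrable_fin_num measurableT (integrable_gmono k.+1).
by rewrite -(fineK f1) -(fineK f2) -!EFinM -EFinB => -[/eqP]; rewrite subr_eq0 => /eqP ->.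
Qed.

Let s : R := Num.sqrt 2^-1.
Notation N := (normal_prob (0 : R) s).

Lemma normal_pdf_half (x : R) : normal_pdf 0 s x = normal_peak s * expR (- x ^+ 2).
Proof.
have s2 : s ^+ 2 = 2^-1 by rewrite sqr_sqrtr.
rewrite normal_pdfE ?sqrtr_eq0 -?ltNge // /normal_fun subr0 s2.
by rewrite -mulr_natl divff // divr1.
Qed.

Lemma normal_integral (f : R -> R) : measurable_fun [set: R] f ->
  mu.-integrable setT (fun x => (f x * normal_pdf 0 s x)%:E) ->
  N.-integrable setT (EFin \o f) /\
  (\int[N]_y (f y)%:E = \int[mu]_x (f x * normal_pdf 0 s x)%:E)%E.
Proof.
move=> mf fi; apply: (@integral_density _ _ _ _ _ mu N id (normal_pdf 0 s)) => //.
- exact: measurable_normal_pdf.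
- exact: normal_pdf_ge0.
Qed.

Lemma normal_pow k : N.-integrable setT (fun x => (x ^+ k)%:E) /\
  (\int[N]_x (x ^+ k)%:E = (normal_peak s)%:E * \int[mu]_x (gmono k x)%:E)%E.
Proof.
have E (x : R) : (x ^+ k * normal_pdf 0 s x)%:E = ((normal_peak s)%:E * (gmono k x)%:E)%E.
  by rewrite -EFinM normal_pdf_half /gmono mulrCA.
have [] := @normal_integral (fun x => x ^+ k).
- exact: exprn_measurable.
- apply: eq_integrable (integrableZl measurableT (normal_peak s) (integrable_gmono k)) => //.
move=> h1 h2; split => //; rewrite h2.
under eq_integral do rewrite E.
by rewrite integralZl //; exact: integrable_gmono.
Qed.

Definition normal_moment k : R := (\int[N]_x x ^+ k)%R.

Lemma normal_momentE k : (\int[N]_x (x ^+ k)%:E = (normal_moment k)%:E)%E.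
Proof.
rewrite /normal_moment /Rintegral fineK //.
by apply: integrable_fin_num => //; have [] := normal_pow k.
Qed.

Lemma normal_moment0 : normal_moment 0 = 1.
Proof.
have := normal_momentE 0; under eq_integral do rewrite expr0.
rewrite integral_cst // mul1e => H; apply: EFin_inj; rewrite -H.
exact: integral_normal_pdf.
Qed.

Lemma normal_moment_rec k : normal_moment k.+1 = 2^-1 * (k%:R * normal_moment k.-1).
Proof.
have [_ h1] := normal_pow k.+1; have [_ h2] := normal_pow k.-1.
have h3 := integral_gmono_rec k.
have f1 := integrable_fin_num measurableT (integrable_gmono k.-1).
have f2 := integrable_fin_num measurableT (integrable_gmono k.+1).
move: h1 h2 h3; rewrite !normal_momentE -(fineK f1) -(fineK f2) -!EFinM.
move=> [->] [->] [h3]; apply: (@mulfI _ 2) => //.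
by rewrite mulrCA h3; field.
Qed.

End GaussMoments.

(** * Expectations of products of independent random variables *)

Section Independence.
Context d1 d2 (T : measurableType d1) (Y : measurableType d2) (R : realType).
Variables (P : probability T R) (I : finType) (X : I -> T -> Y).
Hypothesis mX : forall k, measurable_fun [set: T] (X k).
Hypothesis indep : forall B : I -> set Y, (forall k, measurable (B k)) ->
  P [set t | forall k, B k (X k t)] = (\prod_k P [set t | B k (X k t)])%E.

Definition rv_integrable (f : Y -> R) k :=
  P.-integrable [set: T] (fun t => (f (X k t))%:E).

Lemma indep_scaled (k : I) (c : R) (w : T -> R) (f : Y -> R) : 0 <= c ->
  measurable_fun [set: T] w -> (forall t, 0 <= w t) ->
  (forall B, measurable B ->
    (\int[P]_(t in X k @^-1` B) (w t)%:E = c%:E * P (X k @^-1` B))%E) ->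
  measurable_fun [set: Y] f -> (forall y, 0 <= f y) ->
  (\int[P]_t (f (X k t) * w t)%:E = c%:E * \int[P]_t (f (X k t))%:E)%E.
Proof.
move=> c0 mw w0 wB mf f0.
have mEf : measurable_fun setT (EFin \o f) by exact/measurable_EFinP.
have H1 := @ge0_integral_density _ _ _ _ R P (mscale (NngNum c0) (pushforward P (X k)))
  (X k) w (mX k) mw w0 (fun B mB => esym (wB B mB)) (EFin \o f) mEf.
under eq_integral do rewrite EFinM.
rewrite -H1 => [|y]; last by rewrite lee_fin.
rewrite ge0_integral_mscale //; last by move=> y _; rewrite lee_fin.
by rewrite ge0_integral_pushforward // => y _; rewrite lee_fin.
Qed.

Let mfX (f : Y -> R) k : measurable_fun [set: Y] f ->
  measurable_fun [set: T] (fun t => f (X k t)).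
Proof. by move=> mf; apply: measurableT_comp. Qed.

Let mprod (f : I -> Y -> R) (Q : pred I) : (forall k, measurable_fun [set: Y] (f k)) ->
  measurable_fun [set: T] (fun t => \prod_(k | Q k) f k (X k t)).
Proof.
move=> mf; under eq_fun do rewrite -big_filter.
by apply: measurable_prod => k _; exact: mfX.
Qed.

Let mpre B k : measurable B -> measurable (X k @^-1` B).
Proof. by move=> mB; rewrite -[X in measurable X]setTI; exact: mX. Qed.

Let indic_pre B k : (fun t => \1_B (X k t) : R) = \1_(X k @^-1` B).
Proof.
apply/funext => t; rewrite !indicE; congr (nat_of_bool _)%:R.
Qed.

Definition mean (f : Y -> R) k : R := (\int[P]_t f (X k t))%R.

Lemma meanE f k : rv_integrable f k -> (\int[P]_t (f (X k t))%:E = (mean f k)%:E)%E.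
Proof. by move=> fi; rewrite /mean /Rintegral fineK //; exact: integrable_fin_num. Qed.

Lemma mean_indic B k : measurable B ->
  (mean (\1_B) k)%:E = P [set t | B (X k t)].
Proof.
move=> mB; have mXB := mpre k mB.
have E : (\int[P]_t (\1_B (X k t))%:E = P (X k @^-1` B))%E.
  by rewrite -[in RHS](setIT (_ @^-1` _)) -integral_indic //.
by rewrite /mean /Rintegral E fineK // fin_num_measure.
Qed.

Lemma indep_ge0 (f : I -> Y -> R) :
  (forall k, measurable_fun [set: Y] (f k)) -> (forall k y, 0 <= f k y) ->
  (forall k, rv_integrable (f k) k) ->
  (\int[P]_t (\prod_k f k (X k t))%:E = (\prod_k mean (f k) k)%:E)%E.
Proof.
move=> mf f0 fi.
(* The induction is on the indices whose functions are still arbitrary; all others carry indicators,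
   for which the claim is the independence of events. *)
suff H (s : seq I) : uniq s -> forall g : I -> Y -> R,
   (forall k, measurable_fun [set: Y] (g k)) -> (forall k y, 0 <= g k y) ->
   (forall k, rv_integrable (g k) k) ->
   (forall k, k \notin s -> exists2 B, measurable B & g k = \1_B) ->
   (\int[P]_t (\prod_k g k (X k t))%:E = (\prod_k mean (g k) k)%:E)%E.
  by apply: (H (index_enum I)) => //; [exact: index_enum_uniq|move=> k; rewrite mem_index_enum].
elim: s => [_|k0 s IH /= /andP[k0s us]] g mg g0 gi gB.
  have {}gB k : exists B, measurable B /\ g k = \1_B.
    by have [//|B mB gkB] := gB k; exists B.
  have [B BP] := boolp.choice gB.
  have mB k : measurable (B k) by have [] := BP k.
  have gE k : g k = \1_(B k) by have [] := BP k.
  pose S := [set t | forall k, B k (X k t)].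
  have SE : S = \big[setI/setT]_k (X k @^-1` (B k)).
    apply/seteqP; split => t; rewrite -bigcap_seq /=.
      by move=> St k _; exact: St.
    by move=> St k; apply: St; rewrite /= mem_index_enum.
  have mS : measurable S.
    rewrite SE; apply: bigsetI_measurable => k _.
    by rewrite -[X in measurable X]setTI; exact: mX.
  rewrite -prodEFin; under [RHS]eq_bigr do rewrite gE mean_indic //.
  rewrite -indep // -/S -[in RHS](setIT S) -integral_indic //.
  apply: eq_integral => t _; congr EFin; rewrite indicE.
  under eq_bigr do rewrite gE indicE.
  have [tS|tS] := boolP (t \in S).
    by rewrite big1 // => k _; rewrite mem_set //; move: tS; rewrite inE; apply.
  have [k Bk] : exists k, ~ B k (X k t).
    by apply/existsNP => h; move/negP: tS; apply; rewrite inE.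
  by rewrite (bigD1 k) //= memNset // mul0r.
pose w t := \prod_(k | k != k0) g k (X k t).
pose c := \prod_(k | k != k0) mean (g k) k.
have mean0 k : 0 <= mean (g k) k.
  by apply: fine_ge0; apply: integral_ge0 => t _; rewrite lee_fin.
have c0 : 0 <= c by apply: prodr_ge0.
have w0 t : 0 <= w t by apply: prodr_ge0.
have wB B : measurable B ->
    (\int[P]_(t in X k0 @^-1` B) (w t)%:E = c%:E * P (X k0 @^-1` B))%E.
  (* Putting an indicator at [k0] turns the induction hypothesis into the assumption of
     [indep_scaled] for the product of the other factors. *)
  move=> mB; pose g' k := if k == k0 then \1_B else g k.
  have mXB : measurable (X k0 @^-1` B).
    by rewrite -[X in measurable X]setTI; exact: mX.
  have := IH us g' _ _ _ _.
  rewrite (bigD1 k0) //= /g' eqxx.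
  have -> : \prod_(k | k != k0) mean (if k == k0 then \1_B else g k) k = c.
    by apply: eq_bigr => k /negbTE ->.
  rewrite EFinM mean_indic // muleC => <-.
  - rewrite integral_mkcond; apply: eq_integral => t _.
    rewrite (bigD1 k0) //= eqxx patchE indicE.
    have -> : \prod_(k | k != k0) (if k == k0 then \1_B else g k) (X k t) = w t.
      by apply: eq_bigr => k /negbTE ->.
    have -> : (t \in X k0 @^-1` B) = (X k0 t \in B) by apply/idP/idP; rewrite !inE.
    by case: ifP => _; rewrite ?mul1r ?mul0r.
  - by move=> k; case: ifP => _ //; exact: measurable_indic.
  - by move=> k y; case: ifP.
  - move=> k; case: ifP => [/eqP ->|_]; last exact: gi.
    rewrite /rv_integrable (_ : (fun t => _) = EFin \o \1_(X k0 @^-1` B)).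
      by apply: integrable_indic; exact: mpre.
    by rewrite -indic_pre.
  - move=> k ks; case: ifP => [_|kk0]; first by exists B.
    by apply: gB; rewrite inE kk0.
rewrite (bigD1 k0) //= -/c EFinM -meanE // muleC.
rewrite -(indep_scaled c0 _ w0 wB) //; last exact: mprod.
by apply: eq_integral => t _; rewrite (bigD1 k0).
Qed.

Let pos (f : Y -> R) y := Num.max (f y) 0.
Let neg (f : Y -> R) y := Num.max (- f y) 0.

Let posB f y : f y = pos f y - neg f y.
Proof.
by rewrite /pos /neg; case: (lerP 0 (f y)) => fy;
  case: (lerP (- f y) 0) => fy'; rewrite ?subr0 ?sub0r ?opprK //; lra.
Qed.

Let pos_int f k : measurable_fun [set: Y] f -> rv_integrable f k -> rv_integrable (pos f) k.
Proof.
move=> mf; apply: le_integrable => //.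
  by apply/measurable_EFinP; apply: mfX; exact: measurable_maxr.
move=> t _ /=; rewrite lee_fin /pos.
by case: (lerP 0 (f (X k t))) => h; rewrite ?normr0.
Qed.

Let neg_int f k : measurable_fun [set: Y] f -> rv_integrable f k -> rv_integrable (neg f) k.
Proof.
move=> mf; apply: le_integrable => //.
  apply/measurable_EFinP; apply: mfX; apply: measurable_maxr => //.
  exact: measurableT_comp.
move=> t _ /=; rewrite lee_fin /neg.
by case: (lerP 0 (- f (X k t))) => h; rewrite ?normr0 ?normrN.
Qed.

Lemma indep_prod (f : I -> Y -> R) :
  (forall k, measurable_fun [set: Y] (f k)) -> (forall k, rv_integrable (f k) k) ->
  P.-integrable [set: T] (fun t => (\prod_k f k (X k t))%:E) /\
  (\int[P]_t (\prod_k f k (X k t))%:E = (\prod_k mean (f k) k)%:E)%E.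
Proof.
move=> mf fi.
(* Now the induction is on the indices whose functions may change sign; each is split into its
   positive and negative parts. *)
suff H (s : seq I) (g : I -> Y -> R) :
   (forall k, measurable_fun [set: Y] (g k)) -> (forall k, rv_integrable (g k) k) ->
   (forall k, k \notin s -> forall y, 0 <= g k y) ->
   P.-integrable [set: T] (fun t => (\prod_k g k (X k t))%:E) /\
   (\int[P]_t (\prod_k g k (X k t))%:E = (\prod_k mean (g k) k)%:E)%E.
  by apply: (H (index_enum I)) => // k; rewrite mem_index_enum.
elim: s g => [|k0 s IH] g mg gi g0.
  have {}g0 k y : 0 <= g k y by exact: g0.
  have E := indep_ge0 mg g0 gi; split => //.
  apply/integrableP; split; first by apply/measurable_EFinP; exact: mprod.
  apply: (@le_lt_trans _ _ (\int[P]_t (\prod_k g k (X k t))%:E)%E).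
    rewrite le_eqVlt; apply/orP; left; apply/eqP; apply: eq_integral => t _.
    by rewrite /= ger0_norm // prodr_ge0.
  by rewrite E ltry.
pose gp k := if k == k0 then pos (g k) else g k.
pose gn k := if k == k0 then neg (g k) else g k.
have prodB t : \prod_k g k (X k t) = \prod_k gp k (X k t) - \prod_k gn k (X k t).
  rewrite (bigD1 k0) //= [X in _ = X - _](bigD1 k0) //= [X in _ = _ - X](bigD1 k0) //=.
  rewrite /gp /gn eqxx [in LHS]posB mulrBl; congr (_ * _ - _ * _);
  by apply: eq_bigr => k /negbTE ->.
have [||k ks|ip Ep] := IH gp.
- by move=> k; rewrite /gp; case: ifP => // _; exact: measurable_maxr.
- by move=> k; rewrite /gp; case: ifP => // _; exact: pos_int.
- move=> y; rewrite /gp; case: ifP => [_|/negbT kk0]; first by rewrite /pos le_max lexx orbT.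
  by apply: g0; rewrite inE negb_or kk0.
have [||k ks|inn En] := IH gn.
- move=> k; rewrite /gn; case: ifP => // _; apply: measurable_maxr => //.
  exact: measurableT_comp.
- by move=> k; rewrite /gn; case: ifP => // _; exact: neg_int.
- move=> y; rewrite /gn; case: ifP => [_|/negbT kk0]; first by rewrite /neg le_max lexx orbT.
  by apply: g0; rewrite inE negb_or kk0.
have EB : (fun t => (\prod_k g k (X k t))%:E) =
    (fun t => (\prod_k gp k (X k t))%:E - (\prod_k gn k (X k t))%:E)%E.
  by apply/funext => t; rewrite -EFinB prodB.
rewrite EB; split; first exact: integrableB.
rewrite integralB // Ep En -EFinB; congr EFin.
have mB : mean (g k0) k0 = mean (pos (g k0)) k0 - mean (neg (g k0)) k0.
  have [p1 p2] := (pos_int (mg k0) (gi k0), neg_int (mg k0) (gi k0)).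
  apply: EFin_inj; rewrite EFinB -!meanE // -integralB //.
  by apply: eq_integral => t _; rewrite -EFinB -posB.
rewrite [RHS](bigD1 k0) //= [X in X - _](bigD1 k0) //= [X in _ - X](bigD1 k0) //=.
rewrite mB mulrBl /gp /gn eqxx; congr (_ * _ - _ * _);
by apply: eq_bigr => k /negbTE ->.
Qed.
End Independence.

(** * Joint moments of the real and imaginary parts of one Gaussian *)

Section SingleGaussian.
Context (R : realType) (disp : measure_display) (T : measurableType disp).
Variables (P : probability T R) (g : T -> R[i]).
Hypothesis hg : std_complex_gaussian P g.
Local Notation Y := (measurableTypeR R * measurableTypeR R)%type.
Local Notation N := (normal_prob (0 : R) (Num.sqrt (2^-1 : R))).

Definition plane_mono (a b : nat) (y : Y) : R := y.1 ^+ a * y.2 ^+ b.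

Lemma measurable_plane_mono a b : measurable_fun [set: Y] (plane_mono a b).
Proof.
apply: measurable_funM; apply: measurable_funX.
  exact: measurable_fst.
exact: measurable_snd.
Qed.

Lemma integrable_plane_mono a b :
  (N \x N)%E.-integrable [set: Y] (EFin \o plane_mono a b).
Proof.
have [ia _] := normal_pow R a; have [ib _] := normal_pow R b.
have mf : measurable_fun [set: Y] (EFin \o plane_mono a b).
  by apply/measurable_EFinP; exact: measurable_plane_mono.
apply: (iffRL (@integrable12ltyP _ _ _ _ R N N _ mf)).
have mpow k : measurable_fun [set: measurableTypeR R] (fun y => `|(y ^+ k)%:E|%E).
  by apply: measurableT_comp => //; apply/measurable_EFinP; apply: measurable_funX.
have E1 x : (\int[N]_y `|(EFin \o plane_mono a b) (x, y)| =
    `|(x ^+ a)%:E| * \int[N]_y `|(y ^+ b)%:E|)%E.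
  rewrite -ge0_integralZl //; apply: eq_integral => y _.
  by rewrite /= normrM EFinM.
have /integrableP[_ fa] := ia; have /integrableP[_ fb] := ib.
have fbE : (\int[N]_y `|(y ^+ b)%:E|)%E \is a fin_num.
  by rewrite ge0_fin_numE ?integral_ge0.
under eq_integral do rewrite E1.
rewrite ge0_integralZr //; last by apply: integral_ge0.
by rewrite lte_mul_pinfty // ?integral_ge0 // ge0_fin_numE ?integral_ge0.
Qed.

Lemma plane_mono_moment a b :
  P.-integrable [set: T] (fun t => (plane_mono a b (plane (g t)))%:E) /\
  (\int[P]_t (plane_mono a b (plane (g t)))%:E =
     (normal_moment R a * normal_moment R b)%:E)%E.
Proof.
have [mg lawg] := hg.
have mf := @measurable_plane_mono a b.
have nuE (B : set Y) : measurable B ->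
    (N \x N)%E B = (\int[P]_(t in (fun t => plane (g t)) @^-1` B) 1%:E)%E.
  move=> mB; rewrite -lawg // integral_cst ?mul1e //.
  by rewrite -[X in measurable X]setTI; exact: mg.
have HD (f : Y -> \bar R) (mf' : measurable_fun setT f) (f0 : forall y, (0 <= f y)%E) :
    (\int[N \x N]_y f y = \int[P]_t f (plane (g t)))%E.
  rewrite (@ge0_integral_density _ _ _ _ R P (N \x N)%E _ (fun=> 1) mg _ (fun=> ler01) nuE f) //.
  by apply: eq_integral => t _; rewrite mule1.
have ifg : P.-integrable [set: T] (fun t => (plane_mono a b (plane (g t)))%:E).
  apply/integrableP; split; first by apply/measurable_EFinP; exact: (measurableT_comp mf).
  have /integrableP[mE] := integrable_plane_mono a b.
  rewrite HD //; exact: measurableT_comp.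
split => //.
have [_ <-] : (N \x N)%E.-integrable setT (EFin \o plane_mono a b) /\
   (\int[N \x N]_y (plane_mono a b y)%:E = \int[P]_t (plane_mono a b (plane (g t)))%:E)%E.
  have := @integral_density _ _ _ _ R P (N \x N)%E _ (fun=> 1) mg _ (fun=> ler01) nuE (plane_mono a b) mf.
  rewrite (_ : (fun t => (plane_mono a b (plane (g t)) * 1)%:E) =
    (fun t => (plane_mono a b (plane (g t)))%:E)); first by apply.
  by apply/funext => t; rewrite mulr1.
rewrite -(integral12_prod_meas1 (integrable_plane_mono a b)) /=.
have [ia _] := normal_pow R a; have [ib _] := normal_pow R b.
have E1 x : (\int[N]_y (plane_mono a b (x, y))%:E =
    (x ^+ a)%:E * (normal_moment R b)%:E)%E.
  by rewrite -normal_momentE -integralZl //; apply: eq_integral => y _.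
rewrite /fubini_F; under eq_integral do rewrite /= E1.
by rewrite integralZr // normal_momentE.
Qed.
End SingleGaussian.

Local Open Scope complex_scope.

(** * Complex expectations and their reduction to polynomial algebra *)

Section ComplexExpectation.
Context (R : realType) (disp : measure_display) (T : measurableType disp).
Variable (P : probability T R).

Definition complex_integrable (F : T -> R[i]) :=
  P.-integrable [set: T] (fun t => (complex.Re (F t))%:E) /\
  P.-integrable [set: T] (fun t => (complex.Im (F t))%:E).

Definition complex_mean (F : T -> R[i]) : R[i] :=
  (\int[P]_t complex.Re (F t))%R +i* (\int[P]_t complex.Im (F t))%R.

Lemma complex_integrableD F G : complex_integrable F -> complex_integrable G ->
  complex_integrable (fun t => F t + G t).
Proof.
move=> [F1 F2] [G1 G2]; split.
  by apply: eq_integrable (integrableD measurableT F1 G1) => // t _ /=; case: (F t); case: (G t).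
by apply: eq_integrable (integrableD measurableT F2 G2) => // t _ /=; case: (F t); case: (G t).
Qed.

Lemma complex_meanD F G : complex_integrable F -> complex_integrable G ->
  complex_mean (fun t => F t + G t) = complex_mean F + complex_mean G.
Proof.
move=> [F1 F2] [G1 G2]; rewrite /complex_mean.
rewrite -[RHS]/((_ + _) +i* (_ + _)) -!RintegralD //.
by congr (_ +i* _); apply: eq_Rintegral => t _; case: (F t); case: (G t).
Qed.

Lemma complex_integrableZ a F : complex_integrable F ->
  complex_integrable (fun t => a * F t).
Proof.
case: a => a b [F1 F2]; split.
  apply: eq_integrable (integrableB measurableT (integrableZl measurableT a F1)
    (integrableZl measurableT b F2)) => // t _ /=.
  by case: (F t).
apply: eq_integrable (integrableD measurableT (integrableZl measurableT a F2)
    (integrableZl measurableT b F1)) => // t _ /=.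
by case: (F t).
Qed.

Lemma complex_meanZ a F : complex_integrable F ->
  complex_mean (fun t => a * F t) = a * complex_mean F.
Proof.
case: a => a b [F1 F2]; rewrite /complex_mean.
have aF1 := integrableZl measurableT a F1; have bF1 := integrableZl measurableT b F1.
have aF2 := integrableZl measurableT a F2; have bF2 := integrableZl measurableT b F2.
rewrite -[RHS]/((_ - _) +i* (_ + _)) -!RintegralZl // -RintegralB // -RintegralD //.
by congr (_ +i* _); apply: eq_Rintegral => t _; case: (F t).
Qed.

Lemma complex_mean_conj F : complex_integrable F ->
  complex_mean (fun t => (F t)^*) = (complex_mean F)^*.
Proof.
move=> [F1 F2]; rewrite /complex_mean -[RHS]/(_ +i* (- _)); congr (_ +i* _).
  by apply: eq_Rintegral => t _; case: (F t).
rewrite -mulN1r -RintegralZl //; apply: eq_Rintegral => t _.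
by rewrite mulN1r; case: (F t).
Qed.

Lemma complex_mean_real (f : T -> R) : P.-integrable [set: T] (EFin \o f) ->
  complex_integrable (fun t => (f t)%:C) /\
  complex_mean (fun t => (f t)%:C) = (\int[P]_t f t)%R%:C.
Proof.
move=> fi; split; first by split => //=; exact: integrable0.
by rewrite /complex_mean /=; congr (_ +i* _); rewrite Rintegral_cst // mul0r.
Qed.

End ComplexExpectation.

Section GaussianFunctional.
Context (R : realType) (disp : measure_display) (T : measurableType disp).
Variables (P : probability T R) (K : finType) (G : K -> T -> R[i]).
Hypothesis hG : forall k, std_complex_gaussian P (G k).
Hypothesis hI : independent_complex_rvs P G.

(** Each complex variable contributes two real ones; the boolean is [false] for the real part and
    [true] for the imaginary part. *)
Definition gaussian_algebra := MomentPolynomials.moment_polynomials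
  (K * bool)%type (fun k => (normal_moment R k)%:C).
Local Notation ga := gaussian_algebra.

Definition coordinates (t : T) (x : K * bool) : R[i] :=
  (if x.2 then complex.Im (G x.1 t) else complex.Re (G x.1 t))%:C.

(** Independence factorizes the expectation of a monomial over [K], and the product law factorizes
    each variable into its two real parts. Expectations of polynomials thus become values of a
    formal functional. *)
Lemma expectation_form (p : ma_ring ga) :
  complex_integrable P (fun t => ma_eval ga (coordinates t) p) /\
  complex_mean P (fun t => ma_eval ga (coordinates t) p) = ma_form ga p.
Proof.
elim/(@ma_ind _ _ _ ga): p => [m|p q [p1 p2] [q1 q2]|a p [p1 p2]]; last 2 first.
- have -> : (fun t => ma_eval ga (coordinates t) (p + q)) =
    fun t => ma_eval ga (coordinates t) p + ma_eval ga (coordinates t) q.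
    by apply/funext => t; rewrite rmorphD.
  split; first exact: complex_integrableD.
  by rewrite complex_meanD // p2 q2 raddfD.
- have -> : (fun t => ma_eval ga (coordinates t) (a *: p)) =
    fun t => a * ma_eval ga (coordinates t) p.
    by apply/funext => t; rewrite ma_evalZ.
  split; first exact: complex_integrableZ.
  by rewrite complex_meanZ // p2; apply/esym; exact: linearZ.
rewrite ma_formX.
pose f k := plane_mono (m (k, false)) (m (k, true)) : _ -> R.
have prodE (F : K * bool -> R[i]) : \prod_x F x = \prod_k (F (k, false) * F (k, true)).
  transitivity (\prod_k \prod_(b : bool) F (k, b)).
    by rewrite pair_bigA /=; apply: eq_bigr => -[].
  by apply: eq_bigr => k _; rewrite big_bool mulrC.
have -> : (fun t => ma_eval ga (coordinates t) (\prod_x ma_var ga x ^+ m x)) =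
    fun t => (\prod_k f k (plane (G k t)))%:C.
  apply/funext => t; rewrite rmorph_prod prodE rmorph_prod /=.
  apply: eq_bigr => k _; rewrite !rmorphXn !ma_evalX /f /plane_mono /coordinates /=.
  by rewrite !rmorphM !rmorphXn.
have indep B : (forall k, measurable (B k)) ->
    P [set t | forall k, B k (plane (G k t))] =
    (\prod_k P [set t | B k (plane (G k t))])%E.
  move=> mB; have := hI [set: K]%SET mB.
  rewrite (_ : [set t | forall k, k \in _ -> _] = [set t | forall k, B k (plane (G k t))]).
    by move=> ->; apply: eq_bigl => k; rewrite inE.
  by apply/seteqP; split => t H k; [apply: H; rewrite inE|move=> _; exact: H].
have fi k : rv_integrable P (fun k t => plane (G k t)) (f k) k.
  by have [] := plane_mono_moment (hG k) (m (k, false)) (m (k, true)).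
have [||i1 i2] := @indep_prod _ _ T _ R P K (fun k t => plane (G k t)) _ indep f _ fi.
- by move=> k; have [] := hG k.
- by move=> k; exact: measurable_plane_mono.
have [r1 r2] := complex_mean_real i1; split => //.
rewrite [LHS]r2 prodE /Rintegral i2 /= rmorph_prod; apply: eq_bigr => k _.
rewrite -rmorphM; congr (_%:C); apply: EFin_inj; rewrite -meanE //.
by have [] := plane_mono_moment (hG k) (m (k, false)) (m (k, true)).
Qed.
End GaussianFunctional.

(** * Stein's identity for the moment functional *)

Section Stein.
Variables (C : fieldType) (V : finType) (gam : nat -> C) (ma : moment_algebra V gam).
Hypothesis gam_rec : forall k, gam k.+1 = 2^-1 * (k%:R * gam k.-1).

Lemma ma_deriv1 x : ma_deriv ma x 1 = 0.
Proof.
have /eqP := @ma_derivM _ _ _ ma x 1 1.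
by rewrite !mulr1 mul1r -subr_eq subrr => /eqP <-.
Qed.

Lemma ma_derivXn x k :
  ma_deriv ma x (ma_var ma x ^+ k) = k%:R *: ma_var ma x ^+ k.-1.
Proof.
elim: k => [|k IH]; first by rewrite expr0 ma_deriv1 scale0r.
rewrite exprS ma_derivM IH ma_derivX eqxx mul1r /= -scalerAr.
case: k {IH} => [|k]; first by rewrite scale0r addr0 scale1r.
by rewrite /= -exprS -[X in X + _]scale1r -scalerDl -mulrS.
Qed.

Lemma ma_deriv_rest x (m : V -> nat) :
  ma_deriv ma x (\prod_(y | y != x) ma_var ma y ^+ m y) = 0.
Proof.
apply: (big_ind (fun q => ma_deriv ma x q = 0)); first exact: ma_deriv1.
  by move=> p q p0 q0; rewrite ma_derivM p0 q0 mul0r mulr0 addr0.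
move=> y /negbTE yx; elim: (m y) => [|k IH]; first by rewrite expr0 ma_deriv1.
by rewrite exprS ma_derivM IH ma_derivX eq_sym yx mul0r mulr0 addr0.
Qed.

Lemma ma_form_split x k (m : V -> nat) :
  ma_form ma (ma_var ma x ^+ k * \prod_(y | y != x) ma_var ma y ^+ m y) =
  gam k * \prod_(y | y != x) gam (m y).
Proof.
pose m' y := if y == x then k else m y.
have := ma_formX ma m'; rewrite (bigD1 x) //= [RHS](bigD1 x) //= /m' eqxx.
under eq_bigr => y /negbTE -> do [].
by move=> ->; congr (_ * _); apply: eq_bigr => y /negbTE ->.
Qed.

Lemma stein x (p : ma_ring ma) :
  ma_form ma (ma_var ma x * p) = 2^-1 * ma_form ma (ma_deriv ma x p).
Proof.
elim/(@ma_ind _ _ _ ma): p => [m|p q pE qE|a p pE].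
- rewrite (bigD1 x) //= ma_derivM ma_deriv_rest mulr0 addr0 ma_derivXn.
  rewrite mulrA -exprS ma_form_split -scalerAl [in RHS]linearZ /=.
  by rewrite ma_form_split gam_rec !mulrA.
- by rewrite mulrDr ma_derivD !raddfD /= pE qE mulrDr.
rewrite -scalerAr ma_derivZ.
have formZ b q : ma_form ma (b *: q) = b * ma_form ma q by exact: linearZ.
by rewrite !formZ pE mulrCA.
Qed.
End Stein.

(** * Partial transposes of the Gaussian Wishart matrix *)

Section MultiIndex.
Variables (n : nat) (d : 'I_n -> nat).

(* Positive leg sizes are written as successors, so that the multi-indices form
   an additive group, the product of the cyclic groups ['I_(d j).+1]. *)
Definition mindex : Type := midx (fun j => (d j).+1).
HB.instance Definition _ := Finite.copy mindex (midx (fun j => (d j).+1)).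

Implicit Types x y z : mindex.
Definition mindex_zero : mindex := finfun (fun j => 0 : 'I_(d j).+1).
Definition mindex_opp x : mindex := finfun (fun j => - x j).
Definition mindex_add x y : mindex := finfun (fun j => x j + y j).

Lemma mindex_addA : associative mindex_add.
Proof. by move=> x y z; apply/ffunP => j; rewrite !ffunE addrA. Qed.
Lemma mindex_addC : commutative mindex_add.
Proof. by move=> x y; apply/ffunP => j; rewrite !ffunE addrC. Qed.
Lemma mindex_add0 : left_id mindex_zero mindex_add.
Proof. by move=> x; apply/ffunP => j; rewrite !ffunE add0r. Qed.
Lemma mindex_addN : left_inverse mindex_zero mindex_opp mindex_add.
Proof. by move=> x; apply/ffunP => j; rewrite !ffunE addNr. Qed.
HB.instance Definition _ := GRing.isZmodule.Build mindex
  mindex_addA mindex_addC mindex_add0 mindex_addN.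

Definition mix (e : {ffun 'I_n -> bool}) (x y : mindex) : mindex :=
  finfun (fun j => if e j then y j else x j).

Lemma mixB e x y x' y' : mix e (x - x') (y - y') = mix e x y - mix e x' y'.
Proof. by apply/ffunP => j; rewrite !ffunE; case: (e j). Qed.

Lemma mixxx e x : mix e x x = x.
Proof. by apply/ffunP => j; rewrite !ffunE; case: (e j). Qed.

Lemma mixI e x y : (mix e x y == mix e y x) = (x == y).
Proof.
apply/eqP/eqP => [/ffunP h|-> //]; apply/ffunP => j.
by have := h j; rewrite !ffunE; case: (e j).
Qed.

Definition leg (j : 'I_n) (x : mindex) : nat := x j.

Lemma leg_mix j e x y : leg j (mix e x y) = if e j then leg j y else leg j x.
Proof. by rewrite /leg /mix ffunE; case: (e j). Qed.

Lemma leg_inj x y : (forall j, leg j x = leg j y) -> x = y.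
Proof. by move=> h; apply/ffunP => j; apply: val_inj; exact: h. Qed.

(** Shifting leg [j] of the second index by all [(d j).+1] residues gives disjoint translates of the
    set of agreeing pairs inside the set of all pairs. *)
Lemma card_leg j :
  (#|[set p : mindex * mindex | leg j p.1 == leg j p.2]%SET| * (d j).+1 <= #|{: mindex}| ^ 2)%N.
Proof.
pose S := [set p : mindex * mindex | leg j p.1 == leg j p.2]%SET.
pose sh (p : mindex * mindex) (a : 'I_(d j).+1) : mindex :=
  finfun (fun k => p.2 k + (if k == j then inZp a else 0)).
pose f (u : (mindex * mindex) * 'I_(d j).+1) := (u.1.1, sh u.1 u.2).
have finj : {in finset.setX S [set: 'I_(d j).+1]%SET &, injective f}.
  move=> [[x y] a] [[x' y'] a']; rewrite !inE /= => /andP[/eqP h _] /andP[/eqP h' _].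
  case=> xx' /ffunP ss; move: h h'; rewrite -xx' => h h'.
  have yy' : y = y'.
    apply/ffunP => k; have := ss k; rewrite !ffunE /=.
    have [->|kj] := eqVneq k j; last by rewrite !addr0.
    by move=> _; apply: val_inj; rewrite /= -[LHS]/(leg j y) -h h'.
  congr (_, _, _) => //; have := ss j; rewrite !ffunE /= eqxx yy' => /addrI.
  by move/(congr1 val) => /= /eqP; rewrite !modn_small // => /eqP /val_inj.
have := subset_leq_card (finset.subsetT (f @: finset.setX S [set: 'I_(d j).+1])%SET).
by rewrite (card_in_imset finj) cardsX !cardsT card_ord card_prod expnS expn1.
Qed.
End MultiIndex.

(** * Wirtinger calculus and the polynomial Wishart entries *)

Section ComplexGaussian.
Variables (C : numFieldType) (K : finType) (gam : nat -> C).
Variable (ma : moment_algebra (K * bool)%type gam).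
Hypothesis gam_rec : forall k, gam k.+1 = 2^-1 * (k%:R * gam k.-1).
Variable (ii : C).
Hypothesis ii2 : ii * ii = -1.

Implicit Types (k l : K) (q r : ma_ring ma).
(* With [ii] the imaginary unit: the complex Gaussian variable, its conjugate and
   the Wirtinger derivative with respect to the conjugate. *)
Definition gvar k : ma_ring ma := ma_var ma (k, false) + ii *: ma_var ma (k, true).
Definition gconj k : ma_ring ma := ma_var ma (k, false) - ii *: ma_var ma (k, true).

Definition dbar k q : ma_ring ma :=
  2^-1 *: (ma_deriv ma (k, false) q + ii *: ma_deriv ma (k, true) q).

Lemma dbarD k q r : dbar k (q + r) = dbar k q + dbar k r.
Proof. by rewrite /dbar !ma_derivD [ii *: (_ + _)]scalerDr addrACA scalerDr. Qed.

Lemma dbarM k q r : dbar k (q * r) = dbar k q * r + q * dbar k r.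
Proof.
rewrite /dbar !ma_derivM [ii *: (_ + _)]scalerDr addrACA scalerDr.
by congr (_ + _); rewrite -?scalerAl -?scalerAr ?mulrDl ?mulrDr -?scalerAl -?scalerAr.
Qed.

Lemma dbarZ k a q : dbar k (a *: q) = a *: dbar k q.
Proof.
rewrite /dbar !ma_derivZ !scalerDr !scalerA; congr (_ *: _ + _ *: _); ring.
Qed.

Lemma dbar_gvar k l : dbar k (gvar l) = 0.
Proof.
rewrite /dbar /gvar !ma_derivD !ma_derivZ !ma_derivX !xpair_eqE !andbT !andbF.
rewrite scaler0 addr0 add0r scalerA ii2 scaleN1r subrr scaler0 //.
Qed.

Lemma dbar_gconj k l : dbar k (gconj l) = (k == l)%:R.
Proof.
rewrite /dbar /gconj -scaleNr !ma_derivD !ma_derivZ !ma_derivX !xpair_eqE !andbT !andbF.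
rewrite scaler0 addr0 add0r scalerA mulrN ii2 opprK scale1r -[X in X + X]scale1r -scalerDl.
by rewrite scalerA mulVf ?scale1r // pnatr_eq0.
Qed.

Lemma stein_complex k q : ma_form ma (gvar k * q) = ma_form ma (dbar k q).
Proof.
have formZ b r : ma_form ma (b *: r) = b * ma_form ma r by exact: linearZ.
have formD q' r : ma_form ma (q' + r) = ma_form ma q' + ma_form ma r by exact: raddfD.
rewrite /gvar /dbar mulrDl -scalerAl !(formD, formZ) !(stein gam_rec); ring.
Qed.
End ComplexGaussian.

Section WishartPolynomials.
Variables (C : numFieldType) (M : finZmodType) (p : nat) (gam : nat -> C).
Variable (ma : moment_algebra (('I_#|M| * 'I_p) * bool)%type gam).
Hypothesis gam_rec : forall k, gam k.+1 = 2^-1 * (k%:R * gam k.-1).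
Variable (ii : C).
Hypothesis ii2 : ii * ii = -1.
Local Notation N := #|M|.

Definition wentry (a b : M) : ma_ring ma :=
  N%:R^-1 *: \sum_r gvar ma ii (enum_rank a, r) * gconj ma ii (enum_rank b, r).
Definition wderiv (a b : M) (q : ma_ring ma) : ma_ring ma :=
  \sum_r gconj ma ii (enum_rank b, r) * dbar ii (enum_rank a, r) q.

Lemma wishart_calculus_poly E (mix : E -> M -> M -> M) (kap0 : C) :
  (forall e x y x' y', mix e (x - x') (y - y') = mix e x y - mix e x' y') ->
  (forall e x, mix e x x = x) ->
  (forall e x y, (mix e x y == mix e y x) = (x == y)) ->
  ma_form ma 1 = 1 -> p%:R / N%:R <= kap0 ->
  wishart_calculus mix (ma_form ma) wentry wderiv (p%:R / N%:R) kap0.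
Proof.
have formD q' r : ma_form ma (q' + r) = ma_form ma q' + ma_form ma r by exact: raddfD.
have formZ b r : ma_form ma (b *: r) = b * ma_form ma r by exact: linearZ.
have sum_delta (r : 'I_p) (F : 'I_p -> ma_ring ma) :
    \sum_s (r == s)%:R * F s = F r.
  rewrite (bigD1 r) //= eqxx mul1r big1 ?addr0 // => s /negbTE rs.
  by rewrite eq_sym rs mul0r.
move=> mB mxx mI f1 pk; split => //.
- by rewrite pk mulr_ge0 // invr_ge0.
- by move=> a b f g; rewrite -big_split; apply: eq_bigr => r _; rewrite dbarD mulrDr.
- move=> a b f g; rewrite mulr_suml mulr_sumr -big_split; apply: eq_bigr => r _.
  by rewrite dbarM /=; ring.
- move=> a b a' b'; rewrite /wderiv /wentry.
  have sumE k (F : 'I_p -> ma_ring ma) : dbar ii k (\sum_s F s) = \sum_s dbar ii k (F s).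
    elim/big_rec2: _ => [|s q q' _ <-]; last by rewrite dbarD.
    by have := dbarD ii k (0 : ma_ring ma) 0; rewrite addr0 => /eqP; rewrite -subr_eq subrr => /eqP <-.
  under eq_bigr => r _.
    rewrite dbarZ sumE.
    under eq_bigr => s _.
      rewrite dbarM dbar_gvar // mul0r add0r dbar_gconj // xpair_eqE mulrC.
      over.
    over.
  rewrite /= (inj_eq enum_rank_inj); case: (a == b') => /=; last first.
    by rewrite mul0r big1 // => r _; rewrite big1 ?scaler0 ?mulr0 // => s _; rewrite mul0r.
  rewrite mul1r scaler_sumr; apply: eq_bigr => r _.
  by rewrite sum_delta -scalerAr mulrC.
suff ibp a b q : ma_form ma (wentry a b * q) = p%:R / N%:R * (a == b)%:R * ma_form ma q +
  N%:R^-1 * ma_form ma (wderiv a b q) by exact: ibp.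
rewrite /wentry -scalerAl formZ mulr_suml raddf_sum /=.
rewrite (_ : p%:R / N%:R * _ * _ = N%:R^-1 * (p%:R * ((a == b)%:R * ma_form ma q))); last by ring.
rewrite -mulrDr; congr (_ * _); rewrite /wderiv raddf_sum /=.
have -> : p%:R * ((a == b)%:R * ma_form ma q) = \sum_(r < p) (a == b)%:R * ma_form ma q.
  by rewrite sumr_const card_ord -[RHS]mulr_natl.
(* In each column, [dbar] falls on the conjugate factor of the entry itself or on [q]. The first
   alternative gives [a == b] once per column, which is the origin of [kap = p / N]. *)
rewrite -big_split; apply: eq_bigr => r _ /=.
rewrite -mulrA stein_complex // dbarM dbar_gconj // xpair_eqE eqxx andbT formD /=.
congr (_ + _); rewrite (inj_eq enum_rank_inj); case: (a == b); rewrite ?mul1r //.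
by rewrite !mul0r raddf0.
Qed.
End WishartPolynomials.

Section PartialTranspose.
Variables (C : comPzRingType) (n : nat) (d : 'I_n -> nat).
Local Notation d1 := (fun j => (d j).+1).
Local Notation ev := (fun i => enum_val i : mindex d).

(** At a fixed entry [(i, j)], exactly one pair of matrix units survives the tensor expansion. *)
Lemma ptransposeE (e : {ffun 'I_n -> bool}) (W : 'M[C]_(#|midx d1|)) i j :
  ptranspose e W i j =
  W (enum_rank (mix e (ev i) (ev j))) (enum_rank (mix e (ev j) (ev i))).
Proof.
have prod_bool (b : 'I_n -> bool) : \prod_k ((b k)%:R : C) = [forall k, b k]%:R.
  case: (altP forallP) => [h|/forallPn[k /negbTE bk]]; last by rewrite (bigD1 k) //= bk mul0r.
  by rewrite big1 // => k _; rewrite h.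
have E x y : tensmx (fun k => if e k then (delta_mx (ev x k) (ev y k))^T
      else delta_mx (ev x k) (ev y k) : 'M[C]__) i j =
    ((x == enum_rank (mix e (ev i) (ev j))) && (y == enum_rank (mix e (ev j) (ev i))))%:R.
  rewrite mxE; transitivity (\prod_k ((mix e (ev i) (ev j) k == ev x k) &&
      (mix e (ev j) (ev i) k == ev y k))%:R : C).
    by apply: eq_bigr => k _; rewrite !ffunE; case: (e k); rewrite !mxE // andbC.
  rewrite prod_bool; congr (nat_of_bool _)%:R; apply/forallP/idP => [h|].
    apply/andP; split; apply/eqP/enum_val_inj; rewrite enum_rankK;
      by apply/ffunP => k; have /andP[/eqP h1 /eqP h2] := h k; rewrite ?h1 ?h2.
  by move=> /andP[/eqP -> /eqP ->] k; rewrite !enum_rankK !eqxx.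
rewrite /ptranspose /tensmap summxE.
under eq_bigr => x _.
  rewrite summxE; under eq_bigr => y _ do rewrite mxE E.
  over.
rewrite /= (bigD1 (enum_rank (mix e (ev i) (ev j)))) //=.
rewrite (bigD1 (enum_rank (mix e (ev j) (ev i)))) //= !eqxx mulr1.
rewrite big1 ?addr0 => [|y /negbTE h]; last by rewrite h andbF mulr0.
by rewrite big1 ?addr0 // => x /negbTE h; rewrite big1 // => y _; rewrite h mulr0.
Qed.
End PartialTranspose.

Section WordEntries.
Variables (C : comNzRingType) (Pr : comNzRingType) (n : nat) (d : 'I_n -> nat).
Local Notation d1 := (fun j => (d j).+1).
Variables (f : {rmorphism Pr -> C}) (X : mindex d -> mindex d -> Pr).
Variable (W : 'M[C]_(#|midx d1|)).
Hypothesis WE : forall a b : mindex d, W (enum_rank a) (enum_rank b) = f (X a b).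

Lemma prod_ptransposeE (w : seq {ffun 'I_n -> bool}) i j :
  (\prod_(s <- w) ptranspose s W) i j =
  f (wd (@mix n d) X w (enum_val i) (enum_val j)).
Proof.
elim: w i => [|e w IH] i.
  by rewrite big_nil mxE rmorph_nat (inj_eq enum_val_inj).
rewrite big_cons mxE /= raddf_sum /= [RHS](reindex (fun k : 'I_#|{: mindex d}| => enum_val k)) /=; last first.
  by apply: onW_bij; exact: enum_val_bij.
by apply: eq_bigr => k _; rewrite IH rmorphM ptransposeE WE.
Qed.

Lemma tr_prod_ptranspose (w : seq {ffun 'I_n -> bool}) :
  \tr (\prod_(s <- w) ptranspose s W) = f (wtr (@mix n d) X w).
Proof.
rewrite /mxtrace /wtr raddf_sum /= [RHS](reindex (fun k : 'I_#|{: mindex d}| => enum_val k)) /=; last first.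
  by apply: onW_bij; exact: enum_val_bij.
by apply: eq_bigr => k _; rewrite prod_ptransposeE.
Qed.
End WordEntries.

(** * Random traces as polynomials in Gaussian variables, and their variance *)

Section WishartMoments.
Context (R : realType) (disp : measure_display) (T : measurableType disp).
Variables (P : probability T R) (n : nat) (d : 'I_n -> nat) (p : nat).
Local Notation d1 := (fun j => (d j).+1).
Variable (G : T -> 'M[R[i]]_(#|midx d1|, p)).
Hypothesis hG : std_gaussian_matrix P G.
Local Notation N := #|{: mindex d}|.
Local Notation K := ('I_N * 'I_p)%type.
Local Notation ii := (0 +i* 1 : R[i]).
Local Notation entries := (fun (k : K) t => G t k.1 k.2).

Definition wishart_algebra : moment_algebra (K * bool)%type
  (fun k => (normal_moment R k)%:C) := gaussian_algebra R K.
Local Notation ga := wishart_algebra.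
Local Notation X := (@wentry R[i] (mindex d) p _ ga ii).
Local Notation form := (ma_form ga).
Definition wishart_eval t : {rmorphism ma_ring ga -> R[i]} :=
  ma_eval ga (coordinates entries t).
Definition wishart_moment : seq {ffun 'I_n -> bool} -> R[i] :=
  moment (@mix n d) form X.
Definition word_trace w t : R[i] := ntr (\prod_(s <- w) ptranspose s (wishart (G t))).

Lemma wishart_calculusP (kap0 : R[i]) : p%:R / N%:R <= kap0 ->
  wishart_calculus (@mix n d) form X (wderiv ii) (p%:R / N%:R) kap0.
Proof.
move=> pk; apply: wishart_calculus_poly => //.
- by move=> k; rewrite normal_moment_rec !rmorphM rmorph_nat fmorphV rmorph_nat.
- by rewrite -expr2; exact: sqr_i.
- exact: mixB.
- exact: mixxx.
- exact: mixI.
have := ma_formX ga (fun=> 0%N); rewrite !big1 => [//|x _|x _]; last by rewrite expr0.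
by rewrite normal_moment0.
Qed.

Lemma eval_gvar t k : wishart_eval t (gvar ga ii k) = G t k.1 k.2.
Proof.
rewrite /gvar rmorphD ma_evalZ !ma_evalX /coordinates /=.
case: (G t k.1 k.2) => a b; apply/eqP; rewrite eq_complex /=.
by apply/andP; split; apply/eqP; ring.
Qed.

Lemma eval_gconj t k : wishart_eval t (gconj ga ii k) = (G t k.1 k.2)^*.
Proof.
rewrite /gconj rmorphB ma_evalZ !ma_evalX /coordinates /=.
case: (G t k.1 k.2) => a b; apply/eqP; rewrite eq_complex /=.
by apply/andP; split; apply/eqP; ring.
Qed.

Lemma wishart_entryE t a b :
  wishart (G t) (enum_rank a) (enum_rank b) = wishart_eval t (X a b).
Proof.
rewrite /wishart /wentry ma_evalZ !mxE -card_midx rmorph_sum; congr (_ * _).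
by apply: eq_bigr => r _; rewrite rmorphM eval_gvar eval_gconj !mxE.
Qed.

Lemma word_traceE w t :
  word_trace w t = wishart_eval t (N%:R^-1 *: wtr (@mix n d) X w).
Proof.
rewrite ma_evalZ -(tr_prod_ptranspose (wishart_entryE t)).
by rewrite /word_trace /ntr mulrC.
Qed.

Lemma conj_wentry t a b : (wishart_eval t (X a b))^* = wishart_eval t (X b a).
Proof.
rewrite /wentry !ma_evalZ rmorphM fmorphV rmorph_nat !rmorph_sum; congr (_ * _).
apply: eq_bigr => r _; rewrite !rmorphM !eval_gvar !eval_gconj mulrC.
by congr (_ * _); exact: conjcK.
Qed.

Lemma conj_wd t w x y : (wishart_eval t (wd (@mix n d) X w x y))^* =
  wishart_eval t (wd (@mix n d) X (rev w) y x).
Proof.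
elim: w x y => [|e w IH] x y; first by rewrite /= !rmorph_nat eq_sym.
rewrite rev_cons -cats1 wd_cat !(rmorph_sum (wishart_eval t)).
apply: etrans (rmorph_sum conjc _ _ _) _; apply: eq_bigr => z _.
have conjM (a b : R[i]) : (a * b)^* = a^* * b^* by exact: rmorphM.
rewrite !(rmorphM (wishart_eval t)); apply: etrans (conjM _ _) _.
by rewrite [RHS]mulrC wd1; congr (_ * _); [exact: conj_wentry|exact: IH].
Qed.

(** Partial transposes of a Hermitian matrix are Hermitian, so the adjoint of a word is the reversed
    word. The squared modulus of a centred trace is therefore again the value of a polynomial, to
    which [expectation_form] applies. *)
Lemma conj_word_trace w t : (word_trace w t)^* = word_trace (rev w) t.
Proof.
rewrite !word_traceE !ma_evalZ rmorphM fmorphV rmorph_nat; congr (_ * _).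
rewrite !(rmorph_sum (wishart_eval t)); apply: etrans (rmorph_sum conjc _ _ _) _.
by apply: eq_bigr => x _; exact: conj_wd.
Qed.

Lemma word_trace_mean w :
  complex_integrable P (word_trace w) /\
  complex_mean P (word_trace w) = wishart_moment w.
Proof.
have -> : word_trace w = fun t => wishart_eval t (N%:R^-1 *: wtr (@mix n d) X w).
  by apply/funext => t; exact: word_traceE.
have [h1 h2] := @expectation_form _ _ T P K entries (fun k => hG.1 k.1 k.2) hG.2
  (N%:R^-1 *: wtr (@mix n d) X w).
by split => //; rewrite [LHS]h2; exact: linearZ.
Qed.

Lemma wishart_moment_rev w : wishart_moment (rev w) = (wishart_moment w)^*.
Proof.
have [w1 <-] := word_trace_mean w; have [_ <-] := word_trace_mean (rev w).
by rewrite -complex_mean_conj //; congr (complex_mean P _); apply/funext => t; rewrite conj_word_trace.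
Qed.

Definition word_deviation w t : R := complex.Re (`|word_trace w t - wishart_moment w| ^+ 2).

Lemma word_deviationE w t :
  (word_deviation w t)%:C = `|word_trace w t - wishart_moment w| ^+ 2.
Proof. by rewrite /word_deviation; exact: (RRe_real (ger0_real (exprn_ge0 _ (normr_ge0 _)))). Qed.

Lemma word_variance (kap0 : R[i]) w : p%:R / N%:R <= kap0 ->
  P.-integrable [set: T] (EFin \o word_deviation w) /\
  (\int[P]_t word_deviation w t)%R%:C <= Kc kap0 (size w) (size w) * N%:R^-1 ^+ 2.
Proof.
move=> pk; set m := wishart_moment w.
have evalC t a : wishart_eval t a%:A = a by rewrite ma_evalZ rmorph1 mulr1.
pose q : ma_ring ga := (N%:R^-1 *: wtr (@mix n d) X w - m%:A) *
  (N%:R^-1 *: wtr (@mix n d) X (rev w) - (m^*)%:A).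
have [h1 h2] := @expectation_form _ _ T P K entries (fun k => hG.1 k.1 k.2) hG.2 q.
have qE t : wishart_eval t q = (word_deviation w t)%:C.
  rewrite word_deviationE normCK rmorphM !rmorphB /= !evalC -!word_traceE.
  congr (_ * _); rewrite -conj_word_trace; by [].
have devi : P.-integrable [set: T] (EFin \o word_deviation w).
  by have := h1.1; apply: eq_integrable => // t _ /=; rewrite [ma_eval _ _ _]qE.
split => //; have [_ <-] := complex_mean_real devi.
have -> : (fun t => (word_deviation w t)%:C) = fun t => ma_eval ga (coordinates entries t) q.
  by apply/funext => t; rewrite -qE.
rewrite h2 /q.
have formZ b r : form (b *: r) = b * form r by exact: linearZ.
have formB q' r : form (q' - r) = form q' - form r by exact: raddfB.
have form1 : form 1 = 1 by exact: (wc_E1 (wishart_calculusP pk)).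
have momE v : form (wtr (@mix n d) X v) = N%:R * wishart_moment v.
  rewrite /wishart_moment /moment mulrA mulfV ?mul1r //.
  by rewrite pnatr_eq0 -lt0n; apply/card_gt0P; exists 0.
rewrite mulrBl !mulrBr !formB -![in leLHS]scalerAl -![in leLHS]scalerAr !(mul1r, mulr1) !formZ form1 !momE.
have N0 : N%:R != 0 :> R[i] by rewrite pnatr_eq0 -lt0n; apply/card_gt0P; exists 0.
have := moment_var (wishart_calculusP pk) w (rev w).
rewrite size_rev -/(wishart_moment w) -/(wishart_moment (rev w)) wishart_moment_rev -/m.
apply: le_trans; rewrite le_eqVlt; apply/orP; left; apply/eqP.
by set F := form _; set mm := conjc m; field.
Qed.
End WishartMoments.

(** * Almost sure convergence *)

Section AlmostSureConvergence.
Context (R : realType) (disp : measure_display) (T : measurableType disp).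
Variable P : probability T R.

(** By monotone convergence the sum over all [i] has finite expectation, hence is finite almost
    everywhere; the tails of a convergent nonnegative series are small and dominate each of their
    terms. *)
Lemma ae_summable_cvg0 (I : countType) (f : I -> T -> R) (B : R) :
  (forall i t, 0 <= f i t) -> (forall i, P.-integrable [set: T] (EFin \o f i)) ->
  (forall s : seq I, uniq s -> \sum_(i <- s) (\int[P]_t f i t)%R <= B) ->
  {ae P, forall t, forall eps : R, 0 < eps ->
    exists s : seq I, forall i, i \notin s -> f i t < eps}.
Proof.
move=> f0 fi sB.
(* The family is enumerated by codes of indices; a number that codes no index contributes [0]. *)
pose F k t : \bar R := oapp (fun i => (f i t)%:E) 0%E (pickle_inv k).
have F0 k t : (0 <= F k t)%E by rewrite /F; case: pickle_inv => //= i; rewrite lee_fin.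
have mF k : measurable_fun [set: T] (F k).
  by rewrite /F; case: pickle_inv => //= i; exact: measurable_int (fi i).
have intF k : (\int[P]_t F k t = (oapp (fun i => \int[P]_t f i t)%R 0 (pickle_inv k))%:E)%E.
  rewrite /F; case: pickle_inv => [i|] /=; last by rewrite integral0.
  by rewrite /Rintegral fineK //; exact: integrable_fin_num (fi i).
pose S t := (\sum_(k <oo) F k t)%E.
have S0 t : (0 <= S t)%E by apply: nneseries_ge0.
have SB : (\int[P]_t S t <= B%:E)%E.
  rewrite integral_nneseries //.
  apply: lime_le; first by apply: is_cvg_nneseries => k _ _; exact: integral_ge0.
  apply: nearW => k; under eq_bigr do rewrite intF.
  rewrite sumEFin lee_fin; apply: le_trans (sB (pmap pickle_inv (iota 0 k)) _).
    by rewrite -/(index_iota 0 k) /index_iota subn0; elim: (iota 0 k) => [|a s IH];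
      rewrite ?big_nil // big_cons /=; case: pickle_inv => [i|] /=;
      rewrite ?big_cons ?add0r // lerD2l.
  exact: seq.pmap_uniq (@pickle_invK I) _ (iota_uniq 0 k).
have mS : measurable_fun [set: T] S by apply: ge0_emeasurable_sum.
have Si : P.-integrable [set: T] S.
  apply/integrableP; split => //; under eq_integral do rewrite gee0_abs //.
  exact: le_lt_trans SB (ltry _).
have := integrable_ae measurableT Si; apply: filterS => t /(_ Logic.I) Sfin eps eps0.
have Soo : (\sum_(k <oo) F k t < +oo)%E by move: Sfin; rewrite fin_numElt => /andP[].
have := nneseries_tail_cvg Soo (fun k _ => F0 k t).
move=> /fine_cvgP[tailfin /cvgr0Pnorm_lt /(_ _ eps0) tail0].
have [m _ /(_ m (leqnn m))[mfin mlt]] := filterI tailfin tail0.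
exists (pmap pickle_inv (iota 0 m)) => i im.
have mi : (m <= pickle i)%N.
  rewrite leqNgt; apply: contra im => im; rewrite mem_pmap.
  by apply/mapP; exists (pickle i); rewrite ?pickleK_inv // mem_iota.
have tail_ge : (F (pickle i) t <= \sum_(m <= k <oo) F k t)%E.
  apply: le_trans (nneseries_lim_ge (pickle i).+1 (fun k _ _ => F0 k t)).
  by rewrite big_nat_recr //= leeDr // sume_ge0.
move: tail_ge; rewrite /F pickleK_inv /= -(fineK mfin) lee_fin => tail_ge.
by apply: le_lt_trans tail_ge (le_lt_trans (ler_norm _) mlt).
Qed.

(** The subtracted term makes the induction go through, by comparison with a telescoping sum. *)
Lemma sum_inv_sqr (m : nat) : \sum_(k < m.+1) (k.+1%:R ^- 2 : R) <= 2 - m.+1%:R^-1.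
Proof.
elim: m => [|m IH]; first by rewrite big_ord_recr big_ord0 /= add0r expr1n invr1; lra.
rewrite big_ord_recr /=; apply: le_trans (lerD IH (lexx _)) _.
have a0 : 0 < m.+1%:R :> R by rewrite ltr0n.
rewrite -[m.+2%:R]natr1; set a : R := m.+1%:R in a0 *.
have a1 : 0 < a + 1 by lra.
have -> : 2 - a^-1 + (a + 1) ^- 2 = 2 - (a + 1)^-1 - (a * (a + 1) ^+ 2)^-1.
  by field; rewrite !gt_eqF.
by rewrite gerBl invr_ge0 mulr_ge0 ?exprn_ge0 // ltW.
Qed.

Lemma sum_prod_inv_sqr (n : nat) (s : seq {ffun 'I_n -> nat}) : uniq s ->
  \sum_(d <- s) \prod_j ((d j).+1%:R ^- 2 : R) <= 2 ^+ n.
Proof.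
(* All listed multi-indices lie in one cube of side [m.+1], over which the sum of products is a
   product of sums. *)
move=> us; pose m := (\max_(d <- s) \max_j d j)%N.
pose F (d : {ffun 'I_n -> nat}) : R := \prod_j (d j).+1%:R ^- 2.
pose up (g : {ffun 'I_n -> 'I_m.+1}) : {ffun 'I_n -> nat} := [ffun j => g j : nat].
have up_inj : injective up.
  by move=> g h /ffunP gh; apply/ffunP => j; apply: val_inj; have := gh j; rewrite !ffunE.
have F0 d : 0 <= F d by apply: prodr_ge0 => j _; rewrite invr_ge0 exprn_ge0.
have s_up : perm_eq s [seq d <- map up (enum {: {ffun 'I_n -> 'I_m.+1}}) | d \in s].
  apply: uniq_perm => //; first by rewrite filter_uniq // map_inj_uniq // enum_uniq.
  move=> d; rewrite mem_filter; case: (boolP (d \in s)) => //= ds; apply/esym/mapP.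
  exists [ffun j => inord (d j)]; first by rewrite mem_enum.
  apply/ffunP => j; rewrite !ffunE inordK // ltnS.
  by apply: leq_trans (leq_bigmax_seq _ ds isT); exact: leq_bigmax.
rewrite -/(F _) (perm_big _ s_up) big_filter big_map big_enum_cond /=.
apply: (@le_trans _ _ (\sum_(g : {ffun 'I_n -> 'I_m.+1}) F (up g))).
  by rewrite [leLHS]big_mkcond ler_sum // => g _; case: ifP.
under eq_bigr => g _.
  rewrite /F; under eq_bigr => j _ do rewrite ffunE.
  over.
rewrite -(bigA_distr_bigA (fun _ k => (k : 'I_m.+1).+1%:R ^- 2)) prodr_const card_ord.
apply: lerXn2r; rewrite ?nnegrE ?sumr_ge0 //.
by apply: le_trans (sum_inv_sqr m) _; rewrite gerBl.
Qed.
End AlmostSureConvergence.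

(** * Convergence along multi-indices *)

Section AllInfty.
Variables (n : nat).
Local Notation pos d := (fun j : 'I_n => (d j).+1).

(** Far along the filter every leg is positive, so it suffices to treat successor dimensions, where
    the indices form a group. *)
Lemma cvg_all_infty_shift (U : topologicalType) (Z : ('I_n -> nat) -> U) (l : U) :
  Z (pos d) @[d --> @all_infty n] --> l -> Z d @[d --> @all_infty n] --> l.
Proof.
move=> Zl A /Zl [N _ NA]; exists N.+1 => // d dN.
have -> : d = pos (fun j => (d j).-1).
  by apply/funext => j; rewrite prednK // (leq_trans _ (dN j)).
by apply: NA => j; rewrite -ltnS prednK // (leq_trans _ (dN j)).
Qed.

Lemma cvg_pos : pos d @[d --> @all_infty n] --> @all_infty n.
Proof.
by move=> A [N _ NA]; exists N => // d dN; apply: NA => j; exact: leqW (dN j).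
Qed.
End AllInfty.

Section ComplexTopology.
Context (R : realType) (D : Type) (F : set_system D) (FF : ProperFilter F).

Lemma gt0_real_complex (z : R[i]) : 0 < z -> 0 < complex.Re z /\ z = (complex.Re z)%:C.
Proof. by case: z => a b; rewrite ltcE /= => /andP[/eqP -> a0]; split. Qed.

Lemma cvg_real_complex (u : D -> R) (l : R) :
  u @ F --> l -> (u d)%:C @[d --> F] --> (l%:C : R[i]^o).
Proof.
move=> /cvgrPdist_lt ul; apply/(@cvgrPdist_lt _ R[i]^o) => e /gt0_real_complex[e0 ->].
near=> d; rewrite -rmorphB normc_def /= expr0n /= addr0 sqrtr_sqr ltcR.
by near: d; exact: ul.
Unshelve. all: by end_near. Qed.
End ComplexTopology.

Section Asymptotics.
Context (R : realType) (disp : measure_display) (T : measurableType disp).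
Variables (P : probability T R) (n : nat).
Hypothesis hn : (0 < n)%N.
Variables (p : ('I_n -> nat) -> nat)
  (G : forall d : 'I_n -> nat, T -> 'M[R[i]]_(#|midx d|, p d)).
Hypothesis hG : forall d : 'I_n -> nat, (forall j, (0 < d j)%N) ->
  std_gaussian_matrix P (G d).
Variable (c : R).
Hypothesis hp : (p d)%:R / (\prod_j d j)%N%:R @[d --> @all_infty n] --> c.
Local Notation pos d := (fun j : 'I_n => (d j).+1).
Local Notation word := (seq {ffun 'I_n -> bool}).

Let ratio (d : 'I_n -> nat) : R[i] := (p (pos d))%:R / #|{: mindex d}|%:R.
Let mean_trace (d : 'I_n -> nat) : word -> R[i] := @wishart_moment R n d (p (pos d)).
Let trace_at (d : 'I_n -> nat) (w : word) (t : T) : R[i] := @word_trace R _ T n d _ (G (pos d)) w t.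
Let dev (w : word) (d : 'I_n -> nat) (t : T) : R := @word_deviation R _ T n d _ (G (pos d)) w t.
Let kap0 : R[i] := (c + 1)%:C.

Let card_mindex (d : 'I_n -> nat) : #|{: mindex d}| = (\prod_j (d j).+1)%N.
Proof. exact: (card_midx (pos d)). Qed.

Let ratioE d : ratio d = ((p (pos d))%:R / (\prod_j (d j).+1)%N%:R)%:C.
Proof. by rewrite /ratio card_mindex rmorphM fmorphV !rmorph_nat. Qed.

Let ratio_cvg : ratio d @[d --> @all_infty n] --> (c%:C : R[i]^o).
Proof.
rewrite (_ : ratio = fun d => ((p (pos d))%:R / (\prod_j (d j).+1)%N%:R)%:C).
  by apply: cvg_real_complex; exact: cvg_comp _ _ (@cvg_pos n) hp.
by apply/funext => d; exact: ratioE.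
Qed.

Let ratio_bounded : \forall d \near @all_infty n, ratio d <= kap0.
Proof.
have /cvgrPdist_lt /(_ 1 ltr01) h := cvg_comp _ _ (@cvg_pos n) hp.
near=> d; rewrite ratioE lecR.
have : `|c - (p (pos d))%:R / (\prod_j (d j).+1)%N%:R| < 1 by near: d; exact: h.
by rewrite ltr_norml => /andP[h1 h2]; lra.
Unshelve. all: by end_near. Qed.

(** This is the [delta] of the Schwinger-Dyson estimates: it dominates every inverse leg dimension,
    hence also [N^-1]. *)
Let gap (d : 'I_n -> nat) : R[i] := \sum_j (d j).+1%:R^-1.

Let gap_ge d j : (d j).+1%:R^-1 <= gap d.
Proof.
by rewrite /gap (bigD1 j) //= lerDl sumr_ge0 // => k _; rewrite invr_ge0.
Qed.

Let gap_cvg0 : gap d @[d --> @all_infty n] --> (0 : R[i]^o).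
Proof.
have -> : (0 : R[i]) = (\sum_(j < n) 0)%:C by rewrite big1.
rewrite (_ : gap = fun d => (\sum_j (d j).+1%:R^-1)%:C); last first.
  by apply/funext => d; rewrite /gap rmorph_sum; apply: eq_bigr => j _; rewrite fmorphV rmorph_nat.
apply: cvg_real_complex; apply: cvg_big => [|j _]; first exact: add_continuous.
apply: (@cvg_comp _ _ _ (fun d : 'I_n -> nat => d j) (fun k : nat => k.+1%:R^-1) _ \oo).
  by move=> A [N _ NA]; exists N => // d dN; apply: NA; exact: dN.
exact: (@cvg_harmonic R).
Qed.

Lemma mean_trace_cvg w : mean_trace d w @[d --> @all_infty n] --> (limit_moment c%:C w : R[i]^o).
Proof.
apply: (@moment_cvg R[i] _ c%:C _ _ (all_infty_filter n) mean_trace ratio gap (Kmom kap0)).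
- exact: ratio_cvg.
- exact: gap_cvg0.
- near=> d; apply: (moment_nil (wishart_calculusP (kap0 := kap0) _)).
  by near: d; exact: ratio_bounded.
near=> d => e u.
have rd : ratio d <= kap0 by near: d; exact: ratio_bounded.
apply: (moment_sd (wishart_calculusP rd) (@leg_mix n d) (@leg_inj n d) _ (@card_leg n d)).
- by [].
- exact: gap_ge.
apply: le_trans (gap_ge d (Ordinal hn)).
rewrite lef_pV2 ?posrE ?ltr0n // ?ler_nat card_mindex; last exact: prodn_gt0.
by rewrite (bigD1 (Ordinal hn)) //= leq_pmulr // prodn_gt0.
Unshelve. all: by end_near. Qed.

Lemma trace_deviation w :
  {ae P, forall t, trace_at d w t - mean_trace d w @[d --> @all_infty n] --> (0 : R[i]^o)}.
Proof.
have [N _ Nratio] := ratio_bounded.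
pose K : R := Num.max 0 (complex.Re (Kc kap0 (size w) (size w))).
(* Finite functions make the index type countable. The deviation is replaced by [0] where the
   variance bound may fail; the limit does not see those multi-indices. *)
pose f (d : {ffun 'I_n -> nat}) t : R := if [forall j, (N <= d j)%N] then dev w d t else 0.
have dev_var (d : 'I_n -> nat) : ratio d <= kap0 ->
    P.-integrable [set: T] (EFin \o dev w d) /\
    (\int[P]_t dev w d t)%R <= K * \prod_j (d j).+1%:R ^- 2.
  move=> rd; have [|i1 i2] := @word_variance _ _ T P n d _ (G (pos d)) _ kap0 w rd.
    exact: hG.
  split => //; have E : #|{: mindex d}|%:R^-1 ^+ 2 = (\prod_j (d j).+1%:R ^- 2)%:C :> R[i].
    rewrite card_mindex natr_prod -prodfV -prodrXl rmorph_prod.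
    by apply: eq_bigr => j _; rewrite fmorphV rmorphXn rmorph_nat exprVn.
  move: i2; rewrite E lecE => /andP[_] /=.
  rewrite -/(dev w d); case: (Kc _ _ _) @K => a b K /=; rewrite mulr0 subr0 => i2.
  apply: le_trans i2 _; rewrite ler_wpM2r ?le_max ?lexx ?orbT //.
  by apply: prodr_ge0 => j _; rewrite invr_ge0 exprn_ge0.
have dev_ge0 d t : 0 <= dev w d t.
  by rewrite -lecR /dev word_deviationE exprn_ge0.
have K0 : 0 <= K by rewrite le_max lexx.
have bnd0 (d : 'I_n -> nat) : 0 <= K * \prod_j (d j).+1%:R ^- 2.
  by rewrite mulr_ge0 // prodr_ge0 // => j _; rewrite invr_ge0 exprn_ge0.
have fP d : P.-integrable [set: T] (EFin \o f d) /\
    (\int[P]_t f d t)%R <= K * \prod_j (d j).+1%:R ^- 2.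
  rewrite /f; case: (boolP [forall j, (N <= d j)%N]) => [/forallP h|_].
    by apply: dev_var; exact: Nratio.
  split; first exact: integrable0.
  by rewrite Rintegral_cst // mul0r.
have := @ae_summable_cvg0 _ _ T P _ f (K * 2 ^+ n).
case => [d t|d|s us|A [mA PA sub]].
- by rewrite /f; case: ifP.
- exact: (fP d).1.
- apply: le_trans (ler_sum _ (fun d _ => (fP d).2)) _.
  by rewrite -mulr_sumr ler_wpM2l // sum_prod_inv_sqr.
exists A; split; [exact: mA|exact: PA|].
apply: subset_trans sub; apply: subsetC => t small.
apply/(@cvgrPdist_lt _ R[i]^o) => e /gt0_real_complex[e0 ->].
have [s hs] := small _ (exprn_gt0 2 e0).
(* A multi-index whose legs all exceed [M] is outside the finite exceptional list. *)
pose M := (\max_(d <- s) \max_j d j)%N.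
exists (maxn N M.+1) => // d dN; rewrite /= sub0r normrN.
have /hs : [ffun j => d j] \notin s.
  apply/negP => ds; have := dN (Ordinal hn); rewrite leqNgt => /negP; apply.
  rewrite leq_max ltnS; apply/orP; right.
  have : (\max_j ([ffun j => d j] : {ffun 'I_n -> nat}) j <= M)%N by apply: (leq_bigmax_seq _ ds isT).
  apply: leq_trans; have := @leq_bigmax _ ([ffun j => d j] : {ffun _ -> nat}) (Ordinal hn).
  by rewrite ffunE.
rewrite /f (_ : fun_of_fin [ffun j => d j] = d); last by apply/funext => j; rewrite ffunE.
rewrite (_ : [forall j, _]); last by apply/forallP => j; rewrite (leq_trans _ (dN j)) ?leq_maxl.
have := word_deviationE (G (pos d)) w t.
rewrite -/(dev w d t) -/(trace_at d w t) -/(mean_trace d w) -ltcR => ->.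
have e0' : 0 <= (complex.Re e)%:C by rewrite lecR ltW.
by rewrite rmorphXn /= ltr_pXn2r.
Qed.

Lemma trace_cvg : {ae P, forall t, forall w : word,
  ntr (\prod_(s <- w) ptranspose s (wishart (G d t))) @[d --> @all_infty n] -->
    (limit_moment c%:C w : R[i]^o)}.
Proof.
(* There are countably many words, so their null sets can be joined; numbers that code no word get
   the trivial statement. *)
pose Q (w : word) t := trace_at d w t - mean_trace d w @[d --> @all_infty n] --> (0 : R[i]^o).
pose Qo (o : option word) t := oapp (Q^~ t) True o.
have QP (o : option word) : {ae P, forall t, Qo o t}.
  by case: o => [w|]; [exact: trace_deviation|exact: aeW].
have := ae_foralln (fun k => QP (unpickle k)); apply: filterS => t h w.
have {h}Qwt : Q w t by have := h (pickle w); rewrite pickleK.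
apply: (@cvg_all_infty_shift n R[i]^o
  (fun d => ntr (\prod_(s <- w) ptranspose s (wishart (G d t))))).
rewrite (_ : (fun d => _) = fun d => trace_at d w t - mean_trace d w + mean_trace d w).
  by rewrite -[X in _ --> X]add0r; exact: (@cvgD R[i] R[i]^o _ _ _ _ _ _ _ Qwt (mean_trace_cvg (w := w))).
by apply/funext => d; rewrite subrK.
Qed.
End Asymptotics.

Theorem theorem2p5 (R : realType) (disp : measure_display)
    (T : measurableType disp) (P : probability T R)
    (n : nat) (hn : (2 <= n)%N)
    (p : ('I_n -> nat) -> nat)
    (G : forall d : 'I_n -> nat, T -> 'M[R[i]]_(#|midx d|, p d))
    (hG : forall d : 'I_n -> nat, (forall j, (0 < d j)%N) ->
       std_gaussian_matrix P (G d))
    (c : R) (hc : 0 < c)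
    (hp : (p d)%:R / (\prod_j d j)%N%:R @[d --> @all_infty n] --> c) :
  as_asymptotically_free P (@all_infty n)
    (fun (d : 'I_n -> nat) (s : {ffun 'I_n -> bool}) (t : T) =>
       ptranspose s (wishart (G d t))).
Proof.
have sd (e : {ffun 'I_n -> bool}) u : limit_moment (c%:C : R[i]) (e :: u) =
    c%:C * limit_moment c%:C u + \sum_(k < size u) (e == nth e u k)%:R *
      (weight c%:C e * (limit_moment c%:C (take k u ++ nseq (left_pad e) e) *
                        limit_moment c%:C (nseq (right_pad e) e ++ drop k.+1 u))).
  rewrite limit_moment_sd; congr (_ + _); apply: eq_bigr => k _.
  by rewrite sdtermE.
have [A [phi [w [phi1 fr phiE]]]] := free_realization (erefl _) sd (fun e => leq_b1 _).
exists A, phi, w; split => //.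
have := trace_cvg (ltnW hn) hG hp.
by apply: filterS => t h e; rewrite phiE; exact: h.
Qed.
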